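(* Let $(V_m)_{1\le m\le d}$ be an orthonormal family of bounded functions of $L^2(W,\mathbb{R})$. Set $V(x)=d^{-1/2}(V_1(x),\dots,V_d(x))^\top$ for $x\in W$ and $\pi(y,x)=y^\top V(x)$. Then $$\mathcal V(y):=\int_WV(x)\,\pi(y,x)\,\mathrm dx=\frac yd ,$$ so that $\nabla\cdot\mathcal V\equiv1$. With $D$ and $\nabla$ the operators associated with this choice of $(\pi,V)$ (see context), for every $F\in\mathrm{Dom}(D)$ with form functions $(f_n)$, $$\nabla F=-\frac1d\sum_{n\ge1}\mathbf 1(N(W)=n)\sum_{i=1}^n\nabla_{x_i}f_n(X_1,\dots,X_n)\cdot X_i .$$ Finally, for any $F\in\mathrm{Dom}(\overline D)$, $$\mathbb{E}[\nabla F]=\mathbb{E}\left[F\,(N(W)-\theta|W|)\right].$$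
   Context: Point process. $W\subset\mathbb{R}^d$ is a compact set with positive Lebesgue measure $|W|$ and $\mathcal{C}^2$ boundary (the closure of a bounded open set with $\mathcal C^2$ boundary). $\mathbf{X}$ is a homogeneous Poisson point process on $\mathbb{R}^d$ with intensity $\theta>0$, $N(W)$ is the number of points of $\mathbf{X}\cap W$, and given $N(W)=n$ these points are denoted $X_1,\dots,X_n$. $L^2(\Omega)=L^2(\Omega,\mathcal F_W,\mathbb P)$ with $\mathcal F_W$ the $\sigma$-field generated by the points of $\mathbf X$ in $W$. Functionals. $\mathcal S$ is the set of $F=f_0\mathbf 1(N(W)=0)+\sum_{n\ge1}\mathbf 1(N(W)=n)f_n(X_1,\dots,X_n)$ with $f_0\in\mathbb{R}$ and each $f_n\in L^1(W^n,\mathbb{R})$ symmetric (form functions). $\mathcal S'$ is the set of $F\in\mathcal S$ for which there is $C>0$ such that for all $n\ge1$, $f_n\in\mathcal C^1(W^n,\mathbb{R})$ and $\|f_n\|_{L^\infty}+\sum_{i=1}^n\|\nabla_{x_i}f_n\|_{L^\infty}\le C^n$. $\mathrm{Dom}(D)$ is the set of $F\in\mathcal S'$ with $f_{n+1}(z_1,\dots,z_n,z_{n+1})=f_n(z_1,\dots,z_n)$ for all $n\ge1$, $z_1,\dots,z_n\in W$, $z_{n+1}\in\partial W$, and $f_1(z)=f_0$ for $z\in\partial W$. Operators. For $F\in\mathrm{Dom}(D)$ and $x\in W$, $D_xF=-\sum_{n\ge1}\mathbf 1(N(W)=n)\sum_{i=1}^n(\nabla_{x_i}f_n)(X_1,\dots,X_n)\,\pi(X_i,x)\in\mathbb{R}^d$,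 viewed as an operator $D$ from $\mathrm{Dom}(D)\subset L^2(\Omega)$ to $L^2(\Omega,L^2(W,\mathbb{R}^d))$, and $\nabla F=\int_WD_xF\cdot V(x)\,\mathrm dx$. The operator $D$ is closable; $\mathrm{Dom}(\overline D)$ is the domain of its closure, i.e. the set of $F\in L^2(\Omega)$ for which there are $F_\ell\in\mathrm{Dom}(D)$ with $F_\ell\to F$ in $L^2(\Omega)$ and $DF_\ell$ convergent in $L^2(\Omega,L^2(W,\mathbb{R}^d))$; then $\nabla F:=\lim\nabla F_\ell$ in $L^2(\Omega)$ (the same symbol denotes the extension). *)

(* Defs.v *)
From HB Require Import structures.
From mathcomp Require Import all_boot all_order all_fingroup all_algebra finmap.
From mathcomp Require Import all_classical all_reals all_analysis.

Set Implicit Arguments.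
Unset Strict Implicit.
Unset Printing Implicit Defensive.

Import Order.TTheory GRing.Theory Num.Theory.
Import numFieldNormedType.Exports.

Local Open Scope classical_set_scope.
Local Open Scope ring_scope.

(* A point of R^d is a row vector ['rV[R]_d]; a point (x_1, ..., x_n) of
   (R^d)^n is a matrix ['M[R]_(n, d)] whose i-th row is x_i. *)

(* These sets generate the product of the Borel sigma-algebras of R, which is
   the Borel sigma-algebra of R^(m * n). *)
Definition mx_cylinders (R : realType) (m n : nat) : set (set 'M[R]_(m, n)) :=
  [set A | exists i j (B : set R),
     measurable B /\ A = [set x : 'M[R]_(m, n) | B (x i j)]].

Section matrix_measurable.
Context (R : realType) (m n : nat).
Let G := @mx_cylinders R m n.

HB.instance Definition _ := @isMeasurable.Build (sigma_display G) 'M[R]_(m, n)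
  <<s G >> (@sigma_algebra0 _ setT G) (@sigma_algebraC _ G)
  (@sigma_algebra_bigcup _ setT G).
End matrix_measurable.

Section lebesgue_tuple_step.
Context (R : realType) (k : nat).
Variable nu : {sigma_finite_measure set (k.-tuple R) -> \bar R}.
Local Open Scope ereal_scope.

Let lam : {sigma_finite_measure set (measurableTypeR R) -> \bar R} :=
  @lebesgue_measure R.

Let cons_tup (p : measurableTypeR R * k.-tuple R) : k.+1.-tuple R :=
  [the k.+1.-tuple R of p.1 :: p.2].

Let measurable_cons_tup : measurable_fun [set: _] cons_tup.
Proof.
by apply: measurable_cons; [exact: measurable_fst|exact: measurable_snd].
Qed.

Definition leb_step : set (k.+1.-tuple R) -> \bar R :=
  pushforward (lam \x nu) cons_tup.

HB.instance Definition _ := Measure.copy leb_step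
  (@measure_function_pushforward__canonical__measure_function_Measure
     _ _ _ _ _ _ _ measurable_cons_tup).

Let leb_step_sigma_finite : sigma_finite setT leb_step.
Proof.
have /sigma_finiteP[A [TA ndA Aoo]] := sigma_finiteT lam.
have /sigma_finiteP[B [TB ndB Boo]] := sigma_finiteT nu.
pose uncons (t : k.+1.-tuple R) : measurableTypeR R * k.-tuple R :=
  (thead t, [tuple of behead t]).
have consK : cancel cons_tup uncons.
  by move=> [x t]; rewrite /uncons /cons_tup theadE/=; congr pair; exact: val_inj.
have muncons : measurable_fun [set: k.+1.-tuple R] uncons.
  by apply: measurable_fun_pair; [exact: measurable_tnth|exact: measurable_behead].
exists (fun i => uncons @^-1` (A i `*` B i)) => [|i].
  apply/esym; rewrite -subTset => t _.
  have [i _ Ai] : (\bigcup_i A i) (uncons t).1 by rewrite -TA.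
  have [j _ Bj] : (\bigcup_i B i) (uncons t).2 by rewrite -TB.
  exists (maxn i j) => //; split => /=.
    by move: Ai; exact/subsetPset/ndA/leq_maxl.
  by move: Bj; exact/subsetPset/ndB/leq_maxr.
have [mA Ai] := Aoo i; have [mB Bi] := Boo i; split.
  by rewrite -[X in measurable X]setTI; apply: muncons => //; exact: measurableX.
rewrite /leb_step /pushforward -comp_preimage.
rewrite (_ : uncons \o cons_tup = id); last first.
  by apply/funext => p /=; rewrite consK.
by rewrite preimage_id product_measure1E// lte_mul_pinfty// ge0_fin_numE.
Qed.

HB.instance Definition _ :=
  Measure_isSigmaFinite.Build _ _ _ leb_step leb_step_sigma_finite.

End lebesgue_tuple_step.

Section lebesgue_tuple0.
Context (R : realType).

Fixpoint leb_tuple (k : nat) : {sigma_finite_measure set (k.-tuple R) -> \bar R} :=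
  if k is k'.+1 then leb_step (leb_tuple k') else @dirac _ (0.-tuple R) [tuple] R.
End lebesgue_tuple0.

Section lebesgue_matrix.
Context (R : realType) (m n : nat).

Let mx_of_tuple (t : (m * n).-tuple R) : 'M[R]_(m, n) :=
  \matrix_(i, j) tnth t (mxvec_index i j).

Let measurable_mx_of_tuple : measurable_fun [set: _] mx_of_tuple.
Proof.
apply: measurability => //.
move=> _ [_ [i [j [B [mB ->]]]] <-]; rewrite setTI.
rewrite (_ : _ @^-1` _ = (@tnth _ R ^~ (mxvec_index i j)) @^-1` B).
  by rewrite -[X in measurable X]setTI; exact: measurable_tnth.
by apply/seteqP; split => t /=; rewrite mxE.
Qed.

Definition leb_mx : set 'M[R]_(m, n) -> \bar R :=
  pushforward (@leb_tuple R (m * n)) mx_of_tuple.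

HB.instance Definition _ := Measure.copy leb_mx
  (@measure_function_pushforward__canonical__measure_function_Measure
     _ _ _ _ _ _ _ measurable_mx_of_tuple).
End lebesgue_matrix.
Arguments leb_mx {R m n}.

Section window.
Context {R : realType} {d : nat}.
Implicit Types (W U B : set 'rV[R]_d) (phi : 'rV[R]_d -> R).

Definition dotv (u v : 'rV[R]_d) : R := \sum_(k < d) u 0 k * v 0 k.

Definition enorm (u : 'rV[R]_d) : R := Num.sqrt (dotv u u).

Definition boundary U : set 'rV[R]_d := closure U `\` U^°.

Definition C1_on B phi :=
  forall x, B x -> differentiable phi x /\
    forall v, {for x, continuous (fun y => 'D_v phi y)}.

Definition C2_on B phi :=
  C1_on B phi /\ forall v, C1_on B (fun y => 'D_v phi y).

(* Near each boundary point, the open set U is a strict sublevel set of a C^2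
   function whose gradient does not vanish at that point. *)
Definition C2_boundary U :=
  forall p, boundary U p -> exists B phi,
    [/\ open B, B p, C2_on B phi, exists v, 'D_v phi p != 0 &
        U `&` B = [set x | phi x < 0] `&` B].

Definition window W :=
  [/\ compact W, (0 < leb_mx W)%E &
      exists U, [/\ open U, bounded_set U, C2_boundary U & W = closure U]].

Definition window_pow W (n : nat) : set 'M[R]_(n, d) :=
  [set z | forall i, W (row i z)].

End window.
Arguments window_pow {R d} W n.

Section point_process.
Context {R : realType} {d : nat} {disp : measure_display}
  {Omega : measurableType disp}.
Variables (P : probability Omega R) (X : Omega -> set 'rV[R]_d).

(* Meaningful when [X w `&` A] is finite, in particular for bounded A. *)
Definition count_in (A : set 'rV[R]_d) (w : Omega) : nat :=
  #|` fset_set (X w `&` A)|.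

(* The points of [X w `&` A], in an arbitrary order: only symmetric functions
   are evaluated at this matrix. *)
Definition points_in (A : set 'rV[R]_d) (w : Omega) : 'M[R]_(count_in A w, d) :=
  \matrix_(i, k) (nth 0 (fset_set (X w `&` A)) i) 0 k.

Definition homogeneous_Poisson (theta : R) :=
  [/\ forall w (A : set 'rV[R]_d), bounded_set A -> finite_set (X w `&` A),
      forall (A : set 'rV[R]_d) (k : nat), measurable A -> bounded_set A ->
        measurable [set w | count_in A w = k],
      forall (A : set 'rV[R]_d) (k : nat), measurable A -> bounded_set A ->
        let rate := theta * fine (leb_mx A) in
        P [set w | count_in A w = k] =
          (rate ^+ k / (k`!)%:R * expR (- rate))%:E &
      forall n (A : 'I_n -> set 'rV[R]_d) (k : 'I_n -> nat),
        (forall i, measurable (A i) /\ bounded_set (A i)) ->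
        trivIset setT A ->
        P (\bigcap_i [set w | count_in (A i) w = k i]) =
          (\prod_(i < n) P [set w | count_in (A i) w = k i])%E].

End point_process.

Section malliavin.
Context {R : realType} {d : nat} {disp : measure_display}
  {Omega : measurableType disp}.
Variables (P : probability Omega R) (X : Omega -> set 'rV[R]_d).
Variable W : set 'rV[R]_d.

Local Notation N := (count_in X W).
Local Notation pts := (points_in X W).

Definition FW_generators : set (set Omega) :=
  [set E | exists (A : set 'rV[R]_d) (k : nat),
    [/\ measurable A, A `<=` W & E = [set w | count_in X A w = k]]].

(* Omega equipped with the sigma-field generated by the points of X in W. *)
Definition OmegaW := g_sigma_algebraType FW_generators.

Definition L2_Omega (F : Omega -> R) :=
  measurable_fun [set: OmegaW] (F : OmegaW -> R) /\
  ('N[P]_2%:E[EFin \o F] < +oo)%E.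

Definition cvg_L2_Omega (Fl : nat -> Omega -> R) (F : Omega -> R) :=
  ('N[P]_2%:E[EFin \o (Fl l \- F)%R])%E @[l --> \oo] --> 0%E.

(* The squared norm of L^2(Omega, L^2(W, R^d)). *)
Definition sqnorm_L2_OmegaW (G : Omega -> 'rV[R]_d -> 'rV[R]_d) : \bar R :=
  (\int[P]_w \int[leb_mx]_(x in W) (enorm (G w x) ^+ 2)%:E)%E.

Definition L2_OmegaW (G : Omega -> 'rV[R]_d -> 'rV[R]_d) :=
  (forall k, measurable_fun ([set: OmegaW] `*` W)
     (fun p : OmegaW * 'rV[R]_d => G p.1 p.2 0 k)) /\
  (sqnorm_L2_OmegaW G < +oo)%E.

Definition cvg_L2_OmegaW (Gl : nat -> Omega -> 'rV[R]_d -> 'rV[R]_d)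
    (G : Omega -> 'rV[R]_d -> 'rV[R]_d) :=
  sqnorm_L2_OmegaW (fun w x => Gl l w x - G w x) @[l --> \oo] --> 0%E.

(* Form functions (f_n); only the restriction of [f n] to W^n matters.  Since
   ['M_(0, d)] has a single element, [f 0] is the constant f_0. *)
Definition forms := forall n : nat, 'M[R]_(n, d) -> R.

(* The sum over n of 1(N(W) = n) f_n(X_1, ..., X_n) has the single nonzero term
   n = N(W). *)
Definition functional (f : forms) (w : Omega) : R := f (N w) (pts w).

Definition form_S (f : forms) :=
  forall n,
    (forall (s : 'S_n) z, window_pow W n z -> f n (row_perm s z) = f n z) /\
    leb_mx.-integrable (window_pow W n) (EFin \o f n).

(* C^1 on the closed set W^n: the partial derivatives in the interior extend
   continuously to W^n. *)
Definition C1_window n (g : 'M[R]_(n, d) -> R) :=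
  [/\ {within window_pow W n, continuous g},
      forall z, (window_pow W n)^° z -> differentiable g z &
      exists G : 'M[R]_(n, d) -> 'M[R]_(n, d),
        {within window_pow W n, continuous G} /\
        forall z i k, (window_pow W n)^° z -> 'D_(delta_mx i k) g z = G z i k].

(* The gradient with respect to x_i, extended by continuity up to the boundary
   of W^n. *)
Definition grad n (g : 'M[R]_(n, d) -> R) (i : 'I_n) (z : 'M[R]_(n, d)) :
    'rV[R]_d :=
  lim ((fun y => \row_(k < d) 'D_(delta_mx i k) g y)
         @ within (window_pow W n)^° (nbhs z)).

Definition Linfty_norm n (g : 'M[R]_(n, d) -> R) : \bar R :=
  'N[leb_mx]_+oo[(EFin \o g) \_ (window_pow W n)].

Definition form_S' (f : forms) :=
  form_S f /\ exists2 C : R, 0 < C & forall n, (0 < n)%N ->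
    C1_window (f n) /\
    (Linfty_norm (f n) + \sum_(i < n) Linfty_norm (fun z => enorm (grad (f n) i z))
       <= (C ^+ n)%:E)%E.

Definition DomD (f : forms) :=
  form_S' f /\
  forall n (z : 'M[R]_(n, d)) (x : 'rV[R]_d),
    window_pow W n z -> boundary W x -> f (n + 1)%N (col_mx z x) = f n z.

Variables (pi : 'rV[R]_d -> 'rV[R]_d -> R) (V : 'rV[R]_d -> 'rV[R]_d).

Definition opD (f : forms) (w : Omega) (x : 'rV[R]_d) : 'rV[R]_d :=
  - \sum_(i < N w) pi (row i (pts w)) x *: grad (f (N w)) i (pts w).

Definition nabla (f : forms) (w : Omega) : R :=
  \int[leb_mx]_(x in W) dotv (opD f w x) (V x).

Definition approximates (fl : nat -> forms) (F : Omega -> R) :=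
  [/\ L2_Omega F, forall l, DomD (fl l),
      cvg_L2_Omega (fun l => functional (fl l)) F &
      exists2 G, L2_OmegaW G & cvg_L2_OmegaW (fun l => opD (fl l)) G].

Definition DomDbar (F : Omega -> R) := exists fl, approximates fl F.

(* H is (a version of) the extension of nabla to F. *)
Definition is_nabla (F H : Omega -> R) :=
  exists fl, [/\ approximates fl F, L2_Omega H &
    cvg_L2_Omega (fun l => nabla (fl l)) H].

End malliavin.

Section orthonormal.
Context {R : realType} {d : nat}.
Implicit Types (W : set 'rV[R]_d) (v : 'I_d -> 'rV[R]_d -> R).

Definition bounded_L2 W (h : 'rV[R]_d -> R) :=
  [/\ measurable_fun W h,
      (\int[leb_mx]_(x in W) (h x ^+ 2)%:E < +oo)%E &
      exists M, forall x, W x -> `|h x| <= M].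

Definition orthonormal_L2 W v :=
  forall m l, \int[leb_mx]_(x in W) (v m x * v l x) = (m == l)%:R.

Definition stack v (x : 'rV[R]_d) : 'rV[R]_d :=
  \row_m ((Num.sqrt d%:R)^-1 * v m x).

Definition vfield W (pi : 'rV[R]_d -> 'rV[R]_d -> R) (V : 'rV[R]_d -> 'rV[R]_d)
    (y : 'rV[R]_d) : 'rV[R]_d :=
  \row_k \int[leb_mx]_(x in W) (V x 0 k * pi y x).

Definition divergence (g : 'rV[R]_d -> 'rV[R]_d) (y : 'rV[R]_d) : R :=
  \sum_(k < d) 'D_(delta_mx 0 k) (fun z => g z 0 k) y.

End orthonormal.

(* Main.v *)
(* A Gauss-Green formula for f(x_1, ..., x_n): dilating the last point by
   1 + h multiplies the integral over W^n of the excess of f_n over its boundary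
   value f_{n-1} by (1 + h)^-d, and dominated convergence as h -> 0 gives
     int_{W^n} <grad_{x_n} f_n, x_n> = -d (int_{W^n} f_n - |W| int_{W^{n-1}} f_{n-1});
   it is here that the boundary of W must be a null set.  By symmetry the same
   value is obtained for the other points.  The counts of a Poisson process in
   the cells of a fine partition of W determine the law of its points up to
   order, hence E[F; N(W) = n] = e^{-theta |W|} theta^n / n! int_{W^n} f_n.
   Summing over n gives E[nabla F] = E[F (N(W) - theta |W|)] on Dom(D).  Finally
   nabla F = <D F, V> in L^2(W, R^d), where V is a unit vector, so that nabla is
   continuous with respect to D and both sides pass to the closure. *)
Require Import Defs.
From HB Require Import structures.
From mathcomp Require Import all_boot all_order all_fingroup all_algebra finmap.
From mathcomp Require Import all_classical all_reals all_analysis.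
From mathcomp Require Import measurable_realfun ess_sup_inf ring lra.

Set Implicit Arguments.
Unset Strict Implicit.
Unset Printing Implicit Defensive.

Import Order.TTheory GRing.Theory Num.Theory.
Import numFieldNormedType.Exports.

Local Open Scope classical_set_scope.
Local Open Scope ring_scope.

(** * Lebesgue measure on matrices *)

(** The obstacle is that W need not be star-shaped and gradients are controlled only in the interior
    of W^n. When the last point is dilated about the origin it may leave and re-enter W many times,
    so the excess, extended by zero, need not be differentiable along the ray. It is nevertheless
    continuous there, vanishes as soon as the moving point is outside the interior of W, and
    elsewhere has a derivative bounded by a constant depending only on f_n. A mean value inequality
    that ignores the zeros turns this into a uniform bound on the difference quotients, which is the
    domination needed for h -> 0. The constant d arises only as minus the derivative at t = 1 of the
    Jacobian t^-d. On the probabilistic side only counts have a law. Configurations are therefore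
    coded by the word of the cells of their points, considered up to order, and a multinomial count
    converts unordered words into a sum over all words, which is also the integral of a step
    function over W^n. The bounds C^n on the form functions become K^N for the number N of points;
    such a variable is integrable because a Poisson count has all exponential moments, and this
    controls both the sum over n and the L^2 norms. *)

Section leb_box.
Context (R : realType).

Lemma leb_tuple_box k (B : 'I_k -> set R) : (forall i, measurable (B i)) ->
  leb_tuple R k [set t | forall i, B i (tnth t i)] =
  (\prod_(i < k) lebesgue_measure (B i))%E.
Proof.
elim: k B => [|k IH] B mB.
  rewrite big_ord0 /= diracE mem_set// => -[] //.
have mk : measurable [set t : k.-tuple R | forall i, B (lift ord0 i) (tnth t i)].
  rewrite (_ : mkset _ =
      \bigcap_i ((@tnth _ R ^~ i) @^-1` B (lift ord0 i))); last first.
    by apply/seteqP; split => t /= tB i *; exact: tB.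
  apply: fin_bigcap_measurable; first exact: finite_finset.
  by move=> i _; rewrite -[X in measurable X]setTI; exact: measurable_tnth.
rewrite big_ord_recl -IH// -product_measure1E// /=.
rewrite /leb_step /pushforward; set X := _ @^-1` _; set Y := _ `*` _.
  suff -> : X = Y by [].
  apply/seteqP; split => [[x t]|[x t]] /=.
    move=> H; split => [|i]; [exact: (H ord0)|].
    by have := H (lift ord0 i); rewrite tnthS.
  by move=> [Bx Bt] i; case: (unliftP ord0 i) => [j|] ->; rewrite ?tnthS ?tnth0.
exact: mB.
Qed.

Definition mx_box m n (B : 'I_m -> 'I_n -> set R) : set 'M[R]_(m, n) :=
  [set x | forall i j, B i j (x i j)].

Lemma measurable_mx_box m n (B : 'I_m -> 'I_n -> set R) :
  (forall i j, measurable (B i j)) -> measurable (mx_box B).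
Proof.
move=> mB; rewrite (_ : mx_box B =
    \bigcap_i \bigcap_j [set x : 'M[R]_(m, n) | B i j (x i j)]); last first.
  apply/seteqP; split => x /= Bx i; first by move=> _ j _; exact: Bx.
  by move=> j; exact: Bx.
apply: fin_bigcap_measurable => [|i _]; first exact: finite_finset.
apply: fin_bigcap_measurable => [|j _]; first exact: finite_finset.
by apply: sub_sigma_algebra; exists i, j, (B i j).
Qed.

Lemma leb_mx_box m n (B : 'I_m -> 'I_n -> set R) :
  (forall i j, measurable (B i j)) ->
  leb_mx (mx_box B) = (\prod_(i < m) \prod_(j < n) lebesgue_measure (B i j))%E.
Proof.
move=> mB; rewrite /leb_mx/= /pushforward.
have bij := curry_mxvec_bij m n.
pose C k := let: (i, j) := enum_val (cast_ord (esym (mxvec_cast m n)) k) in B i j.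
have CE i j : C (mxvec_index i j) = B i j.
  by rewrite /C /mxvec_index cast_ordK enum_rankK.
rewrite (_ : _ @^-1` _ = [set t | forall k, C k (tnth t k)]); last first.
  apply/seteqP; split => t /=.
    by move=> Bt k; case/mxvec_indexP: k => i j; rewrite CE; have := Bt i j; rewrite mxE.
  by move=> Ct i j; rewrite mxE -CE.
rewrite leb_tuple_box; last by move=> k; case/mxvec_indexP: k => i j; rewrite CE.
rewrite pair_big (reindex _ bij)/=.
by apply: eq_bigr => -[i j] _ /=; rewrite CE.
Qed.

Lemma le_mx_norm_entry m n (x : 'M[R]_(m, n)) i j : `|x i j| <= `|x|.
Proof.
rewrite [leRHS]/Num.norm/= mx_normrE.
exact: (le_bigmax _ (fun ij => `|x ij.1 ij.2|) (i, j)).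
Qed.

Lemma mx_norm_le m n (x : 'M[R]_(m, n)) (e : R) : 0 <= e ->
  (forall i j, `|x i j| <= e) -> `|x| <= e.
Proof.
move=> e0 xe; rewrite [leLHS]/Num.norm/= mx_normrE.
by apply/bigmax_leP; split => // ij _; exact: xe.
Qed.

Definition mx_cube m n (k : nat) : set 'M[R]_(m, n) :=
  mx_box (fun _ _ => `[- k%:R, k%:R]%classic).

Arguments mx_cube : clear implicits.

Lemma bigcup_mx_cube m n :
  \bigcup_(k : nat) mx_cube m n k = [set: 'M[R]_(m, n)].
Proof.
rewrite -subTset => x _.
have [k xk] : exists k : nat, `|x| <= k%:R.
  by exists (Num.truncn `|x|).+1; apply/ltW; exact: truncnS_gt.
exists k => // i j; by rewrite /= in_itv/= -ler_norml (le_trans _ xk)// le_mx_norm_entry.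
Qed.

Lemma leb_mx_cube m n (k : nat) :
  (leb_mx (mx_cube m n k) < +oo)%E.
Proof.
rewrite leb_mx_box//.
have [r E] : exists r : R, lebesgue_measure `[- k%:R, k%:R]%classic = r%:E.
  rewrite lebesgue_measure_itv/=; case: ifPn => _; last by exists 0.
  by exists (k%:R - - k%:R); rewrite EFinB.
under eq_bigr do under eq_bigr do rewrite E.
under eq_bigr do rewrite prodEFin.
by rewrite prodEFin ltry.
Qed.

Lemma leb_mx_sigma_finite m n : sigma_finite [set: 'M[R]_(m, n)] leb_mx.
Proof.
exists (mx_cube m n).
  by rewrite bigcup_mx_cube.
by move=> k; split; [exact: measurable_mx_box|exact: leb_mx_cube].
Qed.

HB.instance Definition _ m n := Measure_isSigmaFinite.Build _ _ _
  (@leb_mx R m n) (@leb_mx_sigma_finite m n).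

(** Boxes are stable under intersection and generate the cylinder sigma-algebra, and cubes of finite
    measure exhaust the space. The changes of variables below are reduced to boxes in this way. *)
Lemma leb_mx_unique m n (mu : {measure set 'M[R]_(m, n) -> \bar R}) :
  (forall B, (forall i j, measurable (B i j)) -> mu (mx_box B) =
    (\prod_(i < m) \prod_(j < n) lebesgue_measure (B i j))%E) ->
  forall A, measurable A -> mu A = leb_mx A.
Proof.
move=> muB A mA.
pose G := [set C : set 'M[R]_(m, n) | exists2 B,
  (forall i j, measurable (B i j)) & C = mx_box B].
apply: (@measure_unique _ _ _ G (mx_cube m n)) => //.
- apply/seteqP; split => X.
    apply: smallest_sub; first exact: smallest_sigma_algebra.
    move=> _ [i [j [B [mB ->]]]]; apply: sub_sigma_algebra.
    exists (fun i' j' => if (i' == i) && (j' == j) then B else setT).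
      by move=> i' j'; case: ifP.
    apply/seteqP; split => x /=.
      by move=> Bx i' j'; case: ifP => // /andP[/eqP-> /eqP->].
    by move=> /(_ i j); rewrite !eqxx.
  apply: smallest_sub; first exact: sigma_algebra_measurable.
  by move=> _ [B mB ->]; exact: measurable_mx_box.
- move=> _ _ [B mB ->] [C mC ->]; exists (fun i j => B i j `&` C i j).
    by move=> i j; exact: measurableI.
  apply/seteqP; split => x /=; first by move=> [Bx Cx] i j; split.
  by move=> BC; split => i j; have [] := BC i j.
- by move=> k; exists (fun _ _ => `[- k%:R, k%:R]%classic).
- exact: bigcup_mx_cube.
- by move=> _ [B mB ->]; rewrite muB//; apply: esym; exact: leb_mx_box.
- by move=> k; rewrite muB//; have := leb_mx_cube m n k; rewrite leb_mx_box.
Qed.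
End leb_box.
Arguments mx_cube {R} m n k.

(** Packages a push-forward as a measure with known values, so that uniqueness theorems can be
    applied to it. *)
Lemma image_measure d1 d2 (T1 : measurableType d1) (T2 : measurableType d2)
    (R : realType) (m : {measure set T1 -> \bar R}) (f : T1 -> T2) :
  measurable_fun setT f ->
  {mu : {measure set T2 -> \bar R} | forall A, mu A = m (f @^-1` A)}.
Proof.
move=> mf; exists (@measure_function_pushforward__canonical__measure_function_Measure
  _ _ _ _ R m f mf).
by [].
Qed.

Section leb_affine.
Context (R : realType).

Lemma measurable_mx_coord m n i j :
  measurable_fun [set: 'M[R]_(m, n)] (fun z : 'M[R]_(m, n) => z i j).
Proof.
move=> _ B mB; rewrite setTI.
by apply: sub_sigma_algebra; exists i, j, B.
Qed.

Lemma measurable_fun_mx d (T : measurableType d) (D : set T) m n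
    (f : T -> 'M[R]_(m, n)) :
  (forall i j, measurable_fun D (fun x => f x i j)) -> measurable_fun D f.
Proof.
move=> mf mD; move: (mD); apply: measurability => //.
move=> _ [_ [i [j [B [mB ->]]]] <-].
exact: (mf i j).
Qed.

(** The image of Lebesgue measure by x -> a x + b, multiplied by [a], gives half-open intervals
    their length, hence is Lebesgue measure. *)
Lemma lebesgue_measure_affine (a b : R) (B : set R) : 0 < a -> measurable B ->
  lebesgue_measure [set x : R | B (a * x + b)] = (a^-1%:E * lebesgue_measure B)%E.
Proof.
move=> a0 mB.
have mf : measurable_fun setT (fun x : measurableTypeR R => a * x + b : measurableTypeR R).
  by apply: measurable_funD => //; exact: measurable_funM.
have [mu muE] := image_measure (@lebesgue_measure R) mf.
have a0' : 0 <= a by exact: ltW.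
have E : forall A : set (measurableTypeR R), measurable A -> lebesgue_measure A = mscale (NngNum a0') mu A.
  apply: lebesgue_measure_unique => _ /ocitvP[->|[[x y]/= xy ->]].
    by rewrite !measure0.
  rewrite /mscale/= muE.
  rewrite (_ : _ @^-1` _ = `](a^-1 * (x - b)), (a^-1 * (y - b))]%classic); last first.
    by apply/seteqP; split => z /=; rewrite !in_itv/= ltr_pdivrMl// ler_pdivlMl// ltrBlDr lerBrDr.
  rewrite lebesgue_measure_itv/= lte_fin xy.
  rewrite [X in _ = (_ * X)%E](_ : _ =
    lebesgue_measure `](a^-1 * (x - b)), (a^-1 * (y - b))]%classic)//.
  rewrite lebesgue_measure_itv/= lte_fin ltr_pM2l ?invr_gt0// ltrD2r xy.
  rewrite -!EFinB -EFinM; congr EFin; field.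
  by rewrite gt_eqF.
rewrite [in RHS]E// /mscale/= muE muleA -EFinM mulVf ?gt_eqF// mul1e.
by [].
Qed.

(** The preimage of a box is a box, whose sides are scaled by the one-dimensional formula. A row
    permutation, a scaling of each row and a translation are treated together: the statement serves
    for translates, for the dilation of a single point and for the exchange of points. *)
Lemma leb_mx_affine m n (s : 'S_m) (a : 'I_m -> R) (b : 'M[R]_(m, n)) A :
  (forall i, 0 < a i) -> measurable A ->
  leb_mx [set z : 'M[R]_(m, n) | A (\matrix_(i, j) (a i * z (s i) j + b i j))] =
  ((\prod_i ((a i)^-1) ^+ n)%:E * leb_mx A)%E.
Proof.
move=> a0 mA; set T := fun z : 'M[R]_(m, n) => \matrix_(i, j) (a i * z (s i) j + b i j).
have mT : measurable_fun setT T.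
  apply: measurable_fun_mx => i j; rewrite /T.
  under eq_fun do rewrite mxE.
  apply: measurable_funD => //; apply: measurable_funM => //.
  exact: measurable_mx_coord.
have [mu muE] := image_measure (@leb_mx R m n) mT.
pose c : R := \prod_i (a i) ^+ n.
have c0 : 0 < c by apply: prodr_gt0 => i _; exact: exprn_gt0.
have cV : \prod_i ((a i)^-1) ^+ n = c^-1.
  by rewrite /c -prodfV; apply: eq_bigr => i _; rewrite exprVn.
have c0' : 0 <= c by exact: ltW.
have <- : mscale (NngNum c0') mu A = leb_mx A.
  apply: leb_mx_unique => // B mB.
  transitivity (c%:E * leb_mx (T @^-1` mx_box B))%E.
    by congr (_ * _)%E; exact: muE.
  rewrite (_ : T @^-1` _ = mx_box (fun i j =>
    [set x | B (s^-1%g i) j (a (s^-1%g i) * x + b (s^-1%g i) j)])); last first.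
    apply/seteqP; split => z /= Bz i j.
      by have := Bz (s^-1%g i) j; rewrite mxE permKV.
    by have := Bz (s i) j; rewrite /= mxE permK.
  rewrite leb_mx_box; last first.
    move=> i j; rewrite -[X in measurable X]setTI.
    apply: (measurable_funD (measurable_funM _ _) _) => //.
  under eq_bigr do under eq_bigr do rewrite lebesgue_measure_affine//.
  rewrite (reindex_inj (@perm_inj _ s))/=.
  under eq_bigr do under eq_bigr do rewrite permK.
  under eq_bigr do rewrite big_split/= prodEFin.
  rewrite big_split/= prodEFin muleA -EFinM.
  under [X in _ * X]eq_bigr do rewrite prodr_const card_ord.
  by rewrite cV mulfV ?gt_eqF// mul1e.
rewrite cV /mscale/= muleA -EFinM mulVf ?gt_eqF// mul1e.
by [].
Qed.

(** Lebesgue measure on m1 + m2 rows is the image of the product measure under [col_mx], as both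
    agree on boxes. Splitting off one point of a configuration, and hence Fubini, rests on this. *)
Lemma leb_mx_col_mx m1 m2 n (A : set 'M[R]_(m1, n)) (B : set 'M[R]_(m2, n)) :
  measurable A -> measurable B ->
  leb_mx [set z : 'M[R]_(m1 + m2, n) | A (usubmx z) /\ B (dsubmx z)] =
  (leb_mx A * leb_mx B)%E.
Proof.
move=> mA mB; pose T := fun p : 'M[R]_(m1, n) * 'M[R]_(m2, n) => col_mx p.1 p.2.
have mT : measurable_fun setT T.
  apply: measurable_fun_mx => i j; rewrite /T.
  case: (splitP i) => k ik.
    apply: (eq_measurable_fun ((fun z : 'M[R]_(m1, n) => z k j) \o fst)).
      by move=> p _ /=; rewrite (_ : i = lshift _ k) ?col_mxEu//; exact: val_inj.
    by apply: measurableT_comp => //; exact: measurable_mx_coord.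
  apply: (eq_measurable_fun ((fun z : 'M[R]_(m2, n) => z k j) \o snd)).
    by move=> p _ /=; rewrite (_ : i = rshift _ k) ?col_mxEd//; exact: val_inj.
  by apply: measurableT_comp => //; exact: measurable_mx_coord.
have [mu muE] := image_measure (@leb_mx R m1 n \x @leb_mx R m2 n)%E mT.
have musub : measurable_fun setT (@usubmx R m1 m2 n).
  apply: measurable_fun_mx => i j; rewrite /usubmx.
  by under eq_fun do rewrite mxE; exact: measurable_mx_coord.
have mdsub : measurable_fun setT (@dsubmx R m1 m2 n).
  apply: measurable_fun_mx => i j; rewrite /dsubmx.
  by under eq_fun do rewrite mxE; exact: measurable_mx_coord.
rewrite -(@leb_mx_unique _ _ _ mu).
- rewrite muE -product_measure1E//.
  congr (product_measure1 _ _ _); apply/seteqP; split => [[x y]|[x y]] /=.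
    by rewrite col_mxKu col_mxKd.
  by rewrite col_mxKu col_mxKd.
- move=> C mC; rewrite muE.
  rewrite (_ : T @^-1` _ = mx_box (fun i => C (lshift _ i)) `*`
                           mx_box (fun i => C (rshift _ i))); last first.
    apply/seteqP; split => [[x y]|[x y]] /=.
      move=> H; split => i j; first by have := H (lshift _ i) j; rewrite /T/= col_mxEu.
      by have := H (rshift _ i) j; rewrite /T/= col_mxEd.
    move=> [Hx Hy] i j; rewrite /T/=; case: (splitP i) => k ik.
      rewrite (_ : i = lshift _ k) ?col_mxEu//; exact: val_inj.
    rewrite (_ : i = rshift _ k) ?col_mxEd//; exact: val_inj.
  rewrite big_split_ord/= -!leb_mx_box//.
  by apply: product_measure1E; exact: measurable_mx_box.
- apply: measurableI.
    by rewrite -[X in measurable X]setTI; exact: musub.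
  by rewrite -[X in measurable X]setTI; exact: mdsub.
Qed.

Lemma mx_bounded_subset m n (A : set 'M[R]_(m, n)) :
  bounded_set A -> exists k : nat, A `<=` mx_cube m n k.
Proof.
move=> [M [Mreal AM]]; exists (Num.truncn (M + 1)).+1 => z Az i j /=.
have := AM (M + 1) (ltr_pwDr ltr01 (lexx _)) z Az => zM.
rewrite in_itv/= -ler_norml (le_trans (le_mx_norm_entry _ _ _))//.
by rewrite (le_trans zM)// ltW// truncnS_gt.
Qed.

Lemma leb_mx_bounded m n (A : set 'M[R]_(m, n)) :
  measurable A -> bounded_set A -> (leb_mx A < +oo)%E.
Proof.
move=> mA /mx_bounded_subset[k Ak]; apply: le_lt_trans (leb_mx_cube R m n k).
by apply: le_measure; rewrite ?inE//; exact: measurable_mx_box.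
Qed.
End leb_affine.

(** * Topology of matrix spaces and Borel sets *)

Section mx_topology.
Context (R : realType).

Lemma cvg_mx m n (T : Type) (F : set_system T) {FF : Filter F}
    (f : T -> 'M[R]_(m, n)) (l : 'M[R]_(m, n)) :
  (forall i j, (fun x => f x i j) @ F --> l i j) -> f @ F --> l.
Proof.
move=> fl A [P lP PA]; apply: filterS PA _.
suff : \forall x \near F, forall i, (forall j, P i j (f x i j)) by [].
apply: filter_forall => i; apply: filter_forall => j.
exact: fl.
Qed.

Lemma measurable_mx_ball m n (x : 'M[R]_(m, n)) e : measurable (ball x e).
Proof.
have [e0|e0] := ltP 0 e; last first.
  by rewrite (_ : ball x e = set0)//; apply/seteqP; split => y // -[]; rewrite ltNge e0.
rewrite (_ : ball x e = mx_box (fun i j => ball (x i j) e)).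
  by apply: measurable_mx_box => i j; exact: measurable_ball.
by apply/seteqP; split => y; [case|split].
Qed.

(** An open set is the union of the balls with rational centre and radius 1/(i+1) that it contains;
    [unpickle] enumerates these countably many balls. *)
Lemma open_measurable_mx m n (A : set 'M[R]_(m, n)) : open A -> measurable A.
Proof.
move=> oA.
pose F k : set 'M[R]_(m, n) := if @choice.unpickle ('M[rat]_(m, n) * nat)%type k is Some (q, i) then
  let b := ball (map_mx (@ratr R) q : 'M[R]_(m, n)) (i.+1%:R^-1 : R) in
  if `[< b `<=` A >] then b else set0 else set0.
rewrite (_ : A = \bigcup_k F k).
  apply: bigcup_measurable => k _; rewrite /F.
  case: choice.unpickle => // -[q i]; case: ifP => // _; exact: measurable_mx_ball.
apply/seteqP; split => [x Ax|x [k _]]; last first.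
  by rewrite /F; case: choice.unpickle => // -[q i]; case: ifP => // /asboolP bA; exact: bA.
have : nbhs x A by exact: open_nbhs_nbhs.
move=> /nbhs_ballP[e/= e0 xeA].
have [i ie] : exists i : nat, i.+1%:R^-1 < e / 2.
  exists (Num.truncn (e / 2)^-1).
  rewrite -[ltRHS]invrK ltf_pV2 ?posrE// ?invr_gt0 ?divr_gt0//; exact: truncnS_gt.
have i0 : (0 : R) < i.+1%:R^-1 by rewrite invr_gt0.
have [q qx] : exists q : 'M[rat]_(m, n), ball (map_mx (@ratr R) q : 'M[R]_(m, n)) (i.+1%:R^-1 : R) x.
  have h k l : exists q : rat, `|ratr q - x k l| < i.+1%:R^-1.
    have [|q] := @rat_in_itvoo R (x k l) (x k l + i.+1%:R^-1); first by rewrite ltrDl.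
    rewrite in_itv/= => /andP[xq qx]; exists q.
    by rewrite gtr0_norm ?subr_gt0// ltrBlDl.
  exists (\matrix_(k, l) sval (cid (h k l))); split => // k l.
  by rewrite !mxE; case: cid => q /= qx; rewrite /ball/=.
exists (choice.pickle (q, i)) => //; rewrite /F choice.pickleK ifT//.
apply/asboolP => y qy; apply: xeA.
apply: (@le_ball _ _ _ (i.+1%:R^-1 + i.+1%:R^-1)); first by rewrite [leRHS]splitr lerD ?ltW.
by apply: ball_triangle qy; exact: ball_sym.
Qed.

Lemma closed_measurable_mx m n (A : set 'M[R]_(m, n)) : closed A -> measurable A.
Proof.
by move=> cA; rewrite -(setCK A); apply: measurableC; apply: open_measurable_mx; exact: closed_openC.
Qed.

Lemma within_continuous_measurable_mx m n (A : set 'M[R]_(m, n)) (g : 'M[R]_(m, n) -> R) :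
  measurable A -> {within A, continuous g} -> measurable_fun A g.
Proof.
move=> mA cg; apply: (measurability _ (RGenOpens.measurableE R)) => // /= _ [_ [a [b ->] <-]].
have oab : open (`]a, b[%classic : set R) by exact: interval_open.
have /open_subspaceP[V oV VE] : open ((g : subspace A -> R) @^-1` `]a, b[%classic).
  by move/continuousP : cg; exact.
rewrite setIC -VE; apply: measurableI => //.
exact: open_measurable_mx.
Qed.

Lemma compact_mx_cube m n k : compact (mx_cube m n k : set 'M[R]_(m, n)).
Proof.
have c : compact [set v : 'rV[R]_(m * n) | forall i, v ord0 i \in `[(- k%:R), k%:R]].
  by apply: (@rV_compact R _ (fun _ => `[(- k%:R : R), k%:R]%classic)) => _; exact: segment_compact.
rewrite (_ : mx_cube m n k = vec_mx @` [set v : 'rV[R]_(m * n) | forall i, v ord0 i \in `[(- k%:R), k%:R]]).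
  apply: continuous_compact c; apply: continuous_subspaceT => v.
  apply: (@cvg_mx _ _ _ (nbhs v)) => i j; rewrite mxE.
  under eq_fun do rewrite mxE.
  exact: coord_continuous.
apply/seteqP; split => [z zk|_ [v vk <-] i j].
  exists (mxvec z); last exact: mxvecK.
  by move=> l; case/mxvec_indexP: l => i j; rewrite mxvecE; exact: zk.
by rewrite /= mxE; exact: vk.
Qed.

Lemma bounded_closed_compact_mx m n (A : set 'M[R]_(m, n)) :
  bounded_set A -> closed A -> compact A.
Proof.
move=> /mx_bounded_subset[k Ak] cA; exact: subclosed_compact cA (@compact_mx_cube m n k) Ak.
Qed.

Lemma continuous_row m n i : continuous (fun z : 'M[R]_(m, n) => row i z).
Proof.
move=> z; apply: (@cvg_mx _ _ _ (nbhs z)) => i' j; rewrite mxE.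
under eq_fun do rewrite mxE.
exact: coord_continuous.
Qed.
End mx_topology.

(** * A bounded open set with C^2 boundary has a null boundary *)

Section boundary_null.
Context (R : realType).

Lemma bounded_set_le (V : normedModType R) (A : set V) M :
  (forall x, A x -> `|x| <= M) -> bounded_set A.
Proof.
move=> AM; exists M; split; first exact: num_real.
by move=> y My x Ax; rewrite /= (le_trans (AM _ Ax))// ltW.
Qed.

Lemma is_derive_line (V W : normedModType R) (g : V -> W) (x v : V) (t : R) :
  derivable g (x + t *: v) v ->
  is_derive t 1 (fun s : R => g (x + s *: v)) ('D_v g (x + t *: v)).
Proof.
move=> dg; have E : (fun h : R => h^-1 *: (g (x + (h *: 1 + t) *: v) - g (x + t *: v))) =
    (fun h => h^-1 *: (g (h *: v + (x + t *: v)) - g (x + t *: v))).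
  by apply/funext => h; rewrite [h *: 1]mulr1 scalerDl addrCA.
split; first by rewrite /derivable/= E.
by rewrite /derive/= E.
Qed.

Lemma leb_mx_translate m n (b : 'M[R]_(m, n)) A : measurable A ->
  leb_mx [set z | A (z + b)] = leb_mx A.
Proof.
move=> mA; have := @leb_mx_affine R m n 1%g (fun=> 1) b A (fun _ => ltr01) mA.
rewrite big1 ?mul1e; last by move=> i _; rewrite invr1 expr1n.
move=> <-; congr leb_mx; apply/seteqP; split => z /=.
  by rewrite (_ : \matrix_(_, _) _ = z + b)//; apply/matrixP => i j; rewrite !mxE perm1 mul1r.
by rewrite (_ : \matrix_(_, _) _ = z + b)//; apply/matrixP => i j; rewrite !mxE perm1 mul1r.
Qed.

(** Infinitely many disjoint sets of the same measure lie in one bounded set, which has finite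
    measure; the common measure must vanish. *)
Lemma leb_mx_disjoint_translates m n (Z : set 'M[R]_(m, n)) (w : nat -> 'M[R]_(m, n)) M :
  measurable Z -> bounded_set Z -> (forall k, `|w k| <= M) ->
  trivIset setT (fun k => [set x | Z (x + w k)]) -> leb_mx Z = 0%E.
Proof.
move=> mZ bZ wM tZ; set F := fun k => [set x | Z (x + w k)].
have mF k : measurable (F k).
  have mt : measurable_fun setT (fun x : 'M[R]_(m, n) => x + w k).
    apply: measurable_fun_mx => i j.
    under eq_fun do rewrite mxE.
    by apply: measurable_funD => //; exact: measurable_mx_coord.
  by have := mt measurableT _ mZ; rewrite setTI.
have bF : bounded_set (\bigcup_k F k).
  case: bZ => N [Nreal ZN]; exists (N + M); split; first exact: num_real.
  move=> y Ny x [k _ Zx].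
  have /(ZN (y - M)) : N < y - M by rewrite ltrBrDr.
  move=> /(_ _ Zx) xw; have := ler_normB (x + w k) (w k); rewrite addrK => /le_trans; apply.
  by rewrite -(subrK M y) lerD.
have mUF : measurable (\bigcup_k F k) by exact: bigcup_measurable.
have foo := leb_mx_bounded mUF bF.
have Zk k : leb_mx (F k) = leb_mx Z by exact: leb_mx_translate.
have fZ : leb_mx Z \is a fin_num by rewrite ge0_fin_numE//; exact: leb_mx_bounded.
have fU : leb_mx (\bigcup_k F k) \is a fin_num by rewrite ge0_fin_numE.
apply/eqP; rewrite eq_le measure_ge0 andbT leNgt; apply/negP => Z0.
have {}Z0 : 0 < fine (leb_mx Z) by rewrite fine_gt0// Z0 -ge0_fin_numE.
have le k : k%:R * fine (leb_mx Z) <= fine (leb_mx (\bigcup_k F k)).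
  rewrite -lee_fin EFinM !fineK//.
  have <- : leb_mx (\big[setU/set0]_(i < k) F i) = (k%:R%:E * leb_mx Z)%E.
    rewrite measure_semi_additive_ord//.
    - transitivity (\sum_(i < k) leb_mx Z)%E; first by apply: eq_bigr => i _; exact: Zk.
      by rewrite sumr_const card_ord mule_natl.
    - by move=> i j _ _ ij; apply/val_inj; exact: tZ.
    - exact: bigsetU_measurable.
  apply: le_measure; rewrite ?inE//; first exact: bigsetU_measurable.
  by rewrite -bigcup_mkord => x [i _ Fx]; exists i.
have := le (Num.truncn (fine (leb_mx (\bigcup_k F k)) / fine (leb_mx Z))).+1.
by rewrite -ler_pdivlMr// leNgt truncnS_gt.
Qed.

(* The function [phi] strictly increases along [v] near [p], hence the translates
   of its zero set by [v / (k + 1)] are pairwise disjoint. *)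
Lemma level_set_null d (U : set 'rV[R]_d) p : open U -> bounded_set U ->
  C2_boundary U -> boundary U p ->
  exists2 e, 0 < e & leb_mx (boundary U `&` ball p e) = 0%E.
Proof.
move=> oU bU C2 bp; have [B [phi [oB Bp [C1 _] [v0 v0p] UB]]] := C2 p bp.
have [v vp] : exists v, 0 < 'D_v phi p.
  have [v0p'|v0p'] := ltP 0 ('D_v0 phi p); first by exists v0.
  exists (- v0); have [dp _] := C1 _ Bp.
  by rewrite !deriveE// linearN -deriveE// oppr_gt0 lt_neqAle v0p.
have [r r0 [rB rv]] : exists2 r, 0 < r & (ball p r `<=` B /\ forall x, ball p r x -> 0 < 'D_v phi x).
  have [_ /(_ v) cv] := C1 _ Bp.
  have h1 : \forall x \near p, B x by exact: open_nbhs_nbhs.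
  have h2 : \forall x \near p, 0 < 'D_v phi x.
    exact: (cv _ (lt_nbhsr vp)).
  have h12 : nbhs p (B `&` [set x | 0 < 'D_v phi x]) by exact: filterI h1 h2.
  have /nbhs_ballP[r/= r0 rr] := h12.
  by exists r => //; split => x /rr[].
exists (r / 2); first by rewrite divr_gt0.
set Z := _ `&` _.
(* A boundary point [x] is not in the open set [U], which excludes phi x < 0; if phi x > 0, a whole
   neighbourhood of [x] would avoid [U], although [x] is in its closure. *)
have Zphi x : Z x -> phi x = 0.
  move=> [[clx nx] xr].
  have Bx : B x by apply: rB; apply: le_ball xr; lra.
  have nUx : ~ U x by move: nx; rewrite (interior_id U).1.
  apply/eqP; rewrite eq_le; apply/andP; split; last first.
    rewrite leNgt; apply/negP => x0; apply: nUx.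
    have : ([set x | phi x < 0] `&` B) x by [].
    by rewrite -UB => -[].
  rewrite leNgt; apply/negP => x0.
  have cphi : {for x, continuous phi}.
    by apply: differentiable_continuous; have [] := C1 _ Bx.
  have h1 : nbhs x B by exact: open_nbhs_nbhs.
  have h2 : \forall y \near x, 0 < phi y by exact: (cphi _ (lt_nbhsr x0)).
  have [y [Uy [By py]]] := clx _ (filterI h1 h2).
  have : ([set x | phi x < 0] `&` B) y by rewrite -UB.
  by move=> [/= + _]; rewrite ltNge (ltW py).
have mZ : measurable Z.
  apply: measurableI; last exact: measurable_mx_ball.
  apply: measurableD; first by apply: closed_measurable_mx; exact: closed_closure.
  by apply: open_measurable_mx; exact: open_interior.
have bZ : bounded_set Z.
  apply: (@bounded_set_le _ _ (`|p| + r)) => x [_ px].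
  rewrite -(subrK p x) (le_trans (ler_normD _ _))// addrC lerD2l distrC ltW//.
  by move: px; rewrite mx_norm_ball /ball_/=; lra.
pose w (k : nat) := (k.+1%:R^-1 : R) *: v.
(* Two zeros on a line directed by [v] would, by the mean value theorem, enclose a zero of the
   derivative along [v], which is positive on the whole ball. *)
have noline q q' s : Z q -> Z q' -> 0 < s -> q' = q + s *: v -> False.
  move=> Zq Zq' s0 q'E.
  have inb t : t \in `[0, s] -> ball p r (q + t *: v).
    rewrite in_itv/= => /andP[t0 ts]; split => // i j.
    have := Zq.2; have := Zq'.2; rewrite q'E => -[_ /(_ i j) + [_ /(_ i j)]].
    rewrite /ball/= !mxE !ltr_norml => /andP[a1 a2] /andP[a3 a4].
    have [v0'|/ltW v0'] := leP 0 (v i j).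
      have h1 := mulr_ge0 t0 v0'; have h2 := ler_wpM2r v0' ts.
      by apply/andP; split; lra.
    have h1 := mulr_ge0_le0 t0 v0'; have h2 := ler_wnM2r v0' ts.
    by apply/andP; split; lra.
  have dphi t : t \in `[0, s] -> is_derive t 1 (fun t => phi (q + t *: v)) ('D_v phi (q + t *: v)).
    move=> ts; apply: is_derive_line; apply: diff_derivable.
    by have [] := C1 _ (rB _ (inb t ts)).
  pose h (t : R) : R := phi (q + t *: v); pose dh (t : R) : R := 'D_v phi (q + t *: v).
  have hd (t : R) : t \in `]0, s[ -> is_derive t 1 h (dh t).
    by move=> ts; apply: dphi; exact: subset_itv_oo_cc ts.
  have hc : {within `[0, s], continuous h}.
    by apply: derivable_within_continuous => t ts; have [] := dphi t ts.
  have [c cs] := MVT s0 hd hc; rewrite /h /dh.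
  rewrite -q'E scale0r addr0 !Zphi// subrr subr0 => /esym/eqP; rewrite mulf_eq0 (gt_eqF s0) orbF gt_eqF//.
  by apply: rv; apply: inb; exact: subset_itv_oo_cc cs.
apply: (@leb_mx_disjoint_translates _ _ Z w `|v|) => //.
  by move=> k; rewrite normrZ ger0_norm ?invr_ge0// ler_piMl// invf_le1 ?ltr0n// ler1n.
apply/trivIsetP => i j _ _.
wlog ij : i j / (i < j)%N.
  move=> H ij; have := ij; rewrite neq_ltn => /orP[lij|lji]; first exact: H.
  by rewrite setIC; apply: H => //; rewrite eq_sym.
move=> _; apply/seteqP; split => // x [/= Zi Zj].
apply: (noline _ _ (i.+1%:R^-1 - j.+1%:R^-1) Zj Zi).
  by rewrite subr_gt0 ltf_pV2 ?posrE// ltr_nat.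
by rewrite /w scalerBl addrCA addrK addrC.
Qed.

(** The boundary is compact and locally null, so finitely many null pieces cover it. *)
Lemma boundary_null d (U : set 'rV[R]_d) : open U -> bounded_set U ->
  C2_boundary U -> leb_mx (boundary U) = 0%E.
Proof.
move=> oU bU C2; set D := boundary U.
have cD : closed D.
  by rewrite /D/boundary setDE; apply: closedI; [exact: closed_closure|exact/open_closedC/open_interior].
have bD : bounded_set D.
  case: bU => M [_ UM]; apply: (@bounded_set_le _ _ (M + 1)) => x [clx _].
  suff : closed [set y : 'rV[R]_d | `|y| <= M + 1].
    move=> /closure_id E; suff : closure [set y : 'rV[R]_d | `|y| <= M + 1] x by rewrite -E.
    by apply: closureS clx => y Uy /=; apply: UM => //; rewrite ltrDl.
  rewrite (_ : mkset _ = (fun y : 'rV[R]_d => `|y|) @^-1` `]-oo, M + 1]).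
    by apply: closed_comp => [y _|]; [exact: norm_continuous|exact: interval_closed].
  by apply/seteqP; split => y /=; rewrite in_itv.
have h p : exists e, D p -> 0 < e /\ leb_mx (D `&` ball p e) = 0%E.
  case: (pselect (D p)) => [Dp|nDp]; last by exists 0.
  by have [e e0 eD] := level_set_null oU bU C2 Dp; exists e.
pose e p := sval (cid (h p)).
have eP p : D p -> 0 < e p /\ leb_mx (D `&` ball p (e p)) = 0%E.
  by rewrite /e; case: cid.
have : compact D by exact: bounded_closed_compact_mx.
rewrite compact_cover => /(_ _ D (fun p => ball p (e p))) [|p Dp|D' D'D DD'].
- by move=> p _; exact: ball_open.
- by exists p => //; apply: ballxx; have [] := eP _ Dp.
have mD : measurable D by exact: closed_measurable_mx.
apply/(negligibleP leb_mx mD).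
apply: (@negligibleS _ _ _ _ (\big[setU/set0]_(p <- D') (D `&` ball p (e p)))).
  move=> x Dx; have [p pD' px] := DD' _ Dx.
  by rewrite -bigcup_seq; exists p.
rewrite big_seq; elim/big_ind: _ => [|A B nA nB|p pD'].
- exact: negligible_set0.
- exact: negligibleU.
- apply/negligibleP; first by apply: measurableI => //; exact: measurable_mx_ball.
  by have /set_mem/eP[] := D'D _ pD'.
Qed.
End boundary_null.

(** * The window W and its powers *)

Section window_facts.
Context (R : realType) (d : nat) (W : set 'rV[R]_d) (hW : window W).

Lemma window_closed : closed W.
Proof. by have [_ _ [U [_ _ _ ->]]] := hW; exact: closed_closure. Qed.

Lemma window_bounded : bounded_set W.
Proof. by have [cW _ _] := hW; exact: compact_bounded. Qed.

Lemma window_measurable : measurable W.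
Proof. by apply: closed_measurable_mx; exact: window_closed. Qed.

Lemma window_interior_measurable : measurable W°.
Proof. by apply: open_measurable_mx; exact: open_interior. Qed.

Lemma window_finite : (leb_mx W < +oo)%E.
Proof. exact: leb_mx_bounded window_measurable window_bounded. Qed.

(** W is the closure of an open set, which lies in the interior of W. This density gives a meaning
    to gradients taken as limits from the interior. *)
Lemma window_closure_interior : W `<=` closure W°.
Proof.
have [_ _ [U [oU _ _ ->]]] := hW; apply: closureS.
by rewrite -open_subsetE//; exact: subset_closure.
Qed.

Lemma boundaryE x : boundary W x <-> W x /\ ~ W° x.
Proof. by rewrite /boundary -(closure_id W).1//; exact: window_closed. Qed.

(** The boundary of the closure of [U] is contained in the boundary of [U]. *)
Lemma window_boundary_null : leb_mx (W `\` W°) = 0%E.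
Proof.
have [_ _ [U [oU bU C2 WU]]] := hW.
have mb : measurable (boundary U).
  apply: measurableD; first by apply: closed_measurable_mx; exact: closed_closure.
  by apply: open_measurable_mx; exact: open_interior.
have mD : measurable (W `\` W°).
  by apply: measurableD; [exact: window_measurable|exact: window_interior_measurable].
apply/eqP; rewrite eq_le measure_ge0 andbT -(boundary_null oU bU C2).
apply: le_measure; rewrite ?inE// => x [Wx nWx]; split; first by rewrite -WU.
by apply: contra_not nWx; rewrite WU; apply: interiorS; exact: subset_closure.
Qed.

Lemma measurable_rows n (A : 'I_n -> set 'rV[R]_d) : (forall i, measurable (A i)) ->
  measurable [set z : 'M[R]_(n, d) | forall i, A i (row i z)].
Proof.
move=> mA; rewrite (_ : mkset _ = \bigcap_i (row i @^-1` A i)); last first.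
  by apply/seteqP; split => z /= Az i; [move=> _|]; exact: Az.
apply: fin_bigcap_measurable => [|i _]; first exact: finite_finset.
have mr : measurable_fun setT (fun z : 'M[R]_(n, d) => row i z).
  apply: measurable_fun_mx => k l.
  by under eq_fun do rewrite mxE; exact: measurable_mx_coord.
by have := mr measurableT _ (mA i); rewrite setTI.
Qed.

Lemma leb_mx_rows n (A : 'I_n -> set 'rV[R]_d) : (forall i, measurable (A i)) ->
  leb_mx [set z : 'M[R]_(n, d) | forall i, A i (row i z)] = (\prod_(i < n) leb_mx (A i))%E.
Proof.
elim: n A => [|n IH] A mA.
  rewrite big_ord0 (_ : mkset _ = mx_box (fun i j => setT)).
    by rewrite leb_mx_box// big_ord0.
  by apply/seteqP; split => // z _ [].
rewrite big_ord_recl -IH// -(@leb_mx_col_mx _ 1)//; last first.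
  by apply: (@measurable_rows n (fun i => A (lift ord0 i))) => i.
have rowS i (z : 'M[R]_(n.+1, d)) :
    row i (dsubmx (z : 'M[R]_(1 + n, d))) = row (lift ord0 i) z.
  by apply/rowP => k; rewrite !mxE; congr (z _ _); apply/val_inj.
have row0 (z : 'M[R]_(n.+1, d)) : usubmx (z : 'M[R]_(1 + n, d)) = row ord0 z.
  by apply/rowP => k; rewrite !mxE; congr (z _ _); apply/val_inj.
congr (@leb_mx R (1 + n) d); apply/seteqP; split => z /=.
  by move=> Az; split => [|i]; rewrite ?row0 ?rowS; exact: Az.
move=> [A0 AS] i; case: (unliftP ord0 i) => [j|] ->; last by rewrite -row0.
by rewrite -rowS; exact: AS.
Qed.

Section window_power.
Variable n : nat.
Local Notation Wn := (window_pow W n).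

Lemma window_pow_measurable : measurable Wn.
Proof. by apply: (@measurable_rows n (fun=> W)) => _; exact: window_measurable. Qed.

Lemma window_pow_closed : closed Wn.
Proof.
rewrite (_ : Wn = \bigcap_i (row i @^-1` W)); last first.
  by apply/seteqP; split => z /= Az i; [move=> _|]; exact: Az.
apply: closed_bigI => i _; apply: closed_comp => [z _|]; last exact: window_closed.
exact: continuous_row.
Qed.

Lemma mx_norm_row (z : 'M[R]_(n, d)) M : 0 <= M -> (forall i, `|row i z| <= M) -> `|z| <= M.
Proof.
move=> M0 zM; apply: mx_norm_le => // i j.
by have := le_trans (le_mx_norm_entry (row i z) ord0 j) (zM i); rewrite mxE.
Qed.

Lemma window_pow_bounded : bounded_set Wn.
Proof.
have [M [_ WM]] := window_bounded; apply: (@bounded_set_le _ _ _ (`|M| + 1)) => z Wz.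
apply: mx_norm_row => [|i]; first by rewrite addr_ge0.
by apply: WM (Wz i); rewrite ltr_pwDr// ler_norm.
Qed.

Lemma window_pow_compact : compact Wn.
Proof. exact: bounded_closed_compact_mx window_pow_bounded window_pow_closed. Qed.

Lemma window_pow_interior (z : 'M[R]_(n, d)) :
  Wn° z <-> forall i, W° (row i z).
Proof.
split => [Wz i|Wz].
  move: Wz => /nbhs_ballP[e/= e0 zW]; apply/nbhs_ballP; exists e => //= x xi.
  have : Wn (\matrix_(i', j) (if i' == i then x 0 j else z i' j)).
    apply: zW; split => // i' j; rewrite mxE; case: eqP => [->|_]; last exact: ballxx.
    by case: xi => _ /(_ 0 j); rewrite mxE.
  move=> /(_ i); rewrite (_ : row _ _ = x)//.
  by apply/rowP => j; rewrite !mxE eqxx.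
apply: (@filter_forall _ _ (fun i => [set y | W (row i y)]) (nbhs z)) => i.
exact: (@continuous_row R n d i z W (Wz i)).
Qed.

Lemma window_pow_closure_interior : Wn `<=` closure Wn°.
Proof.
move=> z Wz B /nbhs_ballP[e/= e0 zB].
have h i : exists x, W° x /\ ball (row i z) e x.
  have [x [Wx xB]] := window_closure_interior (Wz i) (nbhsx_ballx (row i z) e e0).
  by exists x.
pose y : 'M[R]_(n, d) := \matrix_(i, j) (sval (cid (h i))) 0 j.
have yi i : row i y = sval (cid (h i)) by apply/rowP => j; rewrite !mxE.
exists y; split.
  by apply/window_pow_interior => i; rewrite yi; case: cid => x [].
apply: zB; split => // i j; rewrite mxE; case: cid => x [_ [_ /= /(_ 0 j)]].
by rewrite mxE.
Qed.

(** A point of W^n outside the interior has some row on the boundary of W, hence belongs to one of n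
    products having a null factor. *)
Lemma window_pow_boundary_null : leb_mx (Wn `\` Wn°) = 0%E.
Proof.
have mD : measurable (W `\` W°).
  by apply: measurableD; [exact: window_measurable|exact: window_interior_measurable].
have mDn : measurable (Wn `\` Wn°).
  apply: measurableD; first exact: window_pow_measurable.
  by apply: open_measurable_mx; exact: open_interior.
apply/(negligibleP leb_mx mDn).
pose A i := [set z : 'M[R]_(n, d) | forall j, (if j == i then W `\` W° else W) (row j z)].
have mA (i j : 'I_n) : measurable (if j == i then W `\` W° else W).
  by case: ifP => // _; exact: window_measurable.
apply: (@negligibleS _ _ _ _ (\big[setU/set0]_(i < n) A i)).
  move=> z [Wz nWz]; rewrite -bigcup_seq.
  have /existsNP[i nWi] : ~ forall i, W° (row i z) by move/window_pow_interior.
  exists i => /=; first by rewrite mem_index_enum.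
  by move=> j; case: eqP => [->|_]; [split|]; rewrite //; exact: Wz.
elim/big_ind: _ => [|B C nB nC|i _].
- exact: negligible_set0.
- exact: negligibleU.
- apply/negligibleP; first exact: (measurable_rows (mA i)).
  rewrite [LHS](leb_mx_rows (mA i)) (bigD1 i)//= eqxx.
  by have -> := window_boundary_null; rewrite mul0e.
Qed.

Lemma leb_window_pow_finite : (leb_mx Wn < +oo)%E.
Proof. exact: leb_mx_bounded window_pow_measurable window_pow_bounded. Qed.

Lemma within_continuous_bounded (g : 'M[R]_(n, d) -> R) :
  {within Wn, continuous g} -> exists2 M, 0 <= M & forall z, Wn z -> `|g z| <= M.
Proof.
move=> cg; have := continuous_compact cg window_pow_compact.
move=> /compact_bounded[M [_ gM]]; exists (`|M| + 1) => [|z Wz]; first by rewrite addr_ge0.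
by apply: (gM (`|M| + 1)); [rewrite ltr_pwDr// ler_norm|exists z].
Qed.

Lemma within_continuous_integrable (g : 'M[R]_(n, d) -> R) :
  {within Wn, continuous g} -> leb_mx.-integrable Wn (EFin \o g).
Proof.
move=> cg; have [M M0 gM] := within_continuous_bounded cg.
apply: measurable_bounded_integrable.
- exact: window_pow_measurable.
- exact: leb_window_pow_finite.
- exact: within_continuous_measurable_mx window_pow_measurable cg.
- by exists M; split; [exact: num_real|move=> y My z Wz; rewrite /= (le_trans (gM _ Wz))// ltW].
Qed.
End window_power.
End window_facts.
Arguments window_pow_measurable {R d W} hW n.
Arguments window_pow_bounded {R d W} hW n.
Arguments window_pow_compact {R d W} hW n.

Lemma cvg_sumr (R : realType) (T I : Type) (F : set_system T) {FF : Filter F}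
    (r : seq I) (f : I -> T -> R) (l : I -> R) :
  (forall i, f i x @[x --> F] --> l i) ->
  \sum_(i <- r) f i x @[x --> F] --> \sum_(i <- r) l i.
Proof.
move=> fl; elim: r => [|i r IH].
  by rewrite big_nil; under eq_cvg do rewrite big_nil; exact: cvg_cst.
by rewrite big_cons; under eq_cvg do rewrite big_cons; apply: cvgD.
Qed.

(** * Gradients on the closed set W^n *)

Section gradient.
Context (R : realType) (d : nat) (W : set 'rV[R]_d) (hW : window W).
Variables (n : nat) (g : 'M[R]_(n, d) -> R).
Hypothesis g_C1 : C1_window W g.
Local Notation Wn := (window_pow W n).

Lemma within_continuous_nbhsP (T S : topologicalType) (A : set T) (f : T -> S) :
  {within A, continuous f} <->
  forall x, A x -> forall B, nbhs (f x) B -> \forall y \near x, A y -> B (f y).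
Proof.
rewrite subspace_continuousP; split => [fA x Ax B fB|fA x Ax B fB].
  exact: (fA x Ax B fB).
exact: (fA x Ax B fB).
Qed.

(** [grad] is a limit along the interior of W^n. The interior being dense, the limit is unique, and
    it is the value of the continuous extension [G] given by [C1_window]. Continuity and bounds up
    to the boundary are read off [G]. *)
Lemma gradE : exists G : 'M[R]_(n, d) -> 'M[R]_(n, d),
  [/\ {within Wn, continuous G},
      forall z, Wn z -> forall i, grad W g i z = row i (G z) &
      forall z, Wn° z -> forall v, 'D_v g z = \sum_i \sum_k v i k * G z i k].
Proof.
have [_ dg [G [cG GE]]] := g_C1; exists G; split => //.
- move=> z Wz i; apply: cvg_lim; first exact: norm_hausdorff.
    by apply: within_nbhs_proper; exact: (window_pow_closure_interior hW).
  apply: cvg_mx => l k; rewrite mxE.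
  move=> B GB; have := (within_continuous_nbhsP _ _).1 cG z Wz.
  move=> /(_ [set M : 'M[R]_(n, d) | B (M i k)]) => /(_ (@coord_continuous _ _ _ i k _ _ GB)).
  apply: filterS => y Gy Wy /=; rewrite mxE GE//.
  by apply: Gy; exact: interior_subset.
- move=> z Wz v; rewrite deriveE; last exact: dg.
  rewrite {1}[v]matrix_sum_delta linear_sum; apply: eq_bigr => i _.
  rewrite linear_sum; apply: eq_bigr => k _.
  by rewrite linearZ/= -deriveE ?GE//; exact: dg.
Qed.

Definition row_term (i : 'I_n) (z : 'M[R]_(n, d)) : R := dotv (grad W g i z) (row i z).

(** The velocity at [z] of the motion that dilates the i-th point about the origin and keeps the
    others in place. *)
Definition single_row (i : 'I_n) (z : 'M[R]_(n, d)) : 'M[R]_(n, d) :=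
  \matrix_(l, k) (if l == i then z l k else 0).

Lemma row_term_derive i z : Wn° z -> row_term i z = 'D_(single_row i z) g z.
Proof.
have [G [_ GE DE]] := gradE => Wz; rewrite DE// (bigD1 i)//= [X in _ + X]big1 ?addr0.
  rewrite /row_term/dotv GE; last exact: interior_subset.
  by apply: eq_bigr => k _; rewrite !mxE eqxx mulrC.
move=> l /negbTE li; rewrite big1// => k _; by rewrite mxE li mul0r.
Qed.

Lemma row_term_continuous i : {within Wn, continuous (row_term i)}.
Proof.
have [G [cG GE _]] := gradE.
have : {within Wn, continuous (fun z => \sum_(k < d) G z i k * z i k)}.
  move=> z; apply: cvg_sumr => k; apply: cvgM.
    apply: (@cvg_comp _ _ _ G (fun M : 'M[R]_(n, d) => M i k) _ _ _ (cG z)).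
    exact: coord_continuous.
  by apply: continuous_subspaceT; exact: coord_continuous.
apply: subspace_eq_continuous => z /set_mem Wz.
have E : row_term i z = \sum_(k < d) G z i k * z i k.
  by rewrite /row_term/dotv GE//; apply: eq_bigr => k _; rewrite !mxE.
exact: (esym E).
Qed.

Lemma row_term_bounded i : exists2 M, 0 <= M & forall z, Wn z -> `|row_term i z| <= M.
Proof. exact: (within_continuous_bounded hW (@row_term_continuous i)). Qed.

Lemma continuous_row_perm (s : 'S_n) : continuous (fun z : 'M[R]_(n, d) => row_perm s z).
Proof.
move=> z; apply: (@cvg_mx _ _ _ _ (nbhs z)) => i j; rewrite mxE.
by under eq_fun do rewrite mxE; exact: coord_continuous.
Qed.

Hypothesis g_sym : forall (s : 'S_n) z, Wn z -> g (row_perm s z) = g z.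

Lemma window_pow_row_perm (s : 'S_n) z : Wn z -> Wn (row_perm s z).
Proof.
move=> Wz i; rewrite (_ : row _ _ = row (s i) z); first exact: Wz.
by apply/rowP => j; rewrite !mxE.
Qed.

(* In the interior [row_term] is a directional derivative, which inherits the
   symmetry of [g]; the identity extends to W^n by density. *)
Lemma row_term_perm (s : 'S_n) i z : Wn z -> row_term i (row_perm s z) = row_term (s i) z.
Proof.
have interior_case y : Wn° y -> row_term i (row_perm s y) = row_term (s i) y.
  move=> Wy; have Wsy : Wn° (row_perm s y).
    apply: (window_pow_interior W _).2 => l; rewrite (_ : row _ _ = row (s l) y).
      exact: ((window_pow_interior W y).1 Wy).
    by apply/rowP => j; rewrite !mxE.
  rewrite !row_term_derive//.
  have <- : 'D_(single_row (s i) y) (fun x => g (row_perm s x)) y = 'D_(single_row (s i) y) g y.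
    by apply: near_eq_derive; apply: (@filterS _ (nbhs y) _ Wn _ _ Wy) => x Wx; exact: g_sym.
  (* The difference quotients already coincide before the limit, since moving row [s i] and then
     permuting is permuting and then moving row [i]. *)
  rewrite /derive; set f1 := (X in lim (X @ _) = _); set f2 := (X in _ = lim (X @ _)).
  suff -> : f1 = f2 by []; rewrite {}/f1 {}/f2; apply/funext => h /=.
  congr (_ *: (g _ - _)); apply/matrixP => l k; rewrite !mxE.
  by rewrite (inj_eq perm_inj).
move=> Wz; apply/eqP; apply: contrapT => /negP; rewrite -subr_eq0 => ne.
set e := `|row_term i (row_perm s z) - row_term (s i) z|.
have e0 : 0 < e / 2 by rewrite divr_gt0// normr_gt0.
have near_ball l (x : 'M[R]_(n, d)) : Wn x ->
    nbhs x [set y | Wn y -> ball (row_term l x) (e / 2) (row_term l y)].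
  move=> Wx; apply: ((within_continuous_nbhsP _ _).1 (@row_term_continuous l) x Wx).
  exact: nbhsx_ballx.
have h2 := @continuous_row_perm s z _ (near_ball i _ (window_pow_row_perm s Wz)).
have {h2}/(_ (nbhs_filter z)) h12 := filterI (near_ball (s i) _ Wz) h2.
have [y [Wy [y1 y2]]] := window_pow_closure_interior hW Wz h12.
have Wny : Wn y by exact: interior_subset.
have /= := y1 Wny; have /= := y2 (window_pow_row_perm s Wny).
rewrite (interior_case _ Wy) /ball/= => a1 a2.
have : e < e / 2 + e / 2.
  rewrite {1}/e -(subrKA (row_term (s i) y)) (le_lt_trans (ler_normD _ _))//.
  by rewrite ltrD// distrC.
by rewrite -splitr ltxx.
Qed.

(** The Euler operator applied to [g]: the derivative when all points are dilated together. *)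
Definition radial (z : 'M[R]_(n, d)) : R := \sum_i row_term i z.

Lemma radial_perm (s : 'S_n) z : Wn z -> radial (row_perm s z) = radial z.
Proof.
move=> Wz; rewrite /radial [RHS](reindex_inj (@perm_inj _ s)).
by apply: eq_bigr => i _; exact: row_term_perm.
Qed.

Lemma radial_continuous : {within Wn, continuous radial}.
Proof. by move=> z; apply: cvg_sumr => i; exact: row_term_continuous. Qed.
End gradient.

(** * Dilation of the last point *)

Section calculus.
Context (R : realType).

(** Dominated convergence is applied to sequences, so the increment is specialised to 1/(k+1). *)
Lemma derive_seq (V : normedModType R) (f : V -> R) (x v : V) :
  derivable f x v ->
  (fun k => k.+1%:R * (f (k.+1%:R^-1 *: v + x) - f x)) @ \oo --> 'D_v f x.
Proof.
move=> df; pose h (k : nat) : R := k.+1%:R^-1.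
have hcvg : h @ \oo --> (0 : R)^'.
  move=> A [e/= e0 eA]; have hb : \forall k \near \oo, ball (0 : R) e (h k).
    exact: (@cvg_harmonic R _ (nbhsx_ballx 0 _ e0)).
  apply: (filterS _ hb) => k ke; apply: (eA (h k) ke).
  by rewrite /h invr_eq0 pnatr_eq0.
have := @cvg_comp _ _ _ h _ _ _ _ hcvg df.
by apply: cvg_trans; apply: near_eq_cvg; near=> k; rewrite /= /h invrK.
Unshelve. all: by end_near. Qed.

(** The limit is the derivative of t^-d at t = 1. *)
Lemma cvg_dilation_factor (d : nat) :
  (fun k => k.+1%:R * (((1 + k.+1%:R^-1) ^+ d)^-1 - 1)) @ \oo --> (- d%:R : R).
Proof.
have dF : is_derive (1 : R) (1 : R) (fun t : R => (t ^+ d)^-1) (- d%:R).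
  have h : is_derive (1 : R) (1 : R) (fun t : R => t ^+ d) (d%:R).
    split; first exact: exprn_derivable.
    by rewrite exp_derive expr1n scaler1 [LHS]mulr1.
  have n0 : (1 : R) ^+ d != 0 by rewrite expr1n oner_eq0.
  have [h1 h2] := h; split; first exact: (@derivableV _ _ (fun t : R => t ^+ d) (1 : R) (1 : R) n0 h1).
  by rewrite (@deriveV _ _ (fun t : R => t ^+ d) (1 : R) (1 : R) n0 h1) h2 !expr1n invr1 scaleN1r.
have [df <-] := dF; have := derive_seq df; apply: cvg_trans; apply: near_eq_cvg.
by near=> k; rewrite /= expr1n invr1 [_ *: 1]mulr1 [1 + _]addrC.
Unshelve. all: by end_near. Qed.

(** Let [c] be the first zero of [phi] in [a, b]. There is no zero in (a, c), so the mean value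
    theorem applies on [a, c], and phi c = 0. *)
Lemma lipschitz_from_zero (phi dphi : R -> R) (a b M : R) : a <= b -> 0 <= M ->
  continuous phi ->
  (forall t, a <= t <= b -> phi t != 0 -> is_derive t 1 phi (dphi t) /\ `|dphi t| <= M) ->
  phi b = 0 -> `|phi a| <= M * (b - a).
Proof.
move=> ab M0 cphi dM b0; pose Z := [set t | a <= t <= b /\ phi t = 0].
have Zb : Z b by rewrite /Z/= ab lexx.
have lbZ : lbound Z a by move=> t [/andP[]].
have hlZ : has_lbound Z by exists a.
pose c := inf Z.
have ac : a <= c by apply: lb_le_inf => //; exists b.
have cb : c <= b by exact: ge_inf.
(* By continuity [phi] would otherwise have no zero near [c], although [c] is the infimum of the
   zeros. *)
have c0 : phi c = 0.
  apply/eqP; apply: contrapT => /negP pc.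
  have h : \forall t \near c, phi t != 0.
    exact: (cphi c _ (open_nbhs_nbhs (conj (@open_neq _ 0) pc))).
  have [e/= e0 ce] := h.
  have [t Zt tc] := inf_adherent e0 (conj (ex_intro _ b Zb) hlZ).
  have : phi t != 0.
    apply: ce; rewrite /ball/= ltr0_norm// ?opprB ?subr_lt0.
      by rewrite ltrBlDl.
    rewrite lt_neqAle ge_inf// andbT; apply/eqP => ct.
    by move: pc; rewrite ct Zt.2 eqxx.
  by rewrite Zt.2 eqxx.
move: ac; rewrite le_eqVlt => /orP[/eqP ->|ac].
  by rewrite c0 normr0 mulr_ge0// subr_ge0.
have nz t : t \in `]a, c[ -> is_derive t 1 phi (dphi t) /\ `|dphi t| <= M.
  rewrite in_itv/= => /andP[at' tc].
  apply: dM; first by rewrite (ltW at') (le_trans (ltW tc)).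
  apply/eqP => t0; have := tc; rewrite ltNge => /negP; apply.
  by apply: ge_inf => //; rewrite /Z/= (ltW at') (le_trans (ltW tc)).
have cw : {within `[a, c], continuous phi} by exact: continuous_subspaceT.
have [t tac] := MVT ac (fun t H => (nz t H).1) cw.
rewrite c0 sub0r => E; rewrite -normrN E normrM (@ger0_norm _ (c - a)) ?subr_ge0 ?(ltW ac)//.
rewrite ler_pM//; first by rewrite subr_ge0 ltW.
  exact: (nz t tac).2.
by rewrite lerD2r.
Qed.

(* No derivative is required at the zeros of [phi]: a ray may meet the boundary
   of W infinitely often. *)
Lemma lipschitz_off_zeros (phi dphi : R -> R) (a b M : R) : a <= b -> 0 <= M ->
  continuous phi ->
  (forall t, a <= t <= b -> phi t != 0 -> is_derive t 1 phi (dphi t) /\ `|dphi t| <= M) ->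
  `|phi b - phi a| <= M * (b - a).
Proof.
move=> ab M0 cphi dM.
(* At a zero [c] the interval is split: the previous bound applies on [a, c] and, after the change
   of variable t -> - t, on [c, b]. Without a zero the mean value theorem applies directly. *)
have [[c [/andP[ac cb] c0]]|nz] := pselect (exists c, a <= c <= b /\ phi c = 0).
  have ha : `|phi a| <= M * (c - a).
    apply: (@lipschitz_from_zero phi dphi) => // t /andP[at' tc]; apply: dM.
    by rewrite at' (le_trans tc).
  have hb : `|phi b| <= M * (b - c).
    have := @lipschitz_from_zero (fun t => phi (- t)) (fun t => - dphi (- t)) (- b) (- c) M.
    rewrite !opprK -[- c + b]addrC; apply => //.
    - by rewrite lerN2.
    - by move=> t; apply: continuous_comp; [exact: oppr_continuous|exact: cphi].
    - move=> t /andP[bt tc] pt.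
      have [|//|dp dpM] := dM (- t); first by lra.
      rewrite normrN; split => //.
      have dN : is_derive t (1 : R) (fun t : R => - t) (- 1) by exact: is_deriveNid.
      by have := @is_derive1_comp R phi (fun t : R => - t) t _ _ dp dN; rewrite mulrN1.
  rewrite (le_trans (ler_normB _ _))// (le_trans (lerD hb ha))// -mulrDr.
  by rewrite ler_wpM2l//; lra.
move: ab; rewrite le_eqVlt => /orP[/eqP->|ab]; first by rewrite !subrr normr0 mulr0.
have nzd t : t \in `]a, b[ -> is_derive t 1 phi (dphi t) /\ `|dphi t| <= M.
  rewrite in_itv/= => /andP[at' tb].
  have tab : a <= t <= b by rewrite !ltW.
  by apply: dM => //; apply/eqP => t0; apply: nz; exists t.
have cw : {within `[a, b], continuous phi} by exact: continuous_subspaceT.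
have [t tab ->] := MVT ab (fun t H => (nzd t H).1) cw.
rewrite normrM (@ger0_norm _ (b - a)) ?subr_ge0 ?(ltW ab)// ler_wpM2r ?subr_ge0 ?(ltW ab)//.
exact: (nzd t tab).2.
Qed.
End calculus.

Section integral_affine.
Context (R : realType) (m n : nat) (s : 'S_m) (a : 'I_m -> R).
Hypothesis a_gt0 : forall i, 0 < a i.
Let T (z : 'M[R]_(m, n)) : 'M[R]_(m, n) := \matrix_(i, j) (a i * z (s i) j).
Let c : R := \prod_i ((a i)^-1) ^+ n.

Let c_ge0 : 0 <= c.
Proof. by apply: prodr_ge0 => i _; rewrite exprn_ge0// invr_ge0 ltW. Qed.

Lemma measurable_mx_scale : measurable_fun setT T.
Proof.
apply: measurable_fun_mx => i j; rewrite /T.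
under eq_fun do rewrite mxE.
by apply: measurable_funM => //; exact: measurable_mx_coord.
Qed.

Lemma ge0_integral_mx_scale (h : 'M[R]_(m, n) -> \bar R) :
  measurable_fun setT h -> (forall z, 0 <= h z)%E ->
  (\int[leb_mx]_z h (T z) = c%:E * \int[leb_mx]_z h z)%E.
Proof.
move=> mh h0; rewrite -(ge0_integral_mscale (@leb_mx R m n) measurableT (NngNum c_ge0) mh)//.
rewrite -[LHS](ge0_integral_pushforward measurable_mx_scale (@leb_mx R m n) (D := setT))//.
apply: eq_measure_integral => [|mT A mA _]; first exact: measurable_mx_scale.
have := @leb_mx_affine R m n s a 0 A a_gt0 mA => E.
rewrite /mscale/= -[RHS]E /pushforward; congr leb_mx.
have TE (z : 'M[R]_(m, n)) : \matrix_(i, j) (a i * z (s i) j + (0 : 'M[R]_(m, n)) i j) = T z.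
  by apply/matrixP => i j; rewrite !mxE addr0.
by apply/seteqP; split => z /=; rewrite TE.
Qed.

Lemma integral_mx_scale (h : 'M[R]_(m, n) -> \bar R) : leb_mx.-integrable setT h ->
  (\int[leb_mx]_z h (T z) = c%:E * \int[leb_mx]_z h z)%E.
Proof.
move=> ih; have mh := measurable_int _ ih.
rewrite integralE [in RHS]integralE muleBr//; last first.
  by apply: fin_num_adde_defl; rewrite fin_numN; apply: integrable_neg_fin_num.
have mpos : measurable_fun setT (h^\+)%E by exact: measurable_funepos.
have mneg : measurable_fun setT (h^\-)%E by exact: measurable_funeneg.
congr (_ - _)%E; rewrite -ge0_integral_mx_scale//; apply: eq_integral => z _.
  by rewrite -[RHS]/(((h^\+)%E \o T) z) -funepos_comp.
by rewrite -[RHS]/(((h^\-)%E \o T) z) -funeneg_comp.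
Qed.
End integral_affine.

Section dilation.
Context (R : realType) (d : nat) (W : set 'rV[R]_d) (hW : window W).
Variables (n : nat) (g : 'M[R]_(n + 1, d) -> R) (f0 : 'M[R]_(n, d) -> R).
Hypothesis g_C1 : C1_window W g.
Hypothesis f0_cont : {within window_pow W n, continuous f0}.
Hypothesis g_boundary : forall z x, window_pow W n z -> boundary W x ->
  g (col_mx z x) = f0 z.
Local Notation Wn := (window_pow W n).
Local Notation WS := (window_pow W (n + 1)).
Let last : 'I_(n + 1) := rshift n ord0.

Lemma window_pow_splitP (z : 'M[R]_(n + 1, d)) :
  WS z <-> Wn (usubmx z) /\ W (dsubmx z).
Proof.
have rowl i : row (lshift 1 i) z = row i (usubmx z) by apply/rowP => k; rewrite !mxE.
have rowr : row last z = dsubmx z.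
  by apply/rowP => k; rewrite !mxE; congr (z _ _); apply/val_inj.
split => [Wz|[Wu Wd] i]; first by split => [i|]; rewrite -?rowl -?rowr; exact: Wz.
case: (splitP i) => k ik.
  rewrite (_ : i = lshift 1 k); last exact: val_inj.
  by rewrite rowl; exact: Wu.
by rewrite (_ : i = last) ?rowr//; apply: val_inj; rewrite /= ik ord1.
Qed.

Lemma window_pow_interior_splitP (z : 'M[R]_(n + 1, d)) :
  WS° z <-> Wn° (usubmx z) /\ W° (dsubmx z).
Proof.
have rowl i : row (lshift 1 i) z = row i (usubmx z) by apply/rowP => k; rewrite !mxE.
have rowr : row last z = dsubmx z.
  by apply/rowP => k; rewrite !mxE; congr (z _ _); apply/val_inj.
split => [/window_pow_interior Wz|[/window_pow_interior Wu Wd]].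
  split; last by rewrite -rowr; exact: Wz.
  by apply/window_pow_interior => i; rewrite -rowl; exact: Wz.
apply/window_pow_interior => i; case: (splitP i) => k ik.
  rewrite (_ : i = lshift 1 k); last exact: val_inj.
  by rewrite rowl; exact: Wu.
by rewrite (_ : i = last) ?rowr//; apply: val_inj; rewrite /= ik ord1.
Qed.

Definition dil (t : R) (z : 'M[R]_(n + 1, d)) : 'M[R]_(n + 1, d) :=
  \matrix_(i, j) ((if i == last then t else 1) * z i j).

Lemma usubmx_dil t z : usubmx (dil t z) = usubmx z.
Proof.
apply/matrixP => i j; rewrite !mxE (_ : lshift 1 i == last = false) ?mul1r//.
by apply/eqP => /(congr1 val)/=; rewrite addn0 => E; have := ltn_ord i; rewrite E ltnn.
Qed.

Lemma dsubmx_dil t z : dsubmx (dil t z) = t *: dsubmx z.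
Proof. by apply/matrixP => i j; rewrite !mxE ord1 eqxx. Qed.

Lemma dilE t z : dil t z = (z - single_row last z) + t *: single_row last z.
Proof.
apply/matrixP => i j; rewrite !mxE; case: eqP => _; first by rewrite subrr add0r.
by rewrite mul1r mulr0 subr0 addr0.
Qed.

Lemma dil1 z : dil 1 z = z.
Proof. by apply/matrixP => i j; rewrite !mxE; case: ifP; rewrite mul1r. Qed.

Lemma single_row_dil t z : single_row last (dil t z) = t *: single_row last z.
Proof. by apply/matrixP => i j; rewrite !mxE; case: (i == last); rewrite ?mulr0. Qed.

Lemma dil_continuous z : continuous (dil ^~ z).
Proof.
move=> t; rewrite (_ : dil ^~ z = fun t => (z - single_row last z) + t *: single_row last z).
  by apply: cvgD; [exact: cvg_cst|apply: cvgZr_tmp; exact: cvg_id].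
by apply/funext => s; rewrite dilE.
Qed.

(* Extension by zero of [g - f0], continuous along the rays of [dil] since
   [g] agrees with [f0] when the last point is on the boundary of W. *)
Definition excess : 'M[R]_(n + 1, d) -> R :=
  (fun z => g z - f0 (usubmx z)) \_ WS.

Lemma excess_in z : WS z -> excess z = g z - f0 (usubmx z).
Proof. by move=> Wz; rewrite /excess patchT ?inE. Qed.

Lemma excess_out z : ~ WS z -> excess z = 0.
Proof. by move=> Wz; rewrite /excess patchC// inE. Qed.

Lemma excess_boundary z : Wn (usubmx z) -> ~ W° (dsubmx z) -> excess z = 0.
Proof.
move=> Wu nWd; have [Wz|nWz] := pselect (WS z); last exact: excess_out.
rewrite excess_in//; have [_ Wd] := (window_pow_splitP z).1 Wz.
rewrite -{1}(vsubmxK z) g_boundary ?subrr//.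
exact/(boundaryE hW).
Qed.

(** There are three positions of the moving point. Outside the closed set W, the excess vanishes
    nearby; in the interior, it is g - f0 nearby; on the boundary, it is zero, and nearby it is
    either zero or g - f0 with [g] close to its boundary value f0. *)
Lemma excess_dil_continuous z : Wn (usubmx z) -> continuous (fun t => excess (dil t z)).
Proof.
move=> Wu t0; rewrite /continuous_at; have dc := @dil_continuous z t0.
have dsub_cvg : dsubmx (dil t z) @[t --> t0] --> dsubmx (dil t0 z).
  rewrite dsubmx_dil; under eq_cvg do rewrite dsubmx_dil.
  by apply: cvgZr_tmp; exact: cvg_id.
have [Wd|nWd] := pselect (W (dsubmx (dil t0 z))); last first.
  rewrite excess_out; last by move=> /window_pow_splitP[].
  have : \forall t \near t0, ~ W (dsubmx (dil t z)).
    exact: (dsub_cvg (~` W) (open_nbhs_nbhs (conj (closed_openC (window_closed hW)) nWd))).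
  move=> h; apply: cvg_near_cst; apply: filterS h => t nW.
  by rewrite excess_out// => /window_pow_splitP[].
have W0 : WS (dil t0 z) by apply/window_pow_splitP; rewrite usubmx_dil.
have gnear e : 0 < e -> \forall t \near t0, WS (dil t z) -> `|g (dil t0 z) - g (dil t z)| < e.
  move=> e0; have [cg _ _] := g_C1.
  have := (within_continuous_nbhsP _ _).1 cg _ W0 _ (nbhsx_ballx _ _ e0).
  by move=> /dc.
apply/cvgrPdist_lt => e e0.
have [Wd0|nWd0] := pselect (W° (dsubmx (dil t0 z))).
  have h : \forall t \near t0, W (dsubmx (dil t z)) by exact: (dsub_cvg W Wd0).
  apply: filterS2 h (gnear _ e0) => t Wt gt.
  have Wtz : WS (dil t z) by apply/window_pow_splitP; rewrite usubmx_dil.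
  by rewrite !excess_in// !usubmx_dil opprB addrA subrK; exact: gt.
rewrite excess_boundary ?usubmx_dil//; apply: filterS (gnear _ e0) => t gt.
have [Wt|nWt] := pselect (WS (dil t z)); last by rewrite excess_out// subrr normr0.
rewrite sub0r normrN excess_in// usubmx_dil.
suff <- : g (dil t0 z) = f0 (usubmx z) by rewrite distrC; exact: gt Wt.
rewrite -{1}(vsubmxK (dil t0 z)) g_boundary ?usubmx_dil//.
exact/(boundaryE hW).
Qed.

Local Notation phi z := (fun t => excess (dil t z)).
Local Notation dphi z := (fun t => 'D_(single_row last z) g (dil t z)).

Lemma excess_dil_derive z t : WS° (dil t z) -> is_derive t 1 (phi z) (dphi z t).
Proof.
move=> Wt; have [_ dg _] := g_C1.
have gd : is_derive t 1 (fun s => g (dil s z) - f0 (usubmx z)) (dphi z t).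
  have dgv : derivable g ((z - single_row last z) + t *: single_row last z) (single_row last z).
    by apply: diff_derivable; apply: dg; rewrite -dilE.
  have := is_derive_line dgv; rewrite -dilE => h.
  have -> : (fun s => g (dil s z) - f0 (usubmx z)) =
      (fun s => g ((z - single_row last z) + s *: single_row last z)) \- cst (f0 (usubmx z)).
    by apply/funext => s; rewrite dilE.
  by apply: is_derive_eq; rewrite subr0.
apply: near_eq_is_derive gd.
have Wnear : \forall s \near t, WS° (dil s z).
  exact: (@dil_continuous z t _ (open_nbhs_nbhs (conj (open_interior WS) Wt))).
by apply: filterS Wnear => s Ws; rewrite excess_in ?usubmx_dil//; exact: interior_subset.
Qed.

Lemma row_term_dil z t : WS° (dil t z) -> row_term W g last (dil t z) = t * dphi z t.
Proof.
move=> Wt; have [_ dg _] := g_C1.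
rewrite (row_term_derive hW g_C1)// single_row_dil !deriveE; [|exact: dg..].
by rewrite linearZ.
Qed.

Lemma excess_neq0 z : Wn (usubmx z) -> excess z != 0 -> WS z /\ W° (dsubmx z).
Proof.
move=> Wu e0; split.
  by apply: contrapT => nW; move: e0; rewrite excess_out ?eqxx.
by apply: contrapT => nW; move: e0; rewrite excess_boundary ?eqxx.
Qed.

Definition quotient (k : nat) (z : 'M[R]_(n + 1, d)) : R :=
  k.+1%:R * (excess (dil (1 + k.+1%:R^-1) z) - excess z).

(** The mean value inequality between t = 1 and t = 1 + 1/(k+1). Where the excess does not vanish,
    the last point is interior; the other n points, which do not move, are assumed interior as soon
    as they are in W, and this fails only on a null set. *)
Lemma quotient_bound : exists2 M, 0 <= M & forall z k,
  (Wn (usubmx z) -> Wn° (usubmx z)) -> `|quotient k z| <= M.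
Proof.
have [M M0 rM] := row_term_bounded hW g_C1 last; exists M => // z k Wint.
have [Wu|nWu] := pselect (Wn (usubmx z)); last first.
  by rewrite /quotient !excess_out ?subrr ?mulr0 ?normr0// => /window_pow_splitP[]; rewrite ?usubmx_dil.
have k0 : (0 : R) < k.+1%:R^-1 by rewrite invr_gt0.
rewrite /quotient normrM ger0_norm// -ler_pdivlMl// -{2}(dil1 z) mulrC.
have := @lipschitz_off_zeros R (phi z) (dphi z) 1 (1 + k.+1%:R^-1) M.
rewrite [1 + _ - 1]addrC addKr; apply => //.
- by rewrite lerDl ltW.
- exact: excess_dil_continuous.
move=> t /andP[t1 _] pt.
have [|Wt Wdt] := excess_neq0 _ pt; first by rewrite usubmx_dil.
have Wti : WS° (dil t z).
  by apply/window_pow_interior_splitP; rewrite usubmx_dil; split => //; exact: Wint.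
split; first exact: excess_dil_derive.
(* Since t >= 1, the derivative along the ray is at most [t] times itself in absolute value, and
   that product is the bounded [row_term] at the dilated point. *)
apply: le_trans (rM _ Wt); rewrite row_term_dil// normrM ler_peMl//.
by rewrite ger0_norm// (le_trans ler01).
Qed.

(** A dilation by a factor at least 1 does not bring a point back into the cube. The quotients thus
    have a common bounded support, and a multiple of the indicator of the cube dominates them. *)
Lemma quotient_support (m : nat) z k : WS `<=` mx_cube (n + 1) d m ->
  ~ mx_cube (n + 1) d m z -> quotient k z = 0.
Proof.
move=> WSm nz; rewrite /quotient !excess_out ?subrr ?mulr0//; first by move=> /WSm.
move=> /WSm zl; apply: nz => i j; have := zl i j.
have k0 : (0 : R) < k.+1%:R^-1 by rewrite invr_gt0.
rewrite /= !in_itv/= -!ler_norml mxE normrM; apply: le_trans.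
by rewrite ler_peMl//; case: ifP => _; rewrite ?normr1// ger0_norm ?addr_ge0// lerDl ltW.
Qed.

(** In W^n this is the derivative along the ray at t = 1. Outside W^n the quotients vanish
    eventually, the complement of W being open. *)
Lemma quotient_cvg z : (WS z -> WS° z) ->
  quotient ^~ z @ \oo --> (row_term W g last \_ WS) z.
Proof.
move=> Wint; have [Wz|nWz] := pselect (WS z).
  have W1 : WS° (dil 1 z) by rewrite dil1; exact: Wint.
  have [df fE] := excess_dil_derive W1.
  have := row_term_dil W1; rewrite mul1r -fE dil1 patchT ?inE// => ->.
  have := derive_seq df; apply: cvg_trans; apply: near_eq_cvg; near=> k.
  by rewrite /quotient /= dil1 [_ *: 1]mulr1 [_^-1 + 1]addrC.
rewrite patchC ?inE//.
have [Wu|nWu] := pselect (Wn (usubmx z)); last first.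
  apply: cvg_near_cst; near=> k; rewrite /quotient !excess_out ?subrr ?mulr0//.
  by move=> /window_pow_splitP[]; rewrite usubmx_dil.
have nWd : ~ W (dsubmx z) by move=> Wd; apply: nWz; apply/window_pow_splitP.
have l1 : (fun k => 1 + k.+1%:R^-1) @ \oo --> (1 : R).
  rewrite -[X in _ --> X]addr0; apply: cvgD; first exact: cvg_cst.
  exact: cvg_harmonic.
have lz : (fun k => (1 + k.+1%:R^-1 : R) *: dsubmx z) @ \oo --> dsubmx z.
  rewrite -[X in _ --> X]scale1r; exact: cvgZr_tmp.
have h : \forall k \near \oo, ~ W ((1 + k.+1%:R^-1 : R) *: dsubmx z).
  exact: (lz (~` W) (open_nbhs_nbhs (conj (closed_openC (window_closed hW)) nWd))).
apply: cvg_near_cst; apply: filterS h => k nW; rewrite /quotient !excess_out ?subrr ?mulr0//.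
by move=> /window_pow_splitP[_]; rewrite dsubmx_dil.
Unshelve. all: by end_near. Qed.
End dilation.

Section dilation_integral.
Context (R : realType) (d : nat) (W : set 'rV[R]_d) (hW : window W).
Variables (n : nat) (g : 'M[R]_(n + 1, d) -> R) (f0 : 'M[R]_(n, d) -> R).
Hypothesis g_C1 : C1_window W g.
Hypothesis f0_cont : {within window_pow W n, continuous f0}.
Hypothesis g_boundary : forall z x, window_pow W n z -> boundary W x ->
  g (col_mx z x) = f0 z.
Local Notation Wn := (window_pow W n).
Local Notation WS := (window_pow W (n + 1)).
Local Notation last := (rshift n (@ord0 0)).
Local Notation exc := (excess W g f0).

Lemma measurable_usubmx m1 m2 : measurable_fun setT (@usubmx R m1 m2 d).
Proof.
apply: measurable_fun_mx => i j.
by under eq_fun do rewrite mxE; exact: measurable_mx_coord.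
Qed.

Lemma integrable_usubmx : leb_mx.-integrable WS (EFin \o (f0 \o usubmx)).
Proof.
have [M M0 fM] := within_continuous_bounded hW f0_cont.
apply: measurable_bounded_integrable.
- exact: window_pow_measurable.
- exact: leb_window_pow_finite.
- apply: (measurable_comp (F := Wn)).
  + exact: window_pow_measurable.
  + by move=> _ [z /window_pow_splitP[Wu _] <-].
  + apply: within_continuous_measurable_mx f0_cont; exact: window_pow_measurable.
  + by apply: measurable_funTS; exact: measurable_usubmx.
- exists M; split; [exact: num_real|move=> y My z /window_pow_splitP[Wu _] /=].
  by rewrite (le_trans (fM _ Wu))// ltW.
Qed.

(** Tonelli: the integrand ignores the last point, which contributes the factor |W|. *)
Lemma ge0_integral_usubmx (h : 'M[R]_(n, d) -> \bar R) :
  measurable_fun Wn h -> (forall z, 0 <= h z)%E ->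
  (\int[leb_mx]_(z in WS) h (usubmx z) = leb_mx W * \int[leb_mx]_(z in Wn) h z)%E.
Proof.
move=> mh h0; have mWn := window_pow_measurable hW n.
have mW := window_measurable hW.
have mh' : measurable_fun setT (h \_ Wn) by exact: ((measurable_restrictT h mWn).1 mh).
have h0' z : (0 <= (h \_ Wn) z)%E by rewrite patchE; case: ifP.
pose H (p : 'M[R]_(n, d) * 'rV[R]_d) : \bar R := ((h \_ Wn) p.1 * (\1_W p.2)%:E)%E.
have mH : measurable_fun setT H.
  apply: emeasurable_funM; first exact: measurableT_comp.
  by apply/measurable_EFinP; exact: measurableT_comp.
have H0 p : (0 <= H p)%E by rewrite mule_ge0// lee_fin.
pose split (z : 'M[R]_(n + 1, d)) := (usubmx z, dsubmx z).
have msplit : measurable_fun setT split.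
  apply: measurable_fun_pair; first exact: measurable_usubmx.
  apply: measurable_fun_mx => i j.
  by under eq_fun do rewrite mxE; exact: measurable_mx_coord.
transitivity (\int[leb_mx]_z H (split z))%E.
  rewrite integral_mkcond; apply: eq_integral => z _; rewrite /H/split/= !patchE indicE.
  have [Wz|nWz] := pselect (WS z).
    have [Wu Wd] := (window_pow_splitP W z).1 Wz.
    by rewrite !mem_set// mule1.
  rewrite memNset//; have [Wu|nWu] := pselect (Wn (usubmx z)).
    rewrite (mem_set Wu) (memNset (A := W)) ?mule0// => Wd.
    by apply: nWz; apply/window_pow_splitP.
  by rewrite (memNset nWu) mul0e.
transitivity (\int[@leb_mx R n d \x @leb_mx R 1 d]_p H p)%E.
  rewrite -[LHS](ge0_integral_pushforward msplit (@leb_mx R (n + 1) d) (D := setT) (f := H))//.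
  apply: eq_measure_integral => A mA _.
  apply/esym/product_measure_unique => // B C mB mC.
  by rewrite /= /pushforward -leb_mx_col_mx.
rewrite fubini_tonelli1//.
rewrite /fubini_F /H/=.
have m1 : measurable_fun setT (fun x : 'rV[R]_d => (\1_W x : R)%:E).
  by apply/measurable_EFinP.
have E u : (\int[leb_mx]_x ((h \_ Wn) u * (\1_W x)%:E) = (h \_ Wn) u * leb_mx W)%E.
  rewrite (@ge0_integralZl _ _ _ leb_mx _ measurableT (fun x : 'rV[R]_d => (\1_W x : R)%:E) m1)//.
  by rewrite integral_indic// setIT.
under eq_integral do rewrite E.
rewrite ge0_integralZr// muleC; congr (_ * _)%E.
by rewrite [RHS]integral_mkcond.
Qed.

Lemma Rintegral_usubmx : \int[leb_mx]_(z in WS) f0 (usubmx z) =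
  fine (leb_mx W) * \int[leb_mx]_(z in Wn) f0 z.
Proof.
have fW : leb_mx W \is a fin_num by rewrite ge0_fin_numE//; exact: window_finite.
have int_f0 := within_continuous_integrable hW f0_cont.
have mf := measurable_int _ int_f0.
have mWn := window_pow_measurable hW n.
have p := integrable_pos_fin_num mWn int_f0.
have q := integrable_neg_fin_num mWn int_f0.
rewrite /Rintegral -fineM//; last exact: integrable_fin_num.
congr fine; rewrite integralE [in RHS]integralE muleBr//; last first.
  by apply: fin_num_adde_defl; rewrite fin_numN.
have mpos : measurable_fun Wn ((EFin \o f0)^\+)%E by exact: measurable_funepos.
have mneg : measurable_fun Wn ((EFin \o f0)^\-)%E by exact: measurable_funeneg.
congr (_ - _)%E; rewrite -ge0_integral_usubmx//; apply: eq_integral => z _.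
  by rewrite -[RHS]/((((EFin \o f0)^\+)%E \o usubmx) z) -funepos_comp.
by rewrite -[RHS]/((((EFin \o f0)^\-)%E \o usubmx) z) -funeneg_comp.
Qed.

Lemma excess_integrable : leb_mx.-integrable setT (EFin \o exc).
Proof.
have -> : EFin \o exc = (EFin \o (fun z => g z - f0 (usubmx z))) \_ WS.
  by rewrite /excess restrict_EFin.
apply/(integrable_mkcond _ (window_pow_measurable hW _)).
have [cg _ _] := g_C1.
have := integrableB (window_pow_measurable hW _) (within_continuous_integrable hW cg) integrable_usubmx.
by apply: eq_integrable => //; exact: window_pow_measurable.
Qed.

Lemma Rintegral_excess : \int[leb_mx]_z exc z =
  \int[leb_mx]_(z in WS) g z - fine (leb_mx W) * \int[leb_mx]_(z in Wn) f0 z.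
Proof.
have [cg _ _] := g_C1; rewrite -Rintegral_usubmx -RintegralB//.
- by rewrite [RHS]Rintegral_mkcond.
- exact: window_pow_measurable.
- exact: within_continuous_integrable.
- exact: integrable_usubmx.
Qed.

Lemma Rintegral_quotient k : \int[leb_mx]_z quotient W g f0 k z =
  k.+1%:R * (((1 + k.+1%:R^-1) ^+ d)^-1 - 1) * \int[leb_mx]_z exc z.
Proof.
have k0 : (0 : R) < k.+1%:R^-1 by rewrite invr_gt0.
have l0 : (0 : R) < 1 + k.+1%:R^-1 by rewrite addr_gt0.
pose a (i : 'I_(n + 1)) : R := if i == last then 1 + k.+1%:R^-1 else 1.
have a0 i : 0 < a i by rewrite /a; case: ifP.
have cE : \prod_i ((a i)^-1) ^+ d = ((1 + k.+1%:R^-1) ^+ d)^-1.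
  rewrite (bigD1 last)//= big1 ?mulr1 /a ?eqxx ?exprVn// => i /negbTE ->.
  by rewrite invr1 expr1n.
have dilE z : dil (1 + k.+1%:R^-1) z = \matrix_(i, j) (a i * z ((1 : 'S_(n + 1)) i)%g j).
  by apply/matrixP => i j; rewrite !mxE perm1.
have ie := excess_integrable.
have me : measurable_fun setT exc by apply/measurable_EFinP; exact: measurable_int ie.
have E : (\int[leb_mx]_z (exc (dil (1 + k.+1%:R^-1) z))%:E =
    (((1 + k.+1%:R^-1) ^+ d)^-1)%:E * \int[leb_mx]_z (exc z)%:E)%E.
  rewrite -cE -(integral_mx_scale 1%g a0 ie); apply: eq_integral => z _.
  by rewrite /= dilE.
have idil : leb_mx.-integrable setT (EFin \o (fun z => exc (dil (1 + k.+1%:R^-1) z))).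
  have mdil : measurable_fun setT (fun z : 'M[R]_(n + 1, d) => dil (1 + k.+1%:R^-1) z).
    by under eq_fun do rewrite dilE; exact: measurable_mx_scale.
  apply/integrableP; split; first by apply/measurable_EFinP; exact: measurableT_comp.
  have /integrableP[_] := ie.
  have mabs : measurable_fun setT (fun z => (`|exc z|)%:E).
    by apply/measurable_EFinP; exact: measurableT_comp.
  have -> : (\int[leb_mx]_z `|(EFin \o (fun z => exc (dil (1 + k.+1%:R^-1) z))) z| =
      (((1 + k.+1%:R^-1) ^+ d)^-1)%:E * \int[leb_mx]_z (`|exc z|)%:E)%E.
    rewrite -cE -(ge0_integral_mx_scale 1%g a0 mabs); last by move=> z; rewrite lee_fin.
    by apply: eq_integral => z _; rewrite /= dilE.
  by move=> ?; rewrite lte_mul_pinfty// lee_fin invr_ge0 exprn_ge0 ?ltW.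
rewrite RintegralZl//; last first.
  exact: (integrableB measurableT idil ie).
rewrite RintegralB// -mulrA mulrBl mul1r; congr (_ * (_ - _)).
by rewrite /Rintegral E fineM//; exact: integrable_fin_num ie.
Qed.

Lemma Rintegral_row_term : \int[leb_mx]_(z in WS) row_term W g last z =
  - d%:R * (\int[leb_mx]_(z in WS) g z - fine (leb_mx W) * \int[leb_mx]_(z in Wn) f0 z).
Proof.
rewrite -Rintegral_excess.
have [m WSm] := mx_bounded_subset (window_pow_bounded hW (n + 1)).
have [M M0 qM] := quotient_bound hW g_C1 g_boundary.
have mWS := window_pow_measurable hW (n + 1).
have mWn := window_pow_measurable hW n.
have mer : measurable_fun WS (row_term W g last).
  by apply: within_continuous_measurable_mx => //; exact: row_term_continuous.
have mh : measurable_fun setT (row_term W g last \_ WS).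
  exact: ((measurable_restrictT _ mWS).1 mer).
have me : measurable_fun setT exc by apply/measurable_EFinP; exact: measurable_int excess_integrable.
have mq k : measurable_fun setT (quotient W g f0 k).
  apply: measurable_funM => //; apply: measurable_funB => //.
  apply: measurableT_comp => //; apply: measurable_fun_mx => i j; rewrite /dil.
  by under eq_fun do rewrite mxE; apply: measurable_funM => //; exact: measurable_mx_coord.
(* Pointwise convergence requires all n + 1 points off the boundary, the domination only the first
   n: hence two exceptional null sets. *)
have nullS : {ae leb_mx, forall z : 'M[R]_(n + 1, d), WS z -> WS° z}.
  exists (WS `\` WS°); split.
  - by apply: measurableD => //; apply: open_measurable_mx; exact: open_interior.
  - exact: window_pow_boundary_null.
  - by move=> z /= /not_implyP.
have nulln : {ae leb_mx, forall z : 'M[R]_(n + 1, d), Wn (usubmx z) -> Wn° (usubmx z)}.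
  have mD : measurable (Wn `\` Wn°).
    by apply: measurableD => //; apply: open_measurable_mx; exact: open_interior.
  exists (usubmx @^-1` (Wn `\` Wn°)); split.
  - by have := @measurable_usubmx n 1 measurableT _ mD; rewrite setTI.
  - have := @leb_mx_col_mx R n 1 d _ setT mD measurableT.
    rewrite window_pow_boundary_null// mul0e => <-; congr leb_mx.
    by apply/seteqP; split => z //= [].
  - by move=> z /= /not_implyP.
have mcube : measurable (mx_cube (n + 1) d m : set 'M[R]_(n + 1, d)) by exact: measurable_mx_box.
have idom : leb_mx.-integrable setT (EFin \o (fun z : 'M[R]_(n + 1, d) => M * \1_(mx_cube (n + 1) d m) z)).
  have -> : EFin \o (fun z : 'M[R]_(n + 1, d) => M * \1_(mx_cube (n + 1) d m) z) =
      (EFin \o cst M) \_ (mx_cube (n + 1) d m).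
    apply/funext => z /=; rewrite patchE indicE; case: ifP => _ /=; first by rewrite mulr1.
    by rewrite mulr0.
  apply/(integrable_mkcond _ mcube); apply: measurable_bounded_integrable => //.
    exact: leb_mx_cube.
  by exists M; split; [exact: num_real|move=> y My z _ /=; rewrite ger0_norm// ltW].
have [||||intH _ lim_q] := @dominated_convergence _ _ _ (@leb_mx R (n + 1) d) setT measurableT
  (fun k z => (quotient W g f0 k z)%:E) (EFin \o (row_term W g last \_ WS)) _ _ _ _ idom.
- by move=> k; apply/measurable_EFinP.
- exact/measurable_EFinP.
- apply: filterS nullS => z Wz _; apply: cvg_EFin; first by near=> k.
  exact: quotient_cvg.
- apply: filterS nulln => z Wz k _; rewrite /= lee_fin indicE.
  have [zc|nzc] := pselect (mx_cube (n + 1) d m z).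
    by rewrite mem_set// mulr1; exact: qM.
  by rewrite memNset// mulr0 (quotient_support _ _ _ WSm nzc) normr0.
have finH := integrable_fin_num measurableT intH.
rewrite -(fineK finH) in lim_q.
(* The same sequence of integrals is computed twice: by dominated convergence its limit is the
   integral of [row_term], and by the exact scaling of Lebesgue measure it is -d times the integral
   of the excess. *)
have lim1 : (fun k => k.+1%:R * (((1 + k.+1%:R^-1) ^+ d)^-1 - 1) * \int[leb_mx]_z exc z) @ \oo -->
    fine (\int[leb_mx]_z (EFin \o (row_term W g last \_ WS)) z)%E.
  rewrite (_ : (fun k => _) = fine \o (fun k => \int[leb_mx]_z (quotient W g f0 k z)%:E)%E).
    exact: fine_cvg lim_q.
  by apply/funext => k; rewrite -Rintegral_quotient.
have lim2 : (fun k => k.+1%:R * (((1 + k.+1%:R^-1) ^+ d)^-1 - 1) * \int[leb_mx]_z exc z) @ \oo -->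
    - d%:R * \int[leb_mx]_z exc z.
  by apply: cvgM; [exact: cvg_dilation_factor|exact: cvg_cst].
suff <- : fine (\int[leb_mx]_z (EFin \o (row_term W g last \_ WS)) z)%E = - d%:R * \int[leb_mx]_z exc z.
  by rewrite [LHS]Rintegral_mkcond.
by apply: (cvg_unique _ lim1 lim2).
Unshelve. all: by end_near. Qed.
End dilation_integral.

Section radial_integral.
Context (R : realType) (d : nat) (W : set 'rV[R]_d) (hW : window W).

Lemma integral_row_perm n (s : 'S_n) (h : 'M[R]_(n, d) -> R) :
  leb_mx.-integrable (window_pow W n) (EFin \o h) ->
  \int[leb_mx]_(z in window_pow W n) h (row_perm s z) =
  \int[leb_mx]_(z in window_pow W n) h z.
Proof.
move=> ih; have mW := window_pow_measurable hW n.
have ih' : leb_mx.-integrable setT (EFin \o (h \_ (window_pow W n))).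
  have -> : EFin \o (h \_ (window_pow W n)) = (EFin \o h) \_ (window_pow W n).
    by rewrite restrict_EFin.
  exact/(integrable_mkcond _ mW).
rewrite Rintegral_mkcond [RHS]Rintegral_mkcond /Rintegral; congr fine.
have := @integral_mx_scale R n d s (fun=> 1) (fun=> ltr01) _ ih'.
rewrite big1 ?mul1e; last by move=> i _; rewrite invr1 expr1n.
move=> <-; apply: eq_integral => z _ /=; congr EFin.
have -> : \matrix_(i, j) (1 * z (s i) j) = row_perm s z.
  by apply/matrixP => i j; rewrite !mxE mul1r.
rewrite !patchE; have [Wz|nWz] := pselect (window_pow W n z).
  by rewrite (mem_set Wz) mem_set//; exact: window_pow_row_perm.
rewrite (memNset nWz) memNset// => Wsz; apply: nWz.
have := window_pow_row_perm s^-1%g Wsz.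
by rewrite -row_permM mulVg row_perm1.
Qed.

(** Regularity is imposed on the form functions for n >= 1 only; for n = 0 the domain is a single
    point. *)
Lemma form0_continuous (f : 'M[R]_(0, d) -> R) : {within window_pow W 0, continuous f}.
Proof.
have -> : f = cst (f 0) by apply/funext => z; rewrite (flatmx0 z).
by move=> z; exact: cvg_cst.
Qed.

Lemma form_continuous (f : forms (R := R)) n : DomD W f -> {within window_pow W n, continuous (f n)}.
Proof.
move=> [[_ [C C0 fC]] _]; case: n => [|n]; first exact: form0_continuous.
by have [[]] := fC n.+1 isT.
Qed.

Lemma Rintegral_radial (f : forms (R := R)) n : DomD W f ->
  \int[leb_mx]_(z in window_pow W (n + 1)) radial W (f (n + 1)%N) z =
  - (n + 1)%:R * d%:R * (\int[leb_mx]_(z in window_pow W (n + 1)) f (n + 1)%N z -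
    fine (leb_mx W) * \int[leb_mx]_(z in window_pow W n) f n z).
Proof.
move=> fD; have [[fS [C C0 fC]] fb] := fD.
have g_C1 : C1_window W (f (n + 1)%N).
  by have [|//] := fC (n + 1)%N; rewrite addn1.
have g_sym s z : window_pow W (n + 1) z -> f (n + 1)%N (row_perm s z) = f (n + 1)%N z.
  by have [+ _] := fS (n + 1)%N; apply.
have mW := window_pow_measurable hW (n + 1).
have irow i : leb_mx.-integrable (window_pow W (n + 1)) (EFin \o row_term W (f (n + 1)%N) i).
  by apply: within_continuous_integrable => //; exact: row_term_continuous.
have eqrow i : \int[leb_mx]_(z in window_pow W (n + 1)) row_term W (f (n + 1)%N) i z =
    \int[leb_mx]_(z in window_pow W (n + 1)) row_term W (f (n + 1)%N) (rshift n ord0) z.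
  rewrite -(integral_row_perm (tperm i (rshift n ord0)) (irow i)).
  by apply: eq_Rintegral => z /set_mem Wz; rewrite row_term_perm// tpermL.
have lastE := Rintegral_row_term hW g_C1 (@form_continuous f n fD) (fb n).
transitivity (\sum_(i < n + 1) \int[leb_mx]_(z in window_pow W (n + 1)) row_term W (f (n + 1)%N) i z).
  rewrite /Rintegral sum_fine; last by move=> i _; exact: (integrable_fin_num mW (irow i)).
  congr fine; rewrite -integral_sum//.
  by apply: eq_integral => z _; rewrite -sumEFin.
under eq_bigr do rewrite eqrow lastE.
by rewrite sumr_const card_ord -mulr_natl; ring.
Qed.
End radial_integral.

(** * The Poisson formula on {N(W) = n} *)

Section permutation_count.
Variable T : finType.
Local Open Scope nat_scope.

Lemma sum_count_mem (s : seq T) : \sum_(x : T) count_mem x s = size s.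
Proof.
under eq_bigr do rewrite -sum1_count big_mkcond/=.
rewrite exchange_big/= -sum1_size; apply: eq_bigr => y _.
by rewrite -big_mkcond/= sum1_card -[RHS](card1 y); apply: eq_card => x; rewrite !inE eq_sym.
Qed.

(** The multinomial formula, by induction on the size. Permutations are sorted by their first letter
    x; removing one x divides the product of factorials by the multiplicity of x, and the
    multiplicities add up to the size. *)
Lemma size_permutations_fact (s : seq T) :
  size (permutations s) * \prod_(x : T) (count_mem x s)`! = (size s)`!.
Proof.
have [n] := ubnP (size s); elim: n s => // n IH s; rewrite ltnS => sn.
have [->|s0] := eqVneq s [::]; first by rewrite /= big1.
have s_gt0 : 0 < size s by rewrite lt0n size_eq0.
rewrite (perm_size (permutationsE s_gt0)) size_allpairs_dep sumnE big_map.
rewrite big_distrl/= -[RHS](prednK (fact_gt0 _)) prednK ?fact_gt0//.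
have remE x : x \in s -> size (permutations (rem x s)) * \prod_(y : T) (count_mem y s)`! =
    count_mem x s * (size s).-1`!.
  move=> xs; have sr := size_rem xs.
  rewrite -sr -(IH (rem x s)); last by rewrite sr; move: s_gt0 sn; case: (size s).
  rewrite mulnCA; congr (_ * _)%N.
  rewrite (bigD1 x)//= [in RHS](bigD1 x)//= mulnA; congr (_ * _)%N.
    rewrite count_rem xs/= eqxx subn1.
    by move: xs; rewrite -has_pred1 has_count; case: count => // k _; rewrite factS.
  by apply: eq_bigr => y yx; rewrite count_rem xs/= eq_sym (negbTE yx) subn0.
rewrite (eq_big_seq (fun x => count_mem x s * (size s).-1`!)); last first.
  by move=> x; rewrite mem_undup => /remE.
rewrite -big_distrl/=; have -> : \sum_(x <- undup s) count_mem x s = size s.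
  rewrite big_uniq ?undup_uniq//= -[RHS]sum_count_mem [RHS](bigID (mem s))/=.
  rewrite [X in _ = _ + X]big1 ?addn0; last by move=> x /count_memPn.
  by apply: eq_bigl => x; rewrite mem_undup.
by case: (size s) s_gt0 => // k _; rewrite factS.
Qed.

Lemma card_perm_eq n (u : n.-tuple T) :
  #|[pred v : n.-tuple T | perm_eq v u]| * \prod_(x : T) (count_mem x u)`! = n`!.
Proof.
rewrite -[in RHS](size_tuple u) -size_permutations_fact; congr (_ * _)%N.
rewrite cardE -(size_map val); apply/perm_size/uniq_perm.
- by rewrite map_inj_uniq ?enum_uniq//; exact: val_inj.
- exact: permutations_uniq.
move=> t; rewrite mem_permutations; apply/mapP/idP => [[v + ->]|tu].
  by rewrite mem_enum.
have st : size t == n by rewrite (perm_size tu) size_tuple.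
by exists (Tuple st) => //; rewrite mem_enum.
Qed.
End permutation_count.

(** * Law of the word of cells of a configuration *)

Section poisson_words.
Context (R : realType) (d : nat) (W : set 'rV[R]_d) (hW : window W).
Context (disp : measure_display) (Omega : measurableType disp).
Variables (P : probability Omega R) (X : Omega -> set 'rV[R]_d) (theta : R).
Hypothesis X_Poisson : homogeneous_Poisson P X theta.
Local Notation vol A := (fine (leb_mx A)).

(** The list of points underlying [points_in], in the same arbitrary order. *)
Definition obs (w : Omega) : seq 'rV[R]_d := fset_set (X w `&` W).

Lemma obsP w x : reflect ((X w `&` W) x) (x \in obs w).
Proof.
have [fX _ _ _] := X_Poisson.
rewrite /obs in_fset_set; last by apply: fX; exact: window_bounded.
by apply: (iffP idP) => [/set_mem|/mem_set].
Qed.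

Lemma obs_sub w x : x \in obs w -> W x.
Proof. by move=> /obsP[]. Qed.

Lemma count_in_obs A w : A `<=` W -> count_in X A w = count (fun x => `[< A x >]) (obs w).
Proof.
move=> AW; have [fX _ _ _] := X_Poisson.
rewrite /count_in cardfE -cardfE -size_filter; apply/perm_size/uniq_perm.
- exact: fset_uniq.
- by rewrite filter_uniq// fset_uniq.
move=> x; rewrite mem_filter in_fset_set; last first.
  apply: fX; case: (window_bounded hW) => M [Mr WM]; exists M; split => // y My z /AW.
  exact: WM.
apply/idP/andP => [/set_mem[Xx Ax]|[/asboolP Ax /obsP[Xx _]]]; last exact: mem_set.
by split; [exact/asboolP|apply/obsP; split => //; exact: AW].
Qed.

Variables (m : nat) (cl : 'rV[R]_d -> 'I_m).
Let A i := W `&` [set x | cl x = i].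
Hypothesis mA : forall i, measurable (A i).

(** The order of the letters is arbitrary, so only events and functions invariant under permutation
    of the word are used. *)
Definition word w := map cl (obs w).

Lemma count_in_cell i w : count_in X (A i) w = count_mem i (word w).
Proof.
rewrite count_in_obs; last by move=> x [].
rewrite count_map; apply: eq_in_count => x xs /=.
by apply/asboolP/eqP => [[]|clx] //; split => //; exact: obs_sub xs.
Qed.

(** Equality up to permutation is equality of the numbers of occurrences, that is, of the counts in
    the cells, whose joint law is known. *)
Lemma cell_event n (u : n.-tuple 'I_m) :
  [set w | perm_eq (word w) u] = \bigcap_i [set w | count_in X (A i) w = count_mem i u].
Proof.
apply/seteqP; split => w /=; first by move=> /seq.permP H i _; rewrite /= count_in_cell H.
by move=> H; apply/allP => i _ /=; rewrite -count_in_cell; apply/eqP/H.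
Qed.

Lemma cell_trivIset : trivIset setT A.
Proof. by move=> i j _ _ [x [[_ /= <-] [_ /= <-]]]. Qed.

Lemma cell_bounded i : bounded_set (A i).
Proof.
case: (window_bounded hW) => M [Mr WM]; exists M; split => // y My z [Wz _].
exact: WM.
Qed.

Lemma cell_fin i : leb_mx (A i) \is a fin_num.
Proof. by rewrite ge0_fin_numE//; apply: leb_mx_bounded => //; exact: cell_bounded. Qed.

Lemma sum_vol_cell : \sum_i vol (A i) = vol W.
Proof.
rewrite sum_fine; last by move=> i _; exact: cell_fin.
have EW : W = \big[setU/set0]_(i < m) A i.
  rewrite -bigcup_seq; apply/seteqP; split => [x Wx|x [i _ []]//].
  by exists (cl x); rewrite //= mem_index_enum.
congr fine; rewrite [X in _ = leb_mx X]EW measure_semi_additive_ord//.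
- exact: cell_trivIset.
- by rewrite -EW; exact: window_measurable.
Qed.

Lemma cell_event_measurable n (u : n.-tuple 'I_m) : measurable [set w | perm_eq (word w) u].
Proof.
have [_ mX _ _] := X_Poisson.
rewrite cell_event; apply: fin_bigcap_measurable => [|i _]; first exact: finite_finset.
by apply: mX => //; exact: cell_bounded.
Qed.

Lemma prod_count_mem (F : 'I_m -> R) (u : seq 'I_m) :
  \prod_i F i ^+ count_mem i u = \prod_(j <- u) F j.
Proof.
elim: u => [|a u IH]; first by rewrite big_nil big1.
rewrite big_cons -IH/=; under eq_bigr do rewrite exprD.
rewrite big_split/=; congr (_ * _); rewrite (bigD1 a)//= eqxx expr1 big1 ?mulr1//.
by move=> i /negbTE ia; rewrite eq_sym ia expr0.
Qed.

(** The cells are disjoint, so the counts are independent; the exponentials multiply to exp(- theta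
    |W|) because the volumes of the cells add up to |W|. *)
Lemma prob_word n (u : n.-tuple 'I_m) : P [set w | perm_eq (word w) u] =
  (expR (- (theta * vol W)) * theta ^+ n * \prod_(j <- u) vol (A j) /
   (\prod_(i < m) (count_mem i u)`!)%:R)%:E.
Proof.
have [_ _ PX indep] := X_Poisson.
rewrite cell_event (indep m A (fun i => count_mem i u)); last exact: cell_trivIset.
  rewrite (eq_bigr (fun i => ((theta * vol (A i)) ^+ count_mem i u /
      ((count_mem i u)`!)%:R * expR (- (theta * vol (A i))))%:E)); last first.
    by move=> i _; exact: (PX (A i) _ (mA i) (cell_bounded i)).
  rewrite prodEFin; congr EFin.
  rewrite big_split/= -[X in _ * X = _]expR_sum sumrN.
  rewrite -mulr_sumr sum_vol_cell prodf_div/=.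
  under eq_bigr do rewrite exprMn.
  rewrite big_split/= !prod_count_mem.
  have -> : \prod_(j <- u) theta = theta ^+ n by rewrite big_tuple prodr_const card_ord.
  by rewrite natr_prod; ring.
by move=> i; split; [exact: mA|exact: cell_bounded].
Qed.

Lemma perm_words_gt0 n (u : n.-tuple 'I_m) : (0 < #|[pred v : n.-tuple 'I_m | perm_eq v u]|)%N.
Proof. by apply/card_gt0P; exists u; rewrite inE. Qed.

(** The multinomial count replaces the product of factorials by n!, so that every ordering of [u]
    receives the same weight. *)
Lemma prob_word_card n (u : n.-tuple 'I_m) :
  P [set w | perm_eq (word w) u] =
  (expR (- (theta * vol W)) * theta ^+ n / n`!%:R * \prod_(j <- u) vol (A j) *
   #|[pred v : n.-tuple 'I_m | perm_eq v u]|%:R)%:E.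
Proof.
rewrite prob_word -(card_perm_eq u) natrM; congr EFin; field.
rewrite !pnatr_eq0 -!lt0n perm_words_gt0 andbT.
by rewrite prodn_gt0// => i; rewrite fact_gt0.
Qed.

(** The factor |W|^n of the Poisson probability is absent because the integral over W^n carries
    it. *)
Definition poisson_weight n : R := expR (- (theta * vol W)) * theta ^+ n / n`!%:R.

Lemma size_word w : size (word w) = count_in X W w.
Proof. by rewrite size_map. Qed.

Lemma count_event_measurable n : measurable [set w | count_in X W w = n].
Proof.
have [_ mX _ _] := X_Poisson.
by apply: mX; [exact: window_measurable|exact: window_bounded].
Qed.

Variable h : seq 'I_m -> R.
Hypothesis h_perm : forall s t, perm_eq s t -> h s = h t.
Local Notation EN n := [set w | count_in X W w = n].
Let K n (u : n.-tuple 'I_m) : R := #|[pred v : n.-tuple 'I_m | perm_eq v u]|%:R.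

(** On N(W) = n exactly the [K u] rearrangements of the word contribute, all with the same value of
    [h]. Dividing by [K] avoids choosing a representative of each class of words. *)
Lemma word_sum n w : ((fun w => h (word w)) \_ (EN n)) w =
  \sum_(u : n.-tuple 'I_m) h u / K u * \1_[set w | perm_eq (word w) u] w.
Proof.
have [Ew|nEw] := pselect (count_in X W w = n); last first.
  rewrite patchC ?inE// big1// => u _; rewrite indicE memNset ?mulr0//= => wu.
  by apply: nEw; rewrite -size_word (perm_size wu) size_tuple.
rewrite patchT ?inE//.
have sw : size (word w) == n by rewrite size_word Ew.
pose v := Tuple sw.
rewrite (bigID (fun u : n.-tuple 'I_m => perm_eq u v))/= [X in _ + X]big1 ?addr0; last first.
  move=> u uv; rewrite indicE memNset ?mulr0//= => wu; move: uv.
  by rewrite perm_sym wu.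
rewrite (eq_bigr (fun=> h v / K v)); last first.
  move=> u uv; rewrite indicE mem_set ?mulr1/=; last by rewrite perm_sym.
  rewrite (h_perm uv); rewrite /K; congr (_ / _%:R); apply: eq_card => x; rewrite !inE.
  exact: (permPr uv).
rewrite sumr_const -[X in _ *+ X]/#|[pred u : n.-tuple 'I_m | perm_eq u v]|.
by rewrite -mulr_natr divfK// pnatr_eq0 -lt0n perm_words_gt0.
Qed.

Lemma word_measurable n : measurable_fun (EN n) (fun w => h (word w)).
Proof.
apply/(measurable_restrictT _ (count_event_measurable n)).
apply: (eq_measurable_fun (fun w => \sum_(u : n.-tuple 'I_m)
    h u / K u * \1_[set w | perm_eq (word w) u] w)).
  by move=> w _; rewrite -word_sum.
apply: measurable_sum => u; apply: measurable_funM => //.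
by apply: measurable_indic; exact: cell_event_measurable.
Qed.

Lemma word_integral n : \int[P]_(w in EN n) h (word w) =
  poisson_weight n * \sum_(u : n.-tuple 'I_m) h u * \prod_(j <- u) vol (A j).
Proof.
rewrite Rintegral_mkcond.
under eq_Rintegral do rewrite word_sum.
have int1 (u : n.-tuple 'I_m) : P.-integrable setT (EFin \o \1_[set w | perm_eq (word w) u]).
  by apply: integrable_indic; exact: cell_event_measurable.
have intu (u : n.-tuple 'I_m) :
    P.-integrable setT (EFin \o (fun w => h u / K u * \1_[set w | perm_eq (word w) u] w)).
  by have := integrableZl measurableT (h u / K u) (int1 u); apply: eq_integrable.
have valu (u : n.-tuple 'I_m) :
    (\int[P]_w (h u / K u * \1_[set w | perm_eq (word w) u] w)%:E =
     (h u / K u)%:E * P [set w | perm_eq (word w) u])%E.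
  transitivity ((h u / K u)%:E * \int[P]_w (\1_[set w | perm_eq (word w) u] w)%:E)%E.
    by rewrite -(integralZl measurableT (int1 u)).
  by rewrite integral_indic// ?setIT//; exact: cell_event_measurable.
rewrite /Rintegral; under eq_integral do rewrite -sumEFin.
rewrite integral_sum// -sum_fine; last first.
  by move=> u _; exact: (integrable_fin_num measurableT (intu u)).
rewrite mulr_sumr; apply: eq_bigr => u _.
(* The multiplicity [K u] cancels against the number of orderings in the probability, leaving a
   plain sum over all words. *)
rewrite valu prob_word_card -EFinM/= /poisson_weight /K; field.
by rewrite !pnatr_eq0 -!lt0n perm_words_gt0 fact_gt0.
Qed.
End poisson_words.

(** * Uniform continuity and fine measurable partitions of W *)

Section uniform_partition.
Context (R : realType) (d : nat) (W : set 'rV[R]_d) (hW : window W).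

(** Heine's theorem, from the near-covering form of compactness with the radius tending to 0 from
    the right as parameter. The halves of [r] and [e] pay for the passage through the centre of a
    covering ball. *)
Lemma window_pow_uniform n (g : 'M[R]_(n, d) -> R) (e : R) : 0 < e ->
  {within window_pow W n, continuous g} ->
  exists2 r : R, 0 < r & forall z y, window_pow W n z -> window_pow W n y ->
    ball z r y -> `|g z - g y| < e.
Proof.
move=> e0 cg; have := window_pow_compact hW n.
rewrite compact_near_coveringP => /(_ R (0 : R)^'+ (fun r z => window_pow W n z ->
  forall y, window_pow W n y -> ball z r y -> `|g z - g y| < e)) near_cover.
have e2 : 0 < e / 2 by rewrite divr_gt0.
have Hnear : \forall r \near (0 : R)^'+, window_pow W n `<=` (fun z => window_pow W n z ->
      forall y, window_pow W n y -> ball z r y -> `|g z - g y| < e).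
  apply: near_cover => x Wx.
  have := (within_continuous_nbhsP _ _).1 cg x Wx _ (nbhsx_ballx _ _ e2).
  move=> /nbhs_ballP[r/= r0 xr].
  have r2 : 0 < r / 2 by rewrite divr_gt0.
  exists (ball x (r / 2), [set t | 0 < t < r / 2]).
    split => /=; first exact: nbhsx_ballx.
    by near=> t; apply/andP; split; near: t; [exact: nbhs_right_gt|exact: nbhs_right_lt].
  move=> [z t] [/= xz /andP[t0 tr]] Wz y Wy zy.
  have xz' : ball x r z by apply: le_ball xz; lra.
  have xy : ball x r y.
    rewrite (splitr r); apply: ball_triangle xz _.
    exact: le_ball (ltW tr) _ zy.
  have := xr _ xz' Wz; have := xr _ xy Wy; rewrite /ball/= => h1 h2.
  rewrite (splitr e) -(subrKA (g x)) (le_lt_trans (ler_normD _ _))// ltrD//.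
  by rewrite distrC.
have H0 : \forall r \near (0 : R)^'+, 0 < r by exact: nbhs_right_gt.
have [r [r0 H]] := filter_ex (filterI H0 Hnear).
by exists r => // z y Wz Wy; exact: H.
Unshelve. all: by end_near. Qed.

Lemma window_nonempty : exists a, W a.
Proof.
have [_ W0 _] := hW; apply/set0P; apply/eqP => W0'.
by move: W0; rewrite W0' measure0 ltxx.
Qed.

Lemma measurable_find (s : seq 'rV[R]_d) r i :
  measurable [set x : 'rV[R]_d | find (fun a => `[< ball a r x >]) s = i].
Proof.
elim: s i => [|a s IH] i /=.
  by have [->|i0] := eqVneq i 0%N; [rewrite (_ : mkset _ = setT)//; apply/seteqP; split|
    rewrite (_ : mkset _ = set0)//; apply/seteqP; split => // x /= /esym/eqP; rewrite (negbTE i0)].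
case: i => [|i].
  rewrite (_ : mkset _ = ball a r); first exact: measurable_mx_ball.
  by apply/seteqP; split => x /=; case: asboolP.
rewrite (_ : mkset _ = [set x | find (fun a => `[< ball a r x >]) s = i] `\` ball a r).
  by apply: measurableD; [exact: IH|exact: measurable_mx_ball].
apply/seteqP; split => x /=; first by case: asboolP => // nb [->].
by move=> [<- nb]; case: asboolP.
Qed.

(** Finitely many balls of radius [r] cover W; a point is labelled by the first ball containing it,
    so that cells are differences of balls cut by W. *)
Lemma window_cells (r : R) : 0 < r ->
  exists m (cl : 'rV[R]_d -> 'I_m) (a : 'I_m -> 'rV[R]_d),
  [/\ forall i, W (a i), forall i, measurable (W `&` [set x | cl x = i]) &
      forall x, W x -> ball (a (cl x)) r x].
Proof.
move=> r0; have [cW _ _] := hW; have [a0 Wa0] := window_nonempty.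
move: cW; rewrite compact_cover => /(_ _ W (fun p => ball p r)) [|p Wp|D' D'W WD'].
- by move=> p _; exact: ball_open.
- by exists p => //; exact: ballxx.
pose s : seq 'rV[R]_d := D'.
(* [find] returns [size s] when no ball contains the point, hence one extra label, which does not
   occur on W. Its representative is the default [a0], chosen in W. *)
pose cl x : 'I_(size s).+1 := inord (find (fun a => `[< ball a r x >]) s).
have clE x : nat_of_ord (cl x) = find (fun a => `[< ball a r x >]) s.
  by rewrite inordK// ltnS find_size.
exists (size s).+1, cl, (fun i => nth a0 s i); split.
- move=> i; have [ilt|ige] := ltnP i (size s); last by rewrite nth_default.
  by apply/set_mem/D'W; exact: mem_nth.
- move=> i; apply: measurableI; first exact: window_measurable.
  rewrite (_ : mkset _ = [set x | find (fun a => `[< ball a r x >]) s = i]).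
    exact: measurable_find.
  apply/seteqP; split => x /=; rewrite -clE; first by move=> ->.
  by move/val_inj.
- move=> x Wx; rewrite clE; apply/asboolP.
  apply: (@nth_find _ a0 (fun a => `[< ball a r x >]) s); apply/hasP.
  by have [p pD' px] := WD' _ Wx; exists p => //; exact/asboolP.
Qed.
End uniform_partition.

Lemma Rintegral_dist (R : realType) dT (T : measurableType dT)
    (mu : {measure set T -> \bar R}) (D : set T) (f g : T -> R) (e : R) :
  measurable D -> (mu D < +oo)%E ->
  mu.-integrable D (EFin \o f) -> mu.-integrable D (EFin \o g) ->
  (forall x, D x -> `|f x - g x| <= e) ->
  `|\int[mu]_(x in D) f x - \int[mu]_(x in D) g x| <= e * fine (mu D).
Proof.
move=> mD Doo fi gi fg.
have fgi : mu.-integrable D (EFin \o (fun x => f x - g x)).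
  by have := integrableB mD fi gi; apply: eq_integrable.
rewrite -RintegralB// (le_trans (le_normr_Rintegral mD fgi))// -Rintegral_cst//.
apply: le_Rintegral => //; first exact: integrable_norm.
apply: measurable_bounded_integrable => //.
by exists `|e|; split; [exact: num_real|move=> y ey z _ /=; exact: ltW].
Qed.

(** * Expectation of a functional on {N(W) = n} *)

Section poisson_integral.
Context (R : realType) (d : nat) (W : set 'rV[R]_d) (hW : window W).
Context (disp : measure_display) (Omega : measurableType disp).
Variables (P : probability Omega R) (X : Omega -> set 'rV[R]_d) (theta : R).
Hypothesis X_Poisson : homogeneous_Poisson P X theta.
Hypothesis theta_ge0 : 0 <= theta.
Local Notation vol A := (fine (leb_mx A)).
Local Notation EN n := [set w | count_in X W w = n].

Definition list_mx n (s : seq 'rV[R]_d) : 'M[R]_(n, d) := \matrix_(i, k) (nth 0 s i) 0 k.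

(** Reading the form functions on lists removes the dependence of the matrix type on the random
    number of points, and treats observed points and representatives of cells alike. *)
Definition eval (f : @forms R d) (s : seq 'rV[R]_d) : R := f (size s) (list_mx (size s) s).

Lemma evalE f n s : size s = n -> eval f s = f n (list_mx n s).
Proof. by move=> <-. Qed.

Lemma functional_eval f w : functional X W f w = eval f (obs W X w).
Proof. by []. Qed.

Lemma window_pow_list n (s : seq 'rV[R]_d) : size s = n -> (forall x, x \in s -> W x) ->
  window_pow W n (list_mx n s).
Proof.
move=> sn sW i; rewrite (_ : row i _ = nth 0 s i); last by apply/rowP => k; rewrite !mxE.
by apply: sW; rewrite mem_nth// sn.
Qed.

Variable f : @forms R d.
Arguments f : clear implicits.
Hypothesis f_sym : forall n (s : 'S_n) z, window_pow W n z -> f n (row_perm s z) = f n z.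
Hypothesis f_cont : forall n, {within window_pow W n, continuous (f n)}.

Lemma eval_perm s t : (forall x, x \in s -> W x) -> perm_eq s t -> eval f s = eval f t.
Proof.
move=> sW st; have tn := perm_size st.
have /tuple_permP[p pE] : perm_eq t (in_tuple s) by rewrite perm_sym.
rewrite [RHS](evalE f (esym tn)) /eval -[LHS](f_sym p); last by apply: window_pow_list.
congr (f _ _); apply/matrixP => i k; rewrite !mxE.
suff -> : nth 0 t i = nth 0 s (p i) by [].
by rewrite pE -tnth_nth tnth_mktuple (tnth_nth 0).
Qed.

Lemma count_in_list_mx n w : count_in X W w = n -> window_pow W n (list_mx n (obs W X w)).
Proof. by move=> wn; apply: window_pow_list => // x; exact: (obs_sub hW X_Poisson). Qed.

(** Every point is replaced by the representative of its cell, with cells finer than the modulus of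
    uniform continuity of f_n. Both estimates are stated for one partition, since the expectation
    and the Lebesgue integral are compared through it. *)
Lemma approximation n (e : R) : 0 < e ->
  exists m (cl : 'rV[R]_d -> 'I_m) (a : 'I_m -> 'rV[R]_d),
  [/\ forall i, W (a i), forall i, measurable (W `&` [set x | cl x = i]),
      forall s, size s = n -> (forall x, x \in s -> W x) ->
        `|eval f s - eval f (map a (map cl s))| < e &
      forall z, window_pow W n z ->
        `|f n z - f n (list_mx n (map a (map cl [seq row i z | i <- enum 'I_n])))| < e].
Proof.
move=> e0; have [r r0 fr] := window_pow_uniform hW e0 (f_cont (n := n)).
have [m [cl [a [Wa mcl clr]]]] := window_cells hW r0.
exists m, cl, a.
have Wmap n' s : size s = n' -> window_pow W n' (list_mx n' (map a (map cl s))).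
  move=> sn; apply: window_pow_list; first by rewrite !size_map.
  by move=> x /mapP[i _ ->].
have lists s : size s = n -> (forall x, x \in s -> W x) ->
    `|eval f s - eval f (map a (map cl s))| < e.
  move=> sn sW; rewrite (evalE f sn) (@evalE f n); last by rewrite !size_map.
  apply: fr; [by apply: window_pow_list|by apply: Wmap|split => // i k].
  have ins : (i < size s)%N by rewrite sn.
  rewrite !mxE -map_comp (nth_map 0)//=; apply: ball_sym.
  by have [_ ] := clr _ (sW _ (mem_nth 0 ins)); apply.
split => // z Wz.
have sz : size [seq row i z | i <- enum 'I_n] = n by rewrite size_map size_enum_ord.
have zE : list_mx n [seq row i z | i <- enum 'I_n] = z.
  apply/matrixP => i k; rewrite mxE (nth_map i) ?size_enum_ord// nth_ord_enum mxE//.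
have := lists _ sz; rewrite (evalE f sz) zE (@evalE f n); last by rewrite 2!size_map.
by apply => x /mapP[i _ ->].
Qed.

Lemma integrable_indic_finite dT (T : measurableType dT) (mu : {measure set T -> \bar R}) (B : set T) :
  measurable B -> (mu B < +oo)%E -> mu.-integrable setT (EFin \o \1_B).
Proof.
move=> mB Boo; have -> : EFin \o \1_B = ((EFin \o cst (1 : R)) \_ B).
  by apply/funext => z /=; rewrite patchE indicE; case: ifP.
apply/(integrable_mkcond _ mB); apply: measurable_bounded_integrable => //.
by exists 1; split; [exact: num_real|move=> y My z _ /=; rewrite normr1 ltW].
Qed.

Section step.
Variables (m : nat) (cl : 'rV[R]_d -> 'I_m) (n : nat) (h : seq 'I_m -> R).
Let A i := W `&` [set x | cl x = i].
Hypothesis mA : forall i, measurable (A i).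
Let B (u : n.-tuple 'I_m) : set 'M[R]_(n, d) := [set z | forall j, A (tnth u j) (row j z)].
Let wz (z : 'M[R]_(n, d)) := map cl [seq row i z | i <- enum 'I_n].

(** The products of cells [B u] partition W^n, and the word of [z] is the index of its piece. *)
Lemma step_sum z : ((fun z => h (wz z)) \_ (window_pow W n)) z =
  \sum_(u : n.-tuple 'I_m) h u * \1_(B u) z.
Proof.
have [Wz|nWz] := pselect (window_pow W n z); last first.
  rewrite patchC ?inE// big1// => u _; rewrite indicE memNset ?mulr0//= => Bz.
  by apply: nWz => i; have [] := Bz i.
rewrite patchT ?inE//.
have sw : size (wz z) == n by rewrite 2!size_map size_enum_ord.
have tE j : tnth (Tuple sw) j = cl (row j z).
  rewrite (tnth_nth (cl (row j z)))/= /wz -map_comp (nth_map j) ?size_enum_ord//=.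
  by rewrite nth_ord_enum.
rewrite (bigD1 (Tuple sw))//= [X in _ + X]big1 ?addr0.
  by rewrite indicE mem_set ?mulr1// => j; rewrite tE; split => //; exact: Wz.
move=> u /eqP ne; rewrite indicE memNset ?mulr0//= => Bz; apply: ne.
by apply: eq_from_tnth => j; rewrite tE; have [_ /= ->] := Bz j.
Qed.

(** The right-hand side is the sum over words that occurs in [word_integral], where it carries the
    Poisson weight. *)
Lemma step_Rintegral : \int[leb_mx]_(z in window_pow W n) h (wz z) =
  \sum_(u : n.-tuple 'I_m) h u * \prod_(j <- u) vol (A j).
Proof.
have mB u : measurable (B u) by apply: (@measurable_rows R d n (fun j => A (tnth u j))) => j; exact: mA.
have lebB u : leb_mx (B u) = (\prod_(j <- u) vol (A j))%:E.
  rewrite [LHS](@leb_mx_rows R d n (fun j => A (tnth u j)) (fun j => mA (tnth u j))).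
  rewrite big_tuple -prodEFin; apply: eq_bigr => j _.
  by rewrite fineK//; exact: cell_fin.
have int1 u : leb_mx.-integrable setT (EFin \o \1_(B u)).
  have Boo : (leb_mx (B u) < +oo)%E by rewrite lebB ltry.
  exact: integrable_indic_finite.
have intu (u : n.-tuple 'I_m) : leb_mx.-integrable setT (EFin \o (fun z => h u * \1_(B u) z)).
  by have := integrableZl measurableT (h u) (int1 u); apply: eq_integrable.
rewrite Rintegral_mkcond; under eq_Rintegral do rewrite step_sum.
rewrite /Rintegral; under eq_integral do rewrite -sumEFin.
rewrite integral_sum// -sum_fine; last first.
  by move=> u _; exact: (integrable_fin_num measurableT (intu u)).
apply: eq_bigr => u _.
transitivity (fine ((h u)%:E * \int[leb_mx]_z (\1_(B u) z)%:E)%E).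
  by rewrite -(integralZl measurableT (int1 u)).
transitivity (fine ((h u)%:E * leb_mx (B u))%E); last by rewrite lebB.
by rewrite integral_indic// setIT.
Qed.

Lemma step_measurable : measurable_fun (window_pow W n) (fun z => h (wz z)).
Proof.
apply/(measurable_restrictT _ (window_pow_measurable hW n)).
apply: (eq_measurable_fun (fun z => \sum_(u : n.-tuple 'I_m) h u * \1_(B u) z)).
  by move=> w _; rewrite -step_sum.
apply: measurable_sum => u; apply: measurable_funM => //.
apply: measurable_indic; apply: (@measurable_rows R d n (fun j => A (tnth u j))) => j.
exact: mA.
Qed.
End step.

(** The points come in an arbitrary order, so measurability is drawn from the counts: on N(W) = n
    the functional is a pointwise limit of functions of the word, the k-th one being within
    1/(k+1). *)
Lemma functional_measurable n : measurable_fun (EN n) (functional X W f).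
Proof.
have k0 k : (0 : R) < k.+1%:R^-1 by rewrite invr_gt0.
pose Ap k g := exists m (cl : 'rV[R]_d -> 'I_m) (a : 'I_m -> 'rV[R]_d),
  [/\ forall i, W (a i), forall i, measurable (W `&` [set x | cl x = i]) &
   (forall s, size s = n -> (forall x, x \in s -> W x) ->
        `|eval f s - eval f (map a (map cl s))| < k.+1%:R^-1) /\
   g = (fun w => eval f (map a (word W X cl w)))].
have ex k : exists g, Ap k g.
  have [m [cl [a [Wa mcl H _]]]] := approximation n (k0 k).
  by exists (fun w => eval f (map a (word W X cl w))), m, cl, a; split.
apply: (@measurable_fun_cvg _ _ _ _ (fun k => sval (cid (ex k)))) => [k|w wn].
  case: cid => g /= [m [cl [a [Wa mcl [_ ->]]]]].
  apply: (word_measurable hW X_Poisson mcl (h := fun u => eval f (map a u))) => s t st.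
  by apply: eval_perm; [move=> x /mapP[i _ ->]|exact: perm_map].
apply/cvgrPdist_lt => e e0; near=> k; case: cid => g /= [m [cl [a [_ _ [H ->]]]]].
rewrite functional_eval; apply: lt_trans (H _ wn _) _.
  by move=> x; exact: (obs_sub hW X_Poisson).
near: k.
have hb : \forall k \near \oo, ball (0 : R) e (k.+1%:R^-1).
  exact: (@cvg_harmonic R _ (nbhsx_ballx 0 _ e0)).
apply: filterS hb => k; rewrite /ball/= sub0r normrN ger0_norm//.
Unshelve. all: by end_near. Qed.

Lemma functional_bounded n : exists2 M, 0 <= M & forall w, EN n w -> `|functional X W f w| <= M.
Proof.
have [M M0 fM] := within_continuous_bounded hW (f_cont (n := n)).
exists M => // w wn; rewrite functional_eval (evalE f wn); apply: fM.
exact: count_in_list_mx.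
Qed.

Lemma functional_integrable n : P.-integrable (EN n) (EFin \o functional X W f).
Proof.
have [M M0 fM] := functional_bounded n.
have mE := count_event_measurable hW X_Poisson n.
apply: measurable_bounded_integrable => //.
- by rewrite (le_lt_trans (probability_le1 _ mE))// ltry.
- exact: functional_measurable.
- by exists M; split; [exact: num_real|move=> y My z Wz; rewrite /= (le_trans (fM _ Wz))// ltW].
Qed.

(** Both sides are within a multiple of [e] of the same sum over words, for arbitrary [e]. *)
Lemma functional_Rintegral n : \int[P]_(w in EN n) functional X W f w =
  poisson_weight W theta n * \int[leb_mx]_(z in window_pow W n) f n z.
Proof.
set c := poisson_weight W theta n; set I := \int[P]_(w in _) _; set J := \int[leb_mx]_(z in _) _.
have mE := count_event_measurable hW X_Poisson n.
have mW := window_pow_measurable hW n.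
have c0 : 0 <= c by rewrite !mulr_ge0 ?expR_ge0 ?exprn_ge0 ?invr_ge0.
(* The 1 bounds the error e P(N(W) = n) on the side of the expectation; the other term is the error
   over W^n, multiplied by the weight. *)
pose C := 1 + c * fine (leb_mx (window_pow W n)).
have C0 : 0 < C by rewrite ltr_pwDl// mulr_ge0// fine_ge0.
suff H e : 0 < e -> `|I - c * J| <= e * C.
  apply/eqP; rewrite -subr_eq0 -normr_le0; apply/ler_addgt0Pl => e e0.
  by rewrite addr0 -(divfK (lt0r_neq0 C0) e); apply: H; rewrite divr_gt0.
move=> e0; have [m [cl [a [Wa mcl He Hz]]]] := approximation n e0.
pose h (u : seq 'I_m) := eval f (map a u).
have h_perm s t : perm_eq s t -> h s = h t.
  by move=> st; apply: eval_perm; [move=> x /mapP[i _ ->]|exact: perm_map].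
have wI := word_integral hW X_Poisson mcl h_perm n.
have sI := @step_Rintegral m cl n h mcl.
have [M M0 fM] := within_continuous_bounded hW (f_cont (n := n)).
have hM u : size u = n -> `|h u| <= M.
  move=> un; rewrite /h (@evalE f n); last by rewrite size_map.
  apply: fM; apply: window_pow_list; first by rewrite size_map.
  by move=> x /mapP[i _ ->].
have PE : (P (EN n) < +oo)%E by rewrite (le_lt_trans (probability_le1 _ mE))// ltry.
have distI : `|I - c * \sum_(u : n.-tuple 'I_m) h u * \prod_(j <- u) vol (W `&` [set x | cl x = j])| <= e.
  rewrite -wI; apply: le_trans (_ : _ <= e * fine (P (EN n))) _.
    apply: Rintegral_dist => //.
    - exact: functional_integrable.
    - apply: measurable_bounded_integrable => //.
        exact: (word_measurable hW X_Poisson mcl h_perm).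
      exists M; split; [exact: num_real|move=> y My w wn /=].
      by rewrite (le_trans (hM _ _)) ?size_word// ltW.
    - move=> w wn; rewrite functional_eval ltW//; apply: He => // x.
      exact: (obs_sub hW X_Poisson).
  by rewrite ler_piMr ?(ltW e0)// -lee_fin fineK ?probability_le1// ge0_fin_numE.
have distJ : `|J - \sum_(u : n.-tuple 'I_m) h u * \prod_(j <- u) vol (W `&` [set x | cl x = j])| <=
    e * fine (leb_mx (window_pow W n)).
  rewrite -sI; apply: Rintegral_dist => //.
  - exact: leb_window_pow_finite.
  - exact: within_continuous_integrable.
  - apply: measurable_bounded_integrable => //.
    + exact: leb_window_pow_finite.
    + exact: (@step_measurable m cl n h mcl).
    + exists M; split; [exact: num_real|move=> y My z _ /=].
      by rewrite (le_trans (hM _ _)) ?(ltW My)// 2!size_map size_enum_ord.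
  - move=> z Wz; rewrite ltW// /h (@evalE f n); last by rewrite 3!size_map size_enum_ord.
    exact: Hz.
set S := \sum_(u : n.-tuple 'I_m) _ in distI distJ.
rewrite (_ : I - c * J = (I - c * S) - c * (J - S)); last by ring.
rewrite (le_trans (ler_normB _ _))// normrM (ger0_norm c0) /C mulrDr mulr1 lerD// mulrCA.
by rewrite ler_wpM2l.
Qed.
End poisson_integral.

(** * From essential bounds to pointwise bounds *)

Section pointwise_bounds.
Context (R : realType) (d : nat) (W : set 'rV[R]_d) (hW : window W).

Lemma leb_mx_open_gt0 m n (U : set 'M[R]_(m, n)) : open U -> U !=set0 -> (0 < leb_mx U)%E.
Proof.
move=> oU [z Uz]; have /nbhs_ballP[e/= e0 zU] : nbhs z U by exact: open_nbhs_nbhs.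
apply: lt_le_trans (_ : leb_mx (ball z e) <= _)%E; last first.
  apply: le_measure; rewrite ?inE//; first exact: measurable_mx_ball.
  exact: open_measurable_mx.
rewrite (_ : ball z e = mx_box (fun i j => ball (z i j) e)); last first.
  by apply/seteqP; split => y; [case|split].
rewrite leb_mx_box; last by move=> i j; exact: measurable_ball.
under eq_bigr => i _ do under eq_bigr => j _ do rewrite lebesgue_measure_ball ?ltW//.
under eq_bigr do rewrite prodEFin.
rewrite prodEFin lte_fin; apply: prodr_gt0 => i _; apply: prodr_gt0 => j _.
by rewrite mulrn_wgt0.
Qed.

(** If the continuous [g] exceeded [K] somewhere on W^n, it would do so on a nonempty open subset of
    the interior, which has positive measure. Pointwise bounds are needed because the configuration
    is evaluated at individual points. *)
Lemma Linfty_pointwise n (g : 'M[R]_(n, d) -> R) (K : R) :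
  {within window_pow W n, continuous g} -> (Linfty_norm W g <= K%:E)%E ->
  forall z, window_pow W n z -> `|g z| <= K.
Proof.
move=> cg gK z Wz; rewrite leNgt; apply/negP => Kg.
pose e := `|g z| - K.
have e0 : 0 < e by rewrite subr_gt0.
have h := (within_continuous_nbhsP _ _).1 cg z Wz _ (nbhsx_ballx _ _ e0).
have /nbhs_ballP[r/= r0 zr] := h.
pose U := ball z r `&` (window_pow W n)°.
have oU : open U by apply: openI; [exact: ball_open|exact: open_interior].
have U0 : U !=set0.
  have [y [Wy zy]] := window_pow_closure_interior hW Wz (nbhsx_ballx z r r0).
  by exists y.
have UK y : U y -> K < `|g y|.
  move=> [zy Wy]; have := zr _ zy (interior_subset Wy).
  rewrite /ball/= /e => gy; have := ler_distD (g y) (g z) 0.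
  by rewrite !subr0; lra.
have muT : (0 < leb_mx [set: 'M[R]_(n, d)])%E.
  by apply: leb_mx_open_gt0; [exact: openT|exists z].
move: gK; rewrite /Linfty_norm unlock muT => gK.
have [N [mN N0 UN]] := (@ess_supP _ _ _ (@leb_mx R n d) _ _) gK.
have := leb_mx_open_gt0 oU U0; rewrite ltNge => /negP; apply.
rewrite -N0; apply: le_measure; rewrite ?inE//; first exact: open_measurable_mx.
move=> y Uy; apply: UN => /=; rewrite patchE mem_set; last exact: interior_subset Uy.2.
by rewrite /= lee_fin; apply/negP; rewrite -ltNge; exact: UK.
Qed.

(** The Euclidean norm of [u] is combined with the maximum norm of [v], hence the factor d. *)
Lemma dotv_le (u v : 'rV[R]_d) : `|dotv u v| <= d%:R * enorm u * `|v|.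
Proof.
have uk k : `|u 0 k| <= enorm u.
  rewrite /enorm -sqrtr_sqr; apply: ler_wsqrtr; rewrite /dotv (bigD1 k)//= expr2 lerDl.
  by apply: sumr_ge0 => i _; rewrite -expr2 sqr_ge0.
rewrite /dotv (le_trans (ler_norm_sum _ _ _))//.
apply: le_trans (_ : _ <= \sum_(k < d) enorm u * `|v|) _.
  apply: ler_sum => k _; rewrite normrM ler_pM//; exact: le_mx_norm_entry.
by rewrite sumr_const card_ord -[leLHS]mulr_natl mulrA.
Qed.

Lemma DomD_bound (f : forms (R := R)) : DomD W f -> exists2 K, 0 <= K & forall n z, window_pow W n z ->
  `|f n z| <= K * K ^+ n /\ `|radial W (f n) z| <= K * K ^+ n.
Proof.
move=> fD; have [[fS [C C0 fC]] fb] := fD.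
have [B [_ WB]] := window_bounded hW.
pose r := `|B| + 1; have r0 : 0 <= r by rewrite addr_ge0.
have Wr x : W x -> `|x| <= r by move=> Wx; apply: WB Wx; rewrite /r ltr_pwDr// ler_norm.
(* One constant serves everywhere: |f_0| for n = 0, [C] for f_n, 2C for the gradients, where the
   number n of terms is absorbed by 2^n, and d r for the scalar products with points of W. *)
pose K := 1 + `|f 0%N 0| + C + C + d%:R * r.
have [K1 KC KCC Kr Kf] : [/\ 1 <= K, C <= K, C + C <= K, d%:R * r <= K & `|f 0%N 0| <= K].
  have h1 := normr_ge0 (f 0%N 0); have h2 : 0 <= d%:R * r by rewrite mulr_ge0.
  by rewrite /K; move: (d%:R * r) (`|f 0%N 0|) h1 h2 => q p h1 h2; split; lra.
have K0 : 0 <= K by exact: le_trans K1.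
exists K => //.
case=> [|n] z Wz.
  split; last by rewrite /radial big_ord0 normr0 mulr1.
  by rewrite (flatmx0 z) mulr1.
have [C1 Cn] := fC n.+1 isT.
have Linfty_ge0 (g : 'M[R]_(n.+1, d) -> R) : (0 <= Linfty_norm W g)%E by exact: Lnorm_ge0.
have CK : C ^+ n.+1 <= K ^+ n.+1 by rewrite lerXn2r ?nnegrE ?(ltW C0).
have CC0 : 0 <= C + C by rewrite addr_ge0 ?ltW.
have C2K : (C + C) ^+ n.+1 <= K ^+ n.+1 by rewrite lerXn2r ?nnegrE.
have KK : K ^+ n.+1 <= K * K ^+ n.+1 by rewrite ler_peMl ?exprn_ge0.
have Linfty_sum_ge0 : (0 <= \sum_(i < n.+1) Linfty_norm W (fun z => enorm (grad W (f n.+1) i z)))%E.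
  by apply: sume_ge0 => i _.
split.
  rewrite (le_trans _ KK)// (le_trans _ CK)//; apply: Linfty_pointwise Wz; first by case: C1.
  by apply: le_trans Cn; rewrite leeDl.
have gradC i : enorm (grad W (f n.+1) i z) <= C ^+ n.+1.
  have [G [cG GE _]] := gradE hW C1.
  have := @Linfty_pointwise _ (fun z => enorm (grad W (f n.+1) i z)) (C ^+ n.+1) _ _ z Wz.
  rewrite ger0_norm ?sqrtr_ge0//; apply; last first.
    apply: le_trans Cn; apply: (le_trans _ (leeDr _ (Linfty_ge0 _))).
    by rewrite (bigD1 i)//= leeDl// sume_ge0.
  have : {within window_pow W n.+1, continuous (fun z => Num.sqrt (\sum_(k < d) G z i k * G z i k))}.
    move=> y; apply: (@cvg_comp _ _ _ (fun z => \sum_(k < d) G z i k * G z i k) (@Num.sqrt R));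
      last exact: sqrt_continuous.
    apply: cvg_sumr => k; apply: cvgM;
      by apply: (@cvg_comp _ _ _ G (fun M : 'M[R]_(n.+1, d) => M i k) _ _ _ (cG y)); exact: coord_continuous.
  apply: subspace_eq_continuous => y /set_mem Wy.
  have E : enorm (grad W (f n.+1) i y) = Num.sqrt (\sum_(k < d) G y i k * G y i k).
    by rewrite /enorm /dotv GE//; congr Num.sqrt; apply: eq_bigr => k _; rewrite !mxE.
  exact: (esym E).
rewrite /radial (le_trans (ler_norm_sum _ _ _))//.
apply: le_trans (_ : \sum_(i < n.+1) d%:R * C ^+ n.+1 * r <= _).
  apply: ler_sum => i _; apply: le_trans (dotv_le _ _) _.
  apply: ler_pM; rewrite ?mulr_ge0 ?sqrtr_ge0//; last exact/Wr/Wz.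
  by rewrite ler_wpM2l.
rewrite sumr_const card_ord -[leLHS]mulr_natl.
rewrite (_ : _ * _ = (d%:R * r) * (n.+1%:R * C ^+ n.+1)); last by ring.
apply: ler_pM => //; rewrite ?mulr_ge0 ?exprn_ge0 ?(ltW C0)//.
apply: le_trans C2K; rewrite (_ : C + C = 2 * C); last by ring.
rewrite exprMn ler_wpM2r ?exprn_ge0 ?(ltW C0)//.
by rewrite -natrX ler_nat ltnW// ltn_expl.
Qed.
End pointwise_bounds.

(** * Expectation of nabla on Dom(D) *)

Section count_calculus.
Context (R : realType) (d : nat) (W : set 'rV[R]_d) (hW : window W).
Context (disp : measure_display) (Omega : measurableType disp).
Variables (P : probability Omega R) (X : Omega -> set 'rV[R]_d) (theta : R).
Hypothesis X_Poisson : homogeneous_Poisson P X theta.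
Hypothesis theta_ge0 : 0 <= theta.
Local Notation vol A := (fine (leb_mx A)).
Local Notation EN n := [set w | count_in X W w = n].
Local Notation N := (count_in X W).

Let mE n : measurable (EN n).
Proof. exact: (count_event_measurable hW X_Poisson). Qed.

Lemma count_cover : \bigcup_n EN n = [set: Omega].
Proof. by rewrite -subTset => w _; exists (N w). Qed.

Lemma count_trivIset : trivIset setT (fun n => EN n).
Proof. by move=> i j _ _ [w [/= <- <-]]. Qed.

Lemma measurable_fun_count (G : Omega -> R) :
  (forall n, measurable_fun (EN n) G) -> measurable_fun setT G.
Proof. by move=> mG; rewrite -count_cover; apply/measurable_fun_bigcup. Qed.

Lemma prob_count n : P (EN n) =
  ((theta * vol W) ^+ n / n`!%:R * expR (- (theta * vol W)))%:E.
Proof.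
have [_ _ PX _] := X_Poisson.
exact: (PX W n (window_measurable hW) (window_bounded hW)).
Qed.

Lemma measurable_fun_countE (h : nat -> R) : measurable_fun setT (fun w => h (N w)).
Proof.
apply: measurable_fun_count => n; apply: (eq_measurable_fun (cst (h n))) => //.
by move=> w /set_mem /= ->.
Qed.

(** The generating function of the Poisson law: with r = theta |W| the terms are exp(- r) (K r)^n /
    n!, whose partial sums are at most exp(- r) exp(K r). *)
Lemma integrable_geom (K : R) : 0 <= K -> P.-integrable setT (EFin \o (fun w => K ^+ N w)).
Proof.
move=> K0; apply/integrableP; split.
  by apply/measurable_EFinP; exact: (measurable_fun_countE (fun n => K ^+ n)).
set r := theta * vol W; have r0 : 0 <= r by rewrite mulr_ge0// fine_ge0.
rewrite -count_cover ge0_integral_bigcup//; last 2 first.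
- apply/measurable_EFinP; apply: measurable_funTS; apply: measurableT_comp => //.
  exact: (measurable_fun_countE (fun n => K ^+ n)).
- exact: count_trivIset.
have E n : (\int[P]_(w in EN n) `|(EFin \o (fun w => K ^+ N w)%R) w| =
    (expR (- r) * exp_coeff (K * r) n)%R%:E)%E.
  rewrite (eq_integral (cst (K ^+ n)%:E)); last first.
    by move=> w /set_mem /= ->; rewrite ger0_norm ?exprn_ge0.
  transitivity ((K ^+ n)%:E * P (EN n))%E; first by rewrite integral_cst.
  rewrite prob_count -EFinM; congr EFin.
  by rewrite /exp_coeff/= /r !exprMn; ring.
under eq_eseriesr do rewrite E.
apply: le_lt_trans (ltry (expR (- r) * expR (K * r))).
apply: lime_le.
  by apply: is_cvg_nneseries => n _ _; rewrite lee_fin mulr_ge0 ?expR_ge0// exp_coeff_ge0// mulr_ge0.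
near=> n; rewrite sumEFin lee_fin -mulr_sumr ler_wpM2l ?expR_ge0//.
rewrite /expR; apply: nondecreasing_cvgn_le; last exact: is_cvg_series_exp_coeff.
apply: nondecreasing_series => k _ _; rewrite exp_coeff_ge0// mulr_ge0.
Unshelve. all: by end_near. Qed.

Lemma integrable_dominated (G : Omega -> R) (M K : R) : measurable_fun setT G -> 0 <= K ->
  (forall w, `|G w| <= M * K ^+ N w) -> P.-integrable setT (EFin \o G).
Proof.
move=> mG K0 GM; have := integrableZl measurableT M (integrable_geom K0).
apply: le_integrable => //; first exact/measurable_EFinP.
by move=> w _ /=; rewrite lee_fin (le_trans (GM w))// ler_norm.
Qed.

(** The truncations of [G] to N(W) < k are dominated by |G|. Expectations become series over n,
    which can be compared term by term. *)
Lemma count_series (G : Omega -> R) : P.-integrable setT (EFin \o G) ->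
  (fun k => \sum_(n < k) \int[P]_(w in EN n) G w) @ \oo --> \int[P]_w G w.
Proof.
move=> iG; have mG : measurable_fun setT G by apply/measurable_EFinP; exact: measurable_int iG.
have iGn n : P.-integrable setT (EFin \o (G \_ (EN n))).
  have -> : EFin \o (G \_ (EN n)) = (EFin \o G) \_ (EN n) by rewrite restrict_EFin.
  by apply/(integrable_mkcond _ (mE n)); exact: integrableS iG.
pose Gk k w := \sum_(n < k) (G \_ (EN n)) w.
have mGk k : measurable_fun setT (Gk k).
  apply: measurable_sum => n; apply/(measurable_restrictT _ (mE n)).
  exact: measurable_funTS.
have GkE k w : Gk k w = if (N w < k)%N then G w else 0.
  rewrite /Gk; case: ltnP => Nk.
    rewrite (bigD1 (Ordinal Nk))//= patchT ?inE// big1 ?addr0// => n /eqP nN.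
    by rewrite patchC// inE /= => E; apply: nN; exact: val_inj.
  rewrite big1// => n _; rewrite patchC// inE /= => E.
  by have := ltn_ord n; rewrite -E ltnNge Nk.
have [|||||_ _ limG] := @dominated_convergence _ _ _ P setT measurableT
  (fun k w => (Gk k w)%:E) (EFin \o G) (abse \o (EFin \o G)).
- by move=> k; apply/measurable_EFinP.
- exact/measurable_EFinP.
- apply: aeW => w _; apply: cvg_near_cst; near=> k; rewrite GkE ifT//.
  by near: k; exact: nbhs_infty_gt.
- exact: integrable_abse.
- by apply: aeW => w k _; rewrite GkE lee_fin; case: ifP; rewrite ?normr0.
have finG := integrable_fin_num measurableT iG.
rewrite -(fineK finG) in limG.
rewrite (_ : (fun k => _) = fine \o (fun k => \int[P]_w (Gk k w)%:E)%E).
  exact: fine_cvg limG.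
apply/funext => k; apply/esym; rewrite /= /Gk; under eq_integral do rewrite -sumEFin.
rewrite integral_sum//; last by move=> n; exact: iGn.
rewrite -sum_fine; last by move=> n _; exact: (integrable_fin_num measurableT (iGn n)).
by apply: eq_bigr => n _; rewrite Rintegral_mkcond.
Unshelve. all: by end_near. Qed.
End count_calculus.

Section expectation_nabla.
Context (R : realType) (d : nat) (d_gt0 : (0 < d)%N) (W : set 'rV[R]_d) (hW : window W).
Context (disp : measure_display) (Omega : measurableType disp).
Variables (P : probability Omega R) (X : Omega -> set 'rV[R]_d) (theta : R).
Hypothesis X_Poisson : homogeneous_Poisson P X theta.
Hypothesis theta_ge0 : 0 <= theta.
Variable f : @forms R d.
Arguments f : clear implicits.
Hypothesis fD : DomD W f.
Local Notation vol A := (fine (leb_mx A)).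
Local Notation EN n := [set w | count_in X W w = n].
Local Notation N := (count_in X W).

(** The radial derivatives are again symmetric and continuous on W^n, so the Poisson formula applies
    to them, and nabla F is -1/d times their functional. *)
Definition radial_forms : @forms R d := fun n z => radial W (f n) z.
Arguments radial_forms : clear implicits.

Lemma DomD_sym n (s : 'S_n) z : window_pow W n z -> f n (row_perm s z) = f n z.
Proof. by move=> Wz; have [[fS _] _] := fD; have [sym _] := fS n; exact: sym. Qed.

Lemma DomD_C1 n : C1_window W (f n.+1).
Proof. by have [[_ [C _ fC]] _] := fD; have [] := fC n.+1 isT. Qed.

Lemma radial_forms_sym n (s : 'S_n) z : window_pow W n z ->
  radial_forms n (row_perm s z) = radial_forms n z.
Proof.
case: n s z => [|n] s z Wz; first by rewrite /radial_forms /radial !big_ord0.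
exact: (radial_perm hW (DomD_C1 n) (@DomD_sym n.+1)).
Qed.

Lemma radial_forms_cont n : {within window_pow W n, continuous (radial_forms n)}.
Proof.
case: n => [|n]; first exact: form0_continuous.
exact: (radial_continuous hW (DomD_C1 n)).
Qed.

Lemma functional_DomD_bound : exists2 K, 0 <= K & forall w,
  `|functional X W f w| <= K * K ^+ N w /\ `|functional X W radial_forms w| <= K * K ^+ N w.
Proof.
have [K K0 fK] := DomD_bound hW fD; exists K => // w.
by rewrite !functional_eval; apply: fK; exact: (count_in_list_mx hW X_Poisson).
Qed.

Lemma functional_DomD_measurable : measurable_fun setT (functional X W f).
Proof.
apply: (measurable_fun_count hW X_Poisson) => n.
apply: (functional_measurable hW X_Poisson DomD_sym) => m.
exact: (form_continuous fD).
Qed.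

Lemma functional_radial_measurable : measurable_fun setT (functional X W radial_forms).
Proof.
apply: (measurable_fun_count hW X_Poisson) => n.
exact: (functional_measurable hW X_Poisson radial_forms_sym radial_forms_cont).
Qed.

Lemma integrable_functional_DomD : P.-integrable setT (EFin \o functional X W f).
Proof.
have [K K0 fK] := functional_DomD_bound.
apply: (integrable_dominated hW X_Poisson theta_ge0 (M := K) (K := K)) => //.
- exact: functional_DomD_measurable.
- by move=> w; have [] := fK w.
Qed.

Lemma integrable_functional_radial : P.-integrable setT (EFin \o functional X W radial_forms).
Proof.
have [K K0 fK] := functional_DomD_bound.
apply: (integrable_dominated hW X_Poisson theta_ge0 (M := K) (K := K)) => //.
- exact: functional_radial_measurable.
- by move=> w; have [] := fK w.
Qed.

(** The factor N is at most 2^N, so the bound K^N becomes (2K)^N. *)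
Lemma integrable_functional_count :
  P.-integrable setT (EFin \o (fun w => functional X W f w * (N w)%:R)).
Proof.
have [K K0 fK] := functional_DomD_bound.
apply: (integrable_dominated hW X_Poisson theta_ge0 (M := K) (K := 2 * K)).
- apply: measurable_funM; first exact: functional_DomD_measurable.
  exact: (measurable_fun_countE hW X_Poisson (fun n => n%:R)).
- by rewrite mulr_ge0.
move=> w; have [fw _] := fK w.
rewrite normrM (ger0_norm (ler0n _ _)) exprMn [_ ^+ _ * _]mulrC mulrA ler_pM//.
by rewrite -natrX ler_nat ltnW// ltn_expl.
Qed.

Local Notation c n := (poisson_weight W theta n).
Local Notation I n := (\int[leb_mx]_(z in window_pow W n) f n z).

(** Turns the boundary term at level n + 1, which contains the integral of f_n, into theta times an
    expectation at level n. *)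
Lemma poisson_weightS n : n.+1%:R * c n.+1 = theta * c n.
Proof.
rewrite /poisson_weight exprS factS natrM; field.
by rewrite nat1r !pnatr_eq0 -!lt0n fact_gt0.
Qed.

Lemma Rintegral_functional_DomD n : \int[P]_(w in EN n) functional X W f w = c n * I n.
Proof.
apply: (functional_Rintegral hW X_Poisson theta_ge0 DomD_sym) => m.
exact: (form_continuous fD).
Qed.

Lemma Rintegral_functional_count n :
  \int[P]_(w in EN n) (functional X W f w * (N w)%:R) = n%:R * (c n * I n).
Proof.
rewrite -Rintegral_functional_DomD -RintegralZl//; last 2 first.
- exact: (count_event_measurable hW X_Poisson).
- apply: integrableS integrable_functional_DomD => //.
  exact: (count_event_measurable hW X_Poisson).
by apply: eq_Rintegral => w /set_mem /= ->; rewrite mulrC.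
Qed.

Lemma Rintegral_functional_radial0 : \int[P]_(w in EN 0) functional X W radial_forms w = 0.
Proof.
rewrite (functional_Rintegral hW X_Poisson theta_ge0 radial_forms_sym radial_forms_cont).
rewrite [X in _ * X](_ : _ = 0) ?mulr0//.
rewrite /Rintegral integral0_eq// => z _.
by rewrite /radial_forms /radial big_ord0.
Qed.

Lemma Rintegral_functional_radial n :
  - d%:R^-1 * \int[P]_(w in EN n.+1) functional X W radial_forms w =
  n.+1%:R * (c n.+1 * I n.+1) - theta * vol W * (c n * I n).
Proof.
rewrite (functional_Rintegral hW X_Poisson theta_ge0 radial_forms_sym radial_forms_cont).
have := Rintegral_radial hW n fD; rewrite addn1 => ->.
have d0 : d%:R != 0 :> R by rewrite pnatr_eq0 -lt0n.
set J := I n.+1; set J' := I n; set v := fine _.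
transitivity (n.+1%:R * c n.+1 * (J - v * J')); first by field.
transitivity (n.+1%:R * c n.+1 * J - v * J' * (n.+1%:R * c n.+1)); first by ring.
by rewrite [in X in _ - X]poisson_weightS; ring.
Qed.

(** Level n + 1 of nabla F matches level n + 1 of F N(W) and level n of theta |W| F. Hence the
    partial sums have k + 1 terms for the first two series and k for the third; the terms of level 0
    vanish in the first two. *)
Lemma Rintegral_duality :
  \int[P]_w (- d%:R^-1 * functional X W radial_forms w) =
  \int[P]_w (functional X W f w * ((N w)%:R - theta * vol W)).
Proof.
have iF := integrable_functional_DomD.
have iS := integrable_functional_radial.
have iN := integrable_functional_count.
rewrite RintegralZl//.
transitivity (\int[P]_w (functional X W f w * (N w)%:R) -
  \int[P]_w (theta * vol W * functional X W f w)); last first.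
  rewrite -RintegralB//; first by apply: eq_Rintegral => w _; ring.
  have := integrableZl measurableT (theta * vol W) iF.
  by apply: eq_integrable.
rewrite RintegralZl//.
have cS := count_series hW X_Poisson iS.
have cN := count_series hW X_Poisson iN.
have cF := count_series hW X_Poisson iF.
have c1 : (fun k => - d%:R^-1 * \sum_(n < k.+1) \int[P]_(w in EN n) functional X W radial_forms w)
    @ \oo --> - d%:R^-1 * \int[P]_w functional X W radial_forms w.
  by apply: cvgMr; rewrite (cvg_shiftS (fun k => \sum_(n < k) \int[P]_(w in EN n) functional X W radial_forms w)).
have c2 : (fun k => \sum_(n < k.+1) \int[P]_(w in EN n) (functional X W f w * (N w)%:R)
   - theta * vol W * \sum_(n < k) \int[P]_(w in EN n) functional X W f w) @ \oo -->
   \int[P]_w (functional X W f w * (N w)%:R) - theta * vol W * \int[P]_w functional X W f w.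
  apply: cvgB; last exact: cvgMr.
  by rewrite (cvg_shiftS (fun k => \sum_(n < k) \int[P]_(w in EN n) (functional X W f w * (N w)%:R))).
suff E k : - d%:R^-1 * \sum_(n < k.+1) \int[P]_(w in EN n) functional X W radial_forms w =
    \sum_(n < k.+1) \int[P]_(w in EN n) (functional X W f w * (N w)%:R)
    - theta * vol W * \sum_(n < k) \int[P]_(w in EN n) functional X W f w.
  by rewrite (funext E) in c1; exact: (cvg_unique _ c1 c2).
rewrite !big_ord_recl /= Rintegral_functional_radial0.
rewrite Rintegral_functional_count mul0r !add0r !mulr_sumr -sumrB.
apply: eq_bigr => n _.
by rewrite Rintegral_functional_radial Rintegral_functional_count Rintegral_functional_DomD.
Qed.
End expectation_nabla.
Arguments radial_forms {R d} W f n z : rename.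

(** * Orthonormal families and the closure of D *)

Section L2_convergence.
Context d (T : measurableType d) (R : realType) (mu : {measure set T -> \bar R}).
Local Open Scope ereal_scope.

(** The integral is a supremum over simple functions below the integrand, hence monotone. In this
    form it applies to the squared norm of D F_l - G at fixed w, whose measurability in w is not at
    hand. *)
Lemma integral_le_ge0 (f g : T -> \bar R) : (forall x, 0 <= f x) ->
  (forall x, f x <= g x) -> \int[mu]_x f x <= \int[mu]_x g x.
Proof.
move=> f0 fg; rewrite !ge0_integralTE// => [|x]; last exact: le_trans (fg x).
by apply: le_ereal_sup => _ [h hf <-]; exists h => // x; exact: le_trans (fg x).
Qed.

Lemma ge0_cvge0P (u : nat -> \bar R) : (forall l, 0 <= u l) ->
  (u @ \oo --> 0 <-> forall e : R, (0 < e)%R -> \forall l \near \oo, u l <= e%:E).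
Proof.
move=> u0; split => [/fine_cvgP[ufin /cvgrPdist_le uf] e e0|H].
  near=> l; have ul : u l \is a fin_num by near: l.
  rewrite -(fineK ul) lee_fin -[fine _]ger0_norm ?fine_ge0// -[leLHS]normrN -sub0r.
  by near: l; exact: uf.
apply/fine_cvgP; split.
  apply: filterS (H 1%R ltr01) => l ul; rewrite ge0_fin_numE//.
  exact: le_lt_trans ul (ltry _).
apply/cvgrPdist_le => e e0; apply: filterS (H e e0) => l ul.
have fl : u l \is a fin_num by rewrite ge0_fin_numE// (le_lt_trans ul)// ltry.
by rewrite sub0r normrN ger0_norm ?fine_ge0//= -lee_fin fineK.
Unshelve. all: by end_near. Qed.

Lemma Lnorm2E (f : T -> R) : 'N[mu]_2%:E[EFin \o f] = (\int[mu]_x (f x ^+ 2)%R%:E) `^ 2^-1%R.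
Proof.
rewrite unlock/=; congr poweR; apply: eq_integral => x _ /=.
by rewrite powR_mulrn// real_normK// num_real.
Qed.

Lemma Lnorm2_lty (f : T -> R) : \int[mu]_x (f x ^+ 2)%R%:E < +oo -> 'N[mu]_2%:E[EFin \o f] < +oo.
Proof. by move=> foo; rewrite Lnorm2E poweR_lty. Qed.

Lemma cvg_Lnorm2 (f : nat -> T -> R) (q : nat -> \bar R) :
  (forall l, \int[mu]_x (f l x ^+ 2)%R%:E <= q l) -> q @ \oo --> 0 ->
  'N[mu]_2%:E[EFin \o f l] @[l --> \oo] --> 0.
Proof.
move=> fq q0.
have I0 l : 0 <= \int[mu]_x (f l x ^+ 2)%R%:E.
  by apply: integral_ge0 => x _; rewrite lee_fin sqr_ge0.
have qge0 l : 0 <= q l by exact: le_trans (fq l).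
apply/ge0_cvge0P => [l|e e0]; first exact: Lnorm_ge0.
have e2 : (0 < e ^+ 2)%R by rewrite exprn_gt0.
apply: filterS ((ge0_cvge0P qge0).1 q0 _ e2) => l qle; rewrite Lnorm2E.
have -> : e%:E = (e ^+ 2)%:E `^ 2^-1%R.
  by rewrite poweR_EFin powR12_sqrt ?sqrtr_sqr ?ger0_norm// ltW.
apply: gt0_ler_poweR; rewrite ?in_itv/= ?leey ?I0 ?lee_fin ?sqr_ge0 ?invr_ge0//.
exact: le_trans (fq l) qle.
Qed.

(** Hoelder with exponents 2 and 2: the pairing with a fixed [g] of L^2 is continuous. It is used
    with g = N(W) - theta |W| and with g = 1. *)
Lemma cvg_Lnorm2_pairing (f : nat -> T -> R) (h g : T -> R) :
  (forall l, measurable_fun setT (f l)) -> measurable_fun setT h -> measurable_fun setT g ->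
  (forall l, 'N[mu]_2%:E[EFin \o f l] < +oo) -> 'N[mu]_2%:E[EFin \o h] < +oo ->
  'N[mu]_2%:E[EFin \o g] < +oo ->
  'N[mu]_2%:E[EFin \o (f l \- h)%R] @[l --> \oo] --> 0 ->
  mu.-integrable setT (EFin \o (h \* g)%R) /\
  (\int[mu]_x (f l x * g x))%R @[l --> \oo] --> (\int[mu]_x (h x * g x))%R.
Proof.
move=> mf mh mg foo hoo goo fh.
have int (u : T -> R) : measurable_fun setT u -> 'N[mu]_2%:E[EFin \o u] < +oo ->
    mu.-integrable setT (EFin \o (u \* g)%R).
  move=> mu_ uoo; apply/integrableP; split; first exact/measurable_EFinP/measurable_funM.
  rewrite -Lnorm1; apply: le_lt_trans (hoelder mu (p := 2%R) (q := 2%R) mu_ mg _ _ _) _ => //.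
    by rewrite [RHS]splitr !mul1r.
  by rewrite lte_mul_pinfty ?Lnorm_ge0// ge0_fin_numE ?Lnorm_ge0.
split; first exact: int.
have h1 l : `|(\int[mu]_x (f l x * g x) - \int[mu]_x (h x * g x))%R|%:E <=
    'N[mu]_2%:E[EFin \o (f l \- h)%R] * 'N[mu]_2%:E[EFin \o g].
  have i1 := int _ (mf l) (foo l); have i2 := int _ mh hoo.
  have mfh : measurable_fun setT (f l \- h)%R by exact: measurable_funB.
  apply: le_trans (hoelder mu (p := 2%R) (q := 2%R) mfh mg _ _ _) => //; last by rewrite [RHS]splitr !mul1r.
  rewrite Lnorm1 -RintegralB//.
  have i3 : mu.-integrable setT (EFin \o (fun x => f l x * g x - h x * g x)%R).
    by have := integrableB measurableT i1 i2; apply: eq_integrable.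
  apply: le_trans (_ : (\int[mu]_x `|f l x * g x - h x * g x|)%R%:E <= _).
    by rewrite lee_fin; exact: le_normr_Rintegral.
  rewrite /Rintegral fineK; last first.
    by apply: integrable_fin_num => //; exact: integrable_norm.
  by rewrite le_eqVlt; apply/orP; left; apply/eqP/eq_integral => x _ /=; rewrite mulrBl.
have h2 : 'N[mu]_2%:E[EFin \o (f l \- h)%R] * 'N[mu]_2%:E[EFin \o g] @[l --> \oo] --> 0.
  rewrite -(mul0e 'N[mu]_2%:E[EFin \o g]); apply: cvgeM => //; last exact: cvg_cst.
  by rewrite mule_def_fin// ge0_fin_numE ?Lnorm_ge0.
apply/cvgrPdist_le => e e0.
have h0 l : 0 <= 'N[mu]_2%:E[EFin \o (f l \- h)%R] * 'N[mu]_2%:E[EFin \o g].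
  by rewrite mule_ge0 ?Lnorm_ge0.
apply: filterS ((ge0_cvge0P h0).1 h2 e e0) => l; rewrite distrC -lee_fin.
exact: le_trans.
Qed.
End L2_convergence.

Section integral_lemmas.
Context dT (T : measurableType dT) (R : realType) (mu : {measure set T -> \bar R}).
Variable D : set T.
Hypothesis mD : measurable D.

Lemma integrable_lincomb (I : finType) (a : I -> R) (u : I -> T -> R) :
  (forall i, mu.-integrable D (EFin \o u i)) ->
  mu.-integrable D (EFin \o (fun x => \sum_i a i * u i x)).
Proof.
move=> iu; have iau i : mu.-integrable D (fun x => (a i * u i x)%:E).
  by have := integrableZl mD (a i) (iu i); apply: eq_integrable.
have : mu.-integrable D (fun x => (\sum_(i <- index_enum I) (a i * u i x)%:E)%E).
  exact: integrable_sum.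
by apply: eq_integrable => // x _; rewrite /= sumEFin.
Qed.

Lemma Rintegral_lincomb (I : finType) (a : I -> R) (u : I -> T -> R) :
  (forall i, mu.-integrable D (EFin \o u i)) ->
  \int[mu]_(x in D) (\sum_i a i * u i x) = \sum_i a i * \int[mu]_(x in D) u i x.
Proof.
move=> iu; have iau i : mu.-integrable D (fun x => (a i * u i x)%:E).
  by have := integrableZl mD (a i) (iu i); apply: eq_integrable.
rewrite /Rintegral; under eq_integral do rewrite -sumEFin.
rewrite integral_sum// -sum_fine; last by move=> i _; exact: (integrable_fin_num mD (iau i)).
by apply: eq_bigr => i _; rewrite -RintegralZl.
Qed.

Lemma integrable_mul_L2 (u1 u2 : T -> R) : measurable_fun D u1 -> measurable_fun D u2 ->
  (\int[mu]_(x in D) (u1 x ^+ 2)%:E < +oo)%E -> (\int[mu]_(x in D) (u2 x ^+ 2)%:E < +oo)%E ->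
  mu.-integrable D (EFin \o (fun x => u1 x * u2 x)).
Proof.
move=> m1 m2 i1 i2.
have sq (u : T -> R) : measurable_fun D u -> (\int[mu]_(x in D) (u x ^+ 2)%:E < +oo)%E ->
    mu.-integrable D (EFin \o (fun x => u x ^+ 2)).
  move=> mu_ iu; apply/integrableP; split; first exact/measurable_EFinP/measurable_funX.
  by under eq_integral do rewrite /= ger0_norm ?sqr_ge0//.
have := integrableD mD (sq _ m1 i1) (sq _ m2 i2); apply: le_integrable => //.
  exact/measurable_EFinP/measurable_funM.
move=> x _ /=; rewrite lee_fin normrM [leRHS]ger0_norm ?addr_ge0 ?sqr_ge0//.
rewrite -(real_normK (num_real (u1 x))) -(real_normK (num_real (u2 x))).
have := sqr_ge0 (`|u1 x| - `|u2 x|); have := normr_ge0 (u1 x); have := normr_ge0 (u2 x).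
by move: `|u1 x| `|u2 x| => p q q0 p0; nra.
Qed.
End integral_lemmas.

(** * Integrals against the orthonormal family *)

Section orthonormal_integrals.
Context (R : realType) (d : nat) (d_gt0 : (0 < d)%N) (W : set 'rV[R]_d) (hW : window W).
Variable v : 'I_d -> 'rV[R]_d -> R.
Hypothesis v_bounded_L2 : forall m, bounded_L2 W (v m).
Hypothesis v_orthonormal : orthonormal_L2 W v.
Let V := stack v.
Let pi (y x : 'rV[R]_d) := dotv y (V x).

Lemma stack_measurable k : measurable_fun W (fun x => V x 0 k).
Proof.
have [mv _ _] := v_bounded_L2 k.
apply: (eq_measurable_fun (fun x => (Num.sqrt d%:R)^-1 * v k x)).
  by move=> x _; rewrite /V /stack mxE.
exact: measurable_funM.
Qed.

Lemma sqrt_natV2 : (Num.sqrt (d%:R : R))^-1 * (Num.sqrt d%:R)^-1 = d%:R^-1.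
Proof. by rewrite -invfM -expr2 sqr_sqrtr. Qed.

Lemma stackM x k l : V x 0 k * V x 0 l = d%:R^-1 * (v k x * v l x).
Proof. by rewrite /V /stack !mxE mulrACA sqrt_natV2. Qed.

Lemma stack_integrable k l : leb_mx.-integrable W (EFin \o (fun x => V x 0 k * V x 0 l)).
Proof.
have mW := window_measurable hW.
have [mk ik _] := v_bounded_L2 k; have [ml il _] := v_bounded_L2 l.
have := integrableZl mW d%:R^-1 (integrable_mul_L2 mW mk ml ik il).
by apply: eq_integrable => // x _; rewrite /= stackM.
Qed.

Lemma Rintegral_stack k l : \int[leb_mx]_(x in W) (V x 0 k * V x 0 l) = d%:R^-1 * (k == l)%:R.
Proof.
have mW := window_measurable hW.
have [mk ik _] := v_bounded_L2 k; have [ml il _] := v_bounded_L2 l.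
under eq_Rintegral do rewrite stackM.
by rewrite RintegralZl ?v_orthonormal//; exact: integrable_mul_L2.
Qed.


Lemma stack_quadratic_integrable (M : 'M[R]_d) :
  leb_mx.-integrable W (EFin \o (fun x => \sum_k \sum_l M k l * (V x 0 k * V x 0 l))).
Proof.
have := integrable_lincomb (window_measurable hW) (fun p : 'I_d * 'I_d => M p.1 p.2)
  (fun p => stack_integrable p.1 p.2).
by apply: eq_integrable => [|x _]; [exact: window_measurable|rewrite /= pair_bigA].
Qed.

(** Orthonormality keeps only the diagonal. The vector field and nabla are both integrals of
    quadratic forms in V, so each is obtained by computing a trace. *)
Lemma Rintegral_stack_quadratic (M : 'M[R]_d) :
  \int[leb_mx]_(x in W) (\sum_k \sum_l M k l * (V x 0 k * V x 0 l)) = d%:R^-1 * \tr M.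
Proof.
under eq_Rintegral do rewrite pair_bigA/=.
rewrite (Rintegral_lincomb (window_measurable hW) (fun p : 'I_d * 'I_d => M p.1 p.2)
  (fun p => stack_integrable p.1 p.2)).
rewrite -(pair_bigA _ (fun k l => M k l * \int[leb_mx]_(x in W) (V x 0 k * V x 0 l)))/=.
rewrite /mxtrace mulr_sumr; apply: eq_bigr => k _; rewrite (bigD1 k)//= big1 ?addr0.
  by rewrite Rintegral_stack eqxx mulr1 mulrC.
by move=> l /negbTE lk; rewrite Rintegral_stack eq_sym lk !mulr0.
Qed.

Lemma vfieldE y : vfield W pi V y = d%:R^-1 *: y.
Proof.
apply/rowP => k; rewrite !mxE.
(* With this matrix the quadratic form is the k-th coordinate of V times the scalar product of [y]
   and V. *)
have <- : \tr (\matrix_(j, l) (y 0 j * (l == k)%:R)) = y 0 k.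
  rewrite /mxtrace (bigD1 k)//= mxE eqxx mulr1 big1 ?addr0// => j /negbTE jk.
  by rewrite mxE jk mulr0.
rewrite -Rintegral_stack_quadratic; apply: eq_Rintegral => x _.
rewrite /pi /dotv mulr_sumr; apply: eq_bigr => j _; rewrite (bigD1 k)//= mxE eqxx big1 ?addr0.
  by rewrite mulr1; ring.
by move=> l /negbTE lk; rewrite mxE lk mulr0 mul0r.
Qed.

Lemma divergence_vfield y : divergence (vfield W pi V) y = 1.
Proof.
rewrite /divergence (eq_bigr (fun=> d%:R^-1)); last first.
  move=> k _; rewrite (_ : (fun z => _) = (fun z : 'rV[R]_d => d%:R^-1 * z 0 k)).
    rewrite /derive; apply: cvg_lim => //; apply: cvg_near_cst; near=> h.
    have h0 : h != 0 by near: h; exact: nbhs_dnbhs_neq.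
    by rewrite /= !mxE !eqxx /= -mulrBr addrK mulr1 /GRing.scale/= mulrC mulfK.
  by apply/funext => z; rewrite vfieldE mxE.
by rewrite sumr_const card_ord -[LHS]mulr_natl divff// pnatr_eq0 -lt0n.
Unshelve. all: by end_near. Qed.

Section nabla.
Context (disp : measure_display) (Omega : measurableType disp).
Variables (P : probability Omega R) (X : Omega -> set 'rV[R]_d).
Variable f : @forms R d.
Arguments f : clear implicits.

(** Minus the sum of the outer products of X_i and the i-th gradient: D_x F is linear in V(x), with
    this matrix. *)
Let M w : 'M[R]_d := \matrix_(k, l) - \sum_(i < count_in X W w)
  points_in X W w i k * grad W (f (count_in X W w)) i (points_in X W w) 0 l.

Lemma opDE w x l : opD X W pi f w x 0 l = \sum_k M w k l * V x 0 k.
Proof.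
rewrite /opD !mxE summxE -sumrN; under [RHS]eq_bigr do rewrite mxE mulNr mulr_suml -sumrN.
rewrite exchange_big/=; apply: eq_bigr => i _; rewrite mxE /pi /dotv mulr_suml -sumrN.
by apply: eq_bigr => k _; rewrite mxE; ring.
Qed.

Lemma dotv_opD w x : dotv (opD X W pi f w x) (V x) =
  \sum_k \sum_l M w k l * (V x 0 k * V x 0 l).
Proof.
rewrite /dotv; under eq_bigr do rewrite opDE mulr_suml.
by rewrite exchange_big/=; apply: eq_bigr => k _; apply: eq_bigr => l _; rewrite mulrA.
Qed.

Lemma dotv_opD_integrable w :
  leb_mx.-integrable W (EFin \o (fun x => dotv (opD X W pi f w x) (V x))).
Proof.
have := stack_quadratic_integrable (M w).
by apply: eq_integrable => [|x _]; [exact: window_measurable|rewrite /= dotv_opD].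
Qed.

Lemma nablaE w : nabla X W pi V f w = - d%:R^-1 * \sum_(i < count_in X W w)
  dotv (grad W (f (count_in X W w)) i (points_in X W w)) (row i (points_in X W w)).
Proof.
rewrite /nabla; under eq_Rintegral do rewrite dotv_opD.
rewrite Rintegral_stack_quadratic mulNr -mulrN; congr (_ * _).
rewrite /mxtrace; under eq_bigr do rewrite mxE; rewrite sumrN; congr (- _).
rewrite exchange_big/=; apply: eq_bigr => i _; apply: eq_bigr => k _.
by rewrite [row _ _ _ _]mxE mulrC.
Qed.
End nabla.
End orthonormal_integrals.

(** * Extension of nabla to the closure of D *)

Section closure.
Context (R : realType) (d : nat) (d_gt0 : (0 < d)%N) (W : set 'rV[R]_d) (hW : window W).
Variable v : 'I_d -> 'rV[R]_d -> R.
Hypothesis v_bounded_L2 : forall m, bounded_L2 W (v m).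
Hypothesis v_orthonormal : orthonormal_L2 W v.
Let V := stack v.
Let pi (y x : 'rV[R]_d) := dotv y (V x).
Let mW := window_measurable hW.
Let mV k : measurable_fun W (fun x => V x 0 k).
Proof. exact: (stack_measurable v_bounded_L2). Qed.

Lemma dotvv_ge0 (u : 'rV[R]_d) : 0 <= dotv u u.
Proof. by apply: sumr_ge0 => k _; rewrite -expr2 sqr_ge0. Qed.

Lemma sqr_enorm (u : 'rV[R]_d) : enorm u ^+ 2 = dotv u u.
Proof. by rewrite sqr_sqrtr// dotvv_ge0. Qed.

Lemma measurable_dotv dT (T : measurableType dT) (D : set T) (u1 u2 : T -> 'rV[R]_d) :
  (forall k, measurable_fun D (fun x => u1 x 0 k)) ->
  (forall k, measurable_fun D (fun x => u2 x 0 k)) ->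
  measurable_fun D (fun x => dotv (u1 x) (u2 x)).
Proof. by move=> m1 m2; apply: measurable_sum => k; exact: measurable_funM. Qed.

Section cauchy_schwarz.
Variable u : 'rV[R]_d -> 'rV[R]_d.
Hypothesis mu : forall k, measurable_fun W (fun x => u x 0 k).
Hypothesis uoo : (\int[leb_mx]_(x in W) (enorm (u x) ^+ 2)%:E < +oo)%E.

Let iu : leb_mx.-integrable W (EFin \o (fun x => dotv (u x) (u x))).
Proof.
apply/integrableP; split; first exact/measurable_EFinP/measurable_dotv.
under eq_integral do rewrite /= ger0_norm ?dotvv_ge0// -sqr_enorm.
exact: uoo.
Qed.

Lemma dotv_stack_integrable : leb_mx.-integrable W (EFin \o (fun x => dotv (u x) (V x))).
Proof.
have iuV k : leb_mx.-integrable W (EFin \o (fun x => u x 0 k * V x 0 k)).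
  apply: integrable_mul_L2 => //; last first.
    have /integrableP[_] := stack_integrable hW v_bounded_L2 k k.
    apply: le_lt_trans; rewrite le_eqVlt; apply/predU1P; left; apply: eq_integral => x _.
    by rewrite /= -expr2 ger0_norm ?sqr_ge0.
  apply: le_lt_trans uoo; apply: ge0_le_integral => //.
  - by move=> x _; rewrite lee_fin sqr_ge0.
  - exact/measurable_EFinP/measurable_funX.
  - apply/measurable_EFinP; under eq_fun do rewrite sqr_enorm; exact: measurable_dotv.
  - move=> x _; rewrite lee_fin sqr_enorm /dotv (bigD1 k)//= expr2 lerDl.
    by apply: sumr_ge0 => i _; rewrite -expr2 sqr_ge0.
have := integrable_lincomb mW (fun=> 1) iuV.
by apply: eq_integrable => // x _; rewrite /= /dotv; congr EFin; apply: eq_bigr => k _; rewrite mul1r.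
Qed.

(* [V] is a unit vector of L^2(W, R^d): expand the squared norm of [u - <u, V> V]. *)
Lemma cauchy_schwarz_stack : (\int[leb_mx]_(x in W) dotv (u x) (V x)) ^+ 2 <=
  \int[leb_mx]_(x in W) dotv (u x) (u x).
Proof.
have iuV := dotv_stack_integrable.
set b := \int[leb_mx]_(x in W) dotv (u x) (V x).
have iVV : leb_mx.-integrable W (EFin \o (fun x => dotv (V x) (V x))).
  have := integrable_lincomb mW (fun=> 1) (fun k => stack_integrable hW v_bounded_L2 k k).
  by apply: eq_integrable => // x _; rewrite /= /dotv; congr EFin; apply: eq_bigr => k _; rewrite mul1r.
have VV1 : \int[leb_mx]_(x in W) dotv (V x) (V x) = 1.
  under eq_Rintegral do [rewrite /dotv; under eq_bigr do rewrite -[_ * _]mul1r].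
  rewrite (Rintegral_lincomb mW (fun=> 1) (fun k => stack_integrable hW v_bounded_L2 k k)).
  under eq_bigr do rewrite Rintegral_stack// eqxx mul1r mulr1.
  by rewrite sumr_const card_ord -[LHS]mulr_natl divff// pnatr_eq0 -lt0n.
pose phi (i : 'I_3) x := [:: dotv (u x) (u x); dotv (u x) (V x); dotv (V x) (V x)]`_i.
have iphi i : leb_mx.-integrable W (EFin \o phi i).
  by case: i => -[|[|[]]].
have : 0 <= \int[leb_mx]_(x in W) (\sum_(i < 3) [:: 1; - (2 * b); b ^+ 2]`_i * phi i x).
  apply: Rintegral_ge0 => x _; rewrite !big_ord_recl big_ord0 /= addr0 mul1r.
  rewrite (_ : _ + _ = dotv (u x - b *: V x) (u x - b *: V x)) ?dotvv_ge0//.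
  rewrite /phi/= /dotv !mulr_sumr -!big_split/=; apply: eq_bigr => k _.
  by rewrite !mxE; ring.
rewrite Rintegral_lincomb// !big_ord_recl big_ord0 /phi/= addr0 VV1 -/b.
by set a := \int[_]_(_ in _) _; nra.
Qed.
End cauchy_schwarz.

Lemma cauchy_schwarz_stacke (u : 'rV[R]_d -> 'rV[R]_d) :
  (forall k, measurable_fun W (fun x => u x 0 k)) ->
  (((\int[leb_mx]_(x in W) dotv (u x) (V x)) ^+ 2)%:E <=
   \int[leb_mx]_(x in W) (enorm (u x) ^+ 2)%:E)%E.
Proof.
move=> mu; case: (ltP (\int[leb_mx]_(x in W) (enorm (u x) ^+ 2)%:E)%E +oo%E) => [uoo|]; last first.
  by apply: le_trans; rewrite leey.
apply: le_trans (_ : (\int[leb_mx]_(x in W) dotv (u x) (u x))%:E <= _)%E.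
  by rewrite lee_fin; exact: cauchy_schwarz_stack.
rewrite /Rintegral; under [leRHS]eq_integral do rewrite sqr_enorm.
rewrite fineK// ge0_fin_numE; last by apply: integral_ge0 => x _; rewrite lee_fin dotvv_ge0.
by under eq_integral do rewrite -sqr_enorm.
Qed.

Context (disp : measure_display) (Omega : measurableType disp).
Variables (P : probability Omega R) (X : Omega -> set 'rV[R]_d) (theta : R).
Hypothesis X_Poisson : homogeneous_Poisson P X theta.
Hypothesis theta_ge0 : 0 <= theta.
Local Notation vol A := (fine (leb_mx A)).
Local Notation N := (count_in X W).

Lemma OmegaW_measurable (F : Omega -> R) :
  measurable_fun [set: OmegaW X W] (F : OmegaW X W -> R) -> measurable_fun [set: Omega] F.
Proof.
move=> mF _ B mB; have : (FW_generators X W).-sigma.-measurable (setT `&` F @^-1` B) by exact: mF.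
apply: smallest_sub; first exact: sigma_algebra_measurable.
move=> _ [A [k [mA AW ->]]]; have [_ mX _ _] := X_Poisson.
apply: mX => //; case: (window_bounded hW) => M [Mr WM]; exists M; split => // y My z /AW.
exact: WM.
Qed.

(** The candidate for nabla F when D F_l tends to [G]: nabla depends on F only through D F. *)
Definition nabla_lim (G : Omega -> 'rV[R]_d -> 'rV[R]_d) (w : Omega) : R :=
  \int[leb_mx]_(x in W) dotv (G w x) (V x).

Section nabla_lim.
Variable G : Omega -> 'rV[R]_d -> 'rV[R]_d.
Hypothesis GL2 : L2_OmegaW P X W G.

Lemma section_measurable w k : measurable_fun W (fun x => G w x 0 k).
Proof.
have [mG _] := GL2.
have mTW : measurable ([set: OmegaW X W] `*` W) by exact: measurableX.
apply: (@measurable_comp _ _ _ _ _ _ _ (fun p : OmegaW X W * 'rV[R]_d => G p.1 p.2 0 k) W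
  (pair (w : OmegaW X W)) mTW _ (mG k)).
- by move=> _ [x Wx <-].
- by apply: measurable_funTS; exact: pair1_measurable.
Qed.

(** For an exceptional w the section of [G] need not be integrable against V, so Tonelli is applied
    to the positive and negative parts, and [fine] of their difference is measurable in all
    cases. *)
Lemma nabla_lim_measurable : measurable_fun [set: OmegaW X W] (nabla_lim G : OmegaW X W -> R).
Proof.
have [mG _] := GL2.
have mTW : measurable ([set: OmegaW X W] `*` W) by exact: measurableX.
pose h : OmegaW X W * 'rV[R]_d -> \bar R :=
  (fun p => (dotv (G p.1 p.2) (V p.2))%:E) \_ ([set: OmegaW X W] `*` W).
have mh : measurable_fun setT h.
  apply/(measurable_restrictT _ mTW)/measurable_EFinP/measurable_dotv => // k.
  apply: (@measurable_comp _ _ _ _ _ _ W (fun x => V x 0 k) ([set: OmegaW X W] `*` W) snd) => //.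
    by move=> _ [p [_ Wp] <-].
  exact: measurable_funTS measurable_snd.
have mp := @measurable_fun_fubini_tonelli_F _ _ _ _ R (@leb_mx R 1 d) h^\+%E
  (measurable_funepos mh) (fun=> funepos_ge0 _ _).
have mn := @measurable_fun_fubini_tonelli_F _ _ _ _ R (@leb_mx R 1 d) h^\-%E
  (measurable_funeneg mh) (fun=> funeneg_ge0 _ _).
have := measurableT_comp (@fine_measurable R setT measurableT) (emeasurable_funB mp mn).
apply: eq_measurable_fun => w _; rewrite /= /nabla_lim /Rintegral; congr fine.
rewrite integral_mkcond integralE; congr (_ - _)%E; apply: eq_integral => x _.
  by rewrite !funeposE /h !patchE /=; congr maxe; rewrite in_setX in_setT.
by rewrite !funenegE /h !patchE /=; congr (maxe (- _) _)%E; rewrite in_setX in_setT.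
Qed.

Lemma nabla_lim_sqr_le w :
  ((nabla_lim G w ^+ 2)%:E <= \int[leb_mx]_(x in W) (enorm (G w x) ^+ 2)%:E)%E.
Proof. by apply: cauchy_schwarz_stacke => k; exact: section_measurable. Qed.

Lemma nabla_lim_L2 : L2_Omega P X W (nabla_lim G).
Proof.
split; first exact: nabla_lim_measurable.
apply: Lnorm2_lty; have [_ Goo] := GL2; apply: le_lt_trans Goo.
by apply: integral_le_ge0 => w; [rewrite lee_fin sqr_ge0|exact: nabla_lim_sqr_le].
Qed.

(** Cauchy-Schwarz for D F - G at fixed w. When the right-hand side is finite, the integrability of
    the scalar product of [G] and V, needed to subtract the integrals, follows from that of D F and
    of the difference. *)
Lemma nabla_dist_le (f : @forms R d) w :
  (((nabla X W pi V f w - nabla_lim G w) ^+ 2)%:E <=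
   \int[leb_mx]_(x in W) (enorm (opD X W pi f w x - G w x) ^+ 2)%:E)%E.
Proof.
have mD k : measurable_fun W (fun x => opD X W pi f w x 0 k).
  under eq_fun do rewrite opDE.
  by apply: measurable_sum => l; exact: measurable_funM.
pose u x := opD X W pi f w x - G w x.
have mu k : measurable_fun W (fun x => u x 0 k).
  apply: (eq_measurable_fun (fun x => opD X W pi f w x 0 k - G w x 0 k)).
    by move=> x _; rewrite /u !mxE.
  by apply: measurable_funB; [exact: mD|exact: section_measurable].
case: (ltP (\int[leb_mx]_(x in W) (enorm (u x) ^+ 2)%:E)%E +oo%E) => [uoo|]; last first.
  by apply: le_trans; rewrite leey.
have iD := dotv_opD_integrable hW v_bounded_L2 X f w.
have iu := dotv_stack_integrable mu uoo.
have iG : leb_mx.-integrable W (EFin \o (fun x => dotv (G w x) (V x))).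
  have := integrableB mW iD iu; apply: eq_integrable => // x _ /=.
  rewrite -EFinB; congr EFin; rewrite /dotv -sumrB; apply: eq_bigr => k _.
  by rewrite /u !mxE; ring.
rewrite /nabla /nabla_lim -RintegralB//.
rewrite (_ : \int[leb_mx]_(x in W) _ = \int[leb_mx]_(x in W) dotv (u x) (V x)); last first.
  apply: eq_Rintegral => x _; rewrite /dotv -sumrB; apply: eq_bigr => k _.
  by rewrite /u !mxE; ring.
exact: cauchy_schwarz_stacke.
Qed.
End nabla_lim.

Lemma is_nabla_lim (F : Omega -> R) : DomDbar P X W pi F ->
  exists H, is_nabla P X W pi V F H.
Proof.
move=> [fl appr]; have [_ _ _ [G GL2 cvgG]] := appr.
exists (nabla_lim G), fl; split => //; first exact: nabla_lim_L2.
apply: cvg_Lnorm2 cvgG => l; apply: integral_le_ge0 => w; first by rewrite lee_fin sqr_ge0.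
exact: nabla_dist_le.
Qed.

Lemma nabla_functional (f : @forms R d) w :
  nabla X W pi V f w = - d%:R^-1 * functional X W (radial_forms W f) w.
Proof. exact: nablaE. Qed.

Lemma nabla_measurable (f : @forms R d) : DomD W f -> measurable_fun setT (nabla X W pi V f).
Proof.
move=> fD; apply: (eq_measurable_fun (fun w => - d%:R^-1 * functional X W (radial_forms W f) w)).
  by move=> w _; rewrite nabla_functional.
by apply: measurable_funM => //; exact: (functional_radial_measurable hW X_Poisson fD).
Qed.

Lemma count_dominated_L2 (u : Omega -> R) (c K : R) : measurable_fun setT u -> 0 <= K ->
  (forall w, `|u w| <= c * K ^+ N w) -> ('N[P]_2%:E[EFin \o u] < +oo)%E.
Proof.
move=> mu K0 uK; apply: Lnorm2_lty.
have : P.-integrable setT (EFin \o (fun w => u w ^+ 2)).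
  apply: (integrable_dominated hW X_Poisson theta_ge0 (M := c ^+ 2) (K := K ^+ 2)).
  - exact: measurable_funX.
  - exact: sqr_ge0.
  - move=> w; rewrite normrX -exprM mulnC exprM -exprMn lerXn2r ?nnegrE//.
    exact: le_trans (uK w).
move=> /integrableP[_]; apply: le_lt_trans; rewrite le_eqVlt; apply/predU1P; left.
by apply: eq_integral => w _; rewrite /= ger0_norm ?sqr_ge0.
Qed.

Lemma L2_functional (f : @forms R d) : DomD W f ->
  ('N[P]_2%:E[EFin \o functional X W f] < +oo)%E /\
  ('N[P]_2%:E[EFin \o nabla X W pi V f] < +oo)%E.
Proof.
move=> fD; have [K K0 fK] := functional_DomD_bound hW X_Poisson fD.
split.
  apply: (count_dominated_L2 (c := K) (K := K)) => //; first exact: (functional_DomD_measurable hW X_Poisson fD).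
  by move=> w; have [] := fK w.
apply: (count_dominated_L2 (c := d%:R^-1 * K) (K := K)) => //.
  exact: nabla_measurable.
have d0 : 0 <= d%:R^-1 :> R by rewrite invr_ge0.
move=> w; have [_ fw] := fK w; rewrite nabla_functional mulNr normrN normrM (ger0_norm d0).
by rewrite -mulrA; exact: ler_wpM2l.
Qed.

(** Along the sequence that defines [H], the expectations of nabla F_l are pairings with the
    constant 1 and converge to that of [H]; the duality on Dom(D) identifies them with pairings of
    F_l with N(W) - theta |W|, which converge too. *)
Lemma expectation_is_nabla (F H : Omega -> R) : is_nabla P X W pi V F H ->
  ('E_P[H] = 'E_P[(fun w => F w * ((N w)%:R - theta * vol W))%R])%E.
Proof.
move=> [fl [[FL2 flD cvgF _] [mH Hoo] cvgH]].
have [/OmegaW_measurable mF Foo] := FL2; have {}mH := OmegaW_measurable mH.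
have mf l := functional_DomD_measurable hW X_Poisson (flD l).
have mn l := nabla_measurable (flD l).
pose g w := (N w)%:R - theta * vol W.
have mg : measurable_fun setT g.
  exact: (measurable_fun_countE hW X_Poisson (fun n => n%:R - theta * vol W)).
have goo : ('N[P]_2%:E[EFin \o g] < +oo)%E.
  (* The constants come from N <= 2^N and 1 <= 2^N. *)
  apply: (count_dominated_L2 (c := 1 + `|theta * vol W|) (K := 2)) => // w.
  rewrite (le_trans (ler_normB _ _))// mulrDl mul1r lerD ?ler_peMr ?exprn_ege1//.
    by rewrite ger0_norm// -natrX ler_nat ltnW// ltn_expl.
  by rewrite ler1n.
have one_oo : ('N[P]_2%:E[EFin \o cst 1%R] < +oo)%E.
  by apply: (count_dominated_L2 (c := 1) (K := 1)) => // w; rewrite normr1 expr1n mulr1.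
have [iF cF] := cvg_Lnorm2_pairing mf mF mg (fun l => (L2_functional (flD l)).1) Foo goo cvgF.
have m1 : measurable_fun setT (cst 1 : Omega -> R) by exact: measurable_cst.
have [iH cH] := cvg_Lnorm2_pairing mn mH m1
  (fun l => (L2_functional (flD l)).2) Hoo one_oo cvgH.
have E l : \int[P]_w (nabla X W pi V (fl l) w * cst 1 w) = \int[P]_w (functional X W (fl l) w * g w).
  rewrite -(Rintegral_duality d_gt0 hW X_Poisson theta_ge0 (flD l)).
  by apply: eq_Rintegral => w _; rewrite mulr1 nabla_functional.
have HF : \int[P]_w (H w * cst 1 w) = \int[P]_w (F w * g w).
  by rewrite (funext E) in cH; exact: (cvg_unique _ cH cF).
have := congr1 EFin HF; rewrite /Rintegral !fineK; last 2 first.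
- exact: (integrable_fin_num measurableT iF).
- exact: (integrable_fin_num measurableT iH).
by rewrite unlock => <-; apply: eq_integral => w _; rewrite /= mulr1.
Qed.
End closure.

Theorem proposition3p5 (R : realType) (d : nat) (d_gt0 : (0 < d)%N)
    (W : set 'rV[R]_d) (W_window : window W)
    (disp : measure_display) (Omega : measurableType disp)
    (P : probability Omega R)
    (X : Omega -> set 'rV[R]_d) (theta : R) (theta_gt0 : 0 < theta)
    (X_Poisson : homogeneous_Poisson P X theta)
    (v : 'I_d -> 'rV[R]_d -> R)
    (v_bounded_L2 : forall m, bounded_L2 W (v m))
    (v_orthonormal : orthonormal_L2 W v) :
  let V := stack v in
  let pi := fun y x : 'rV[R]_d => dotv y (V x) in
  [/\ forall y, vfield W pi V y = d%:R^-1 *: y,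
      forall y, divergence (vfield W pi V) y = 1,
      forall f : forms, DomD W f -> forall w,
        nabla X W pi V f w =
          - d%:R^-1 * \sum_(i < count_in X W w)
              dotv (grad W (f (count_in X W w)) i (points_in X W w))
                   (row i (points_in X W w)) &
      forall F : Omega -> R, DomDbar P X W pi F ->
        (exists H, is_nabla P X W pi V F H) /\
        (forall H, is_nabla P X W pi V F H ->
          'E_P[H] =
          'E_P[(fun w => F w * ((count_in X W w)%:R - theta * fine (leb_mx W)))%R])%E].
Proof.
move=> V pi; split.
- exact: vfieldE.
- exact: divergence_vfield.
- by move=> f _ w; exact: nablaE.
- move=> F Fbar; split; first exact: is_nabla_lim.
  by move=> H; exact: (expectation_is_nabla d_gt0 W_window v_bounded_L2 v_orthonormal X_Poisson (ltW theta_gt0)).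
Qed.
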